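(* Let $D\in\{D_4,E_6,E_7,E_8\}$. Then: (i) The elements $T_{w(x)}$, $x\in W$, form a basis of $\mathbf{A}$ as a left $\mathcal{R}$-module. The elements $T_{w(x)}$ for even $x$ form a basis of $\mathbf{H}$ over $\mathcal{R}$. (ii) For every $N\ge 0$, the elements $T_{w(x)}$ with $\mathrm{length}(x)\le N$ form a basis of $F_L^N\mathbf{A}$ as a left $\mathcal{R}$-module. The elements $T_{w(x)}$ for even $x$ of length $\le N$ form a basis of $F_L^N\mathbf{H}$ over $\mathcal{R}$. (iii) The $\mathcal{R}$-modules $F_L^N\mathbf{H}/F_L^{N-1}\mathbf{H}$ and $F_L^N\mathbf{A}/F_L^{N-1}\mathbf{A}$ are free. The Hilbert series of $\mathbf{A}$ and $\mathbf{H}$ under the length filtration are the same as those of $W$ and $W_+$, respectively (with respect to the length function).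
   Context: To $D$ attach integers $m$ and $(d_1,\dots,d_m)$: for $D_4$, $m=4$ and $(2,2,2,2)$; for $E_6$, $m=3$ and $(3,3,3)$; for $E_7$, $m=3$ and $(2,4,4)$; for $E_8$, $m=3$ and $(2,3,6)$. Let $\mathbb{T}$ be the algebraic torus of collections $t=(t_{kj})$, $1\le k\le m$, $1\le j\le d_k$, $t_{kj}\in\mathbb{C}^*$, with $\prod_j t_{kj}=1$ for all $k$; put $u_{kj}=e^{2\pi\mathrm{i}j/d_k}t_{kj}$. Let $\mathcal{R}=\mathbb{C}[\mathbb{T}]\otimes\mathbb{C}[q,q^{-1}]$. $\mathbf{H}$ is the $\mathcal{R}$-algebra generated by $T_1,\dots,T_m$ with relations $\prod_{j=1}^{d_k}(T_k-u_{kj})=0$ ($k=1,\dots,m$), $T_1\cdots T_m=q$. $W$ is the group generated by $s_1,\dots,s_m$ with defining relations $s_k^2=1$, $(s_ks_{k+1})^{d_k}=1$, $k\in\mathbb{Z}/m$ (indices modulo $m$); it is an affine Weyl group, with the usual length function, and $W_+\subset W$ is the subgroup of even elements (elements of even length). Let $f\mapsto\overline{f}$ be the $\mathbb{C}$-algebra automorphism of $\mathcal{R}$ with $\overline{q}=q^{-1}$, $\overline{t_{kj}}=t_{k,-j}^{-1}$ ($-j$ taken modulo $d_k$). $\mathbf{A}$ is the algebra generated by $\mathcal{R}$ and elements $s_1,\dots,s_m$ (indices mod $m$) with defining relations $s_k^2=1$, $s_kf=\overline{f}s_k$ for $f\in\mathcal{R}$, and $\prod_{j=1}^{d_k}(s_ks_{k+1}-q^{-\delta_{km}}u_{kj})=0$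 for $k=1,\dots,m$, where $\delta_{km}$ is the Kronecker delta. There is a homomorphism $\eta:\mathbf{H}\to\mathbf{A}$, $\eta(T_k)=q^{\delta_{km}}s_ks_{k+1}$; it extends to an isomorphism $(\mathbb{C}[\sigma]/(\sigma^2=1))\ltimes\mathbf{H}\to\mathbf{A}$, $\sigma\mapsto s_2$ (for a suitable involution $\sigma$ of $\mathbf{H}$), and $\mathbf{H}$ is identified with its image. The length filtration $F_L^\bullet$ on $\mathbf{A}$ is defined by $\deg(\mathcal{R})=0$, $\deg(s_k)=1$; on $\mathbf{H}\subset\mathbf{A}$ it is the filtration induced from $\mathbf{A}$. For a word $w$ in the letters $s_k$, $T_w\in\mathbf{A}$ is the corresponding product of generators. For each $x\in W$ a reduced decomposition $w(x)$ of $x$ is fixed. *)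

(* Defs.v *)
From HB Require Import structures.
From mathcomp Require Import all_boot all_order all_algebra ring_quotient.
From mathcomp Require Import complex.
From mathcomp Require Import boolp classical_sets functions cardinality reals.
From mathcomp Require Import trigo.

Set Implicit Arguments.
Unset Strict Implicit.
Unset Printing Implicit Defensive.

Import GRing.Theory.
Local Open Scope classical_set_scope.
Local Open Scope complex_scope.
Local Open Scope quotient_scope.
Local Open Scope ring_scope.

(* Groups given by generators and relations.  A relation is a pair of elements
   of the free group, and [freeGroup] is itself the group without relations. *)

Section GroupPresentation.
Variable I : Type.

Inductive gterm :=
  | GOne | GGen of I | GInv of gterm | GMul of gterm & gterm.

HB.instance Definition _ := gen_eqMixin gterm.
HB.instance Definition _ := gen_choiceMixin gterm.

Variable rel : gterm -> gterm -> Prop.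

Inductive gcong : gterm -> gterm -> Prop :=
  | gcong_rel a b : rel a b -> gcong a b
  | gcong_refl a : gcong a a
  | gcong_sym a b : gcong a b -> gcong b a
  | gcong_trans a b c : gcong a b -> gcong b c -> gcong a c
  | gcong_mul a a' b b' :
      gcong a a' -> gcong b b' -> gcong (GMul a b) (GMul a' b')
  | gcong_inv a a' : gcong a a' -> gcong (GInv a) (GInv a')
  | gcong_mulA a b c : gcong (GMul a (GMul b c)) (GMul (GMul a b) c)
  | gcong_mul1 a : gcong (GMul GOne a) a
  | gcong_1mul a : gcong (GMul a GOne) a
  | gcong_mulV a : gcong (GMul (GInv a) a) GOne
  | gcong_Vmul a : gcong (GMul a (GInv a)) GOne.

Definition gcongb a b := `[< gcong a b >].

Lemma gcongb_equiv : equiv_class_of gcongb.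
Proof.
split=> [a|a b|b a c].
- by apply/asboolP/gcong_refl.
- by apply/asboolP/asboolP; apply: gcong_sym.
- by move=> /asboolP ab /asboolP bc; apply/asboolP/gcong_trans/bc.
Qed.
Canonical gcongb_equiv_rel := EquivRelPack gcongb_equiv.

Definition gquo := {eq_quot gcongb}.
HB.instance Definition _ := Choice.on gquo.
HB.instance Definition _ := EqQuotient.on gquo.

Definition gpi : gterm -> gquo := \pi.

Lemma gpiP a b : gcong a b <-> gpi a = gpi b.
Proof.
split=> [ab|/eqmodP/asboolP //]; by apply/eqmodP/asboolP.
Qed.

Lemma gpi_repr a : gcong (repr (gpi a)) a.
Proof. by apply/gpiP; rewrite /gpi reprK. Qed.

Definition gquo_mul (x y : gquo) := gpi (GMul (repr x) (repr y)).
Definition gquo_inv (x : gquo) := gpi (GInv (repr x)).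

Lemma gquo_mulE a b : gquo_mul (gpi a) (gpi b) = gpi (GMul a b).
Proof. by apply/gpiP/gcong_mul; apply: gpi_repr. Qed.
Lemma gquo_invE a : gquo_inv (gpi a) = gpi (GInv a).
Proof. by apply/gpiP/gcong_inv; apply: gpi_repr. Qed.

Lemma gquo_ind (P : gquo -> Prop) : (forall a, P (gpi a)) -> forall x, P x.
Proof. by move=> Pp x; rewrite -[x]reprK; apply: Pp. Qed.

Lemma gquo_mulA : associative gquo_mul.
Proof.
elim/gquo_ind => a; elim/gquo_ind => b; elim/gquo_ind => c.
by rewrite !gquo_mulE; apply/gpiP/gcong_mulA.
Qed.
Lemma gquo_mul1 : left_id (gpi GOne) gquo_mul.
Proof. by elim/gquo_ind => a; rewrite gquo_mulE; apply/gpiP/gcong_mul1. Qed.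
Lemma gquo_1mul : right_id (gpi GOne) gquo_mul.
Proof. by elim/gquo_ind => a; rewrite gquo_mulE; apply/gpiP/gcong_1mul. Qed.
Lemma gquo_mulV : left_inverse (gpi GOne) gquo_inv gquo_mul.
Proof.
by elim/gquo_ind => a; rewrite gquo_invE gquo_mulE; apply/gpiP/gcong_mulV.
Qed.
Lemma gquo_Vmul : right_inverse (gpi GOne) gquo_inv gquo_mul.
Proof.
by elim/gquo_ind => a; rewrite gquo_invE gquo_mulE; apply/gpiP/gcong_Vmul.
Qed.

HB.instance Definition _ := isGroup.Build gquo
  gquo_mulA gquo_mul1 gquo_1mul gquo_mulV gquo_Vmul.

Definition ggen (i : I) : gquo := gpi (GGen i).

End GroupPresentation.

Definition freeGroup (I : Type) := gquo (fun _ _ : gterm I => False).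
HB.instance Definition _ I := Group.on (freeGroup I).

Definition presGroup (I : Type) (rel : freeGroup I -> freeGroup I -> Prop) :=
  gquo (fun a b : gterm I => rel (gpi _ a) (gpi _ b)).
HB.instance Definition _ I rel := Group.on (@presGroup I rel).

(* Rings generated by a ring R (not assumed central) and by elements indexed
   by I, subject to relations.  A relation is a pair of elements of [freeRing],
   the free product of R with the free ring on I. *)

Section RingPresentation.
Variables (R : pzRingType) (I : Type).

Inductive rterm :=
  | RCst of R | RGen of I
  | ROpp of rterm | RAdd of rterm & rterm | RMul of rterm & rterm.

HB.instance Definition _ := gen_eqMixin rterm.
HB.instance Definition _ := gen_choiceMixin rterm.

Variable rel : rterm -> rterm -> Prop.

Inductive rcong : rterm -> rterm -> Prop :=
  | rcong_rel a b : rel a b -> rcong a b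
  | rcong_refl a : rcong a a
  | rcong_sym a b : rcong a b -> rcong b a
  | rcong_trans a b c : rcong a b -> rcong b c -> rcong a c
  | rcong_opp a a' : rcong a a' -> rcong (ROpp a) (ROpp a')
  | rcong_add a a' b b' :
      rcong a a' -> rcong b b' -> rcong (RAdd a b) (RAdd a' b')
  | rcong_mul a a' b b' :
      rcong a a' -> rcong b b' -> rcong (RMul a b) (RMul a' b')
  | rcong_addA a b c : rcong (RAdd a (RAdd b c)) (RAdd (RAdd a b) c)
  | rcong_addC a b : rcong (RAdd a b) (RAdd b a)
  | rcong_add0 a : rcong (RAdd (RCst 0) a) a
  | rcong_addN a : rcong (RAdd (ROpp a) a) (RCst 0)
  | rcong_mulA a b c : rcong (RMul a (RMul b c)) (RMul (RMul a b) c)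
  | rcong_mul1 a : rcong (RMul (RCst 1) a) a
  | rcong_1mul a : rcong (RMul a (RCst 1)) a
  | rcong_mulDl a b c : rcong (RMul (RAdd a b) c) (RAdd (RMul a c) (RMul b c))
  | rcong_mulDr a b c : rcong (RMul a (RAdd b c)) (RAdd (RMul a b) (RMul a c))
  | rcong_cstD x y : rcong (RCst (x + y)) (RAdd (RCst x) (RCst y))
  | rcong_cstM x y : rcong (RCst (x * y)) (RMul (RCst x) (RCst y)).

Definition rcongb a b := `[< rcong a b >].

Lemma rcongb_equiv : equiv_class_of rcongb.
Proof.
split=> [a|a b|b a c].
- by apply/asboolP/rcong_refl.
- by apply/asboolP/asboolP; apply: rcong_sym.
- by move=> /asboolP ab /asboolP bc; apply/asboolP/rcong_trans/bc.
Qed.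
Canonical rcongb_equiv_rel := EquivRelPack rcongb_equiv.

Definition rquo := {eq_quot rcongb}.
HB.instance Definition _ := Choice.on rquo.
HB.instance Definition _ := EqQuotient.on rquo.

Definition rpi : rterm -> rquo := \pi.

Lemma rpiP a b : rcong a b <-> rpi a = rpi b.
Proof.
split=> [ab|/eqmodP/asboolP //]; by apply/eqmodP/asboolP.
Qed.

Lemma rpi_repr a : rcong (repr (rpi a)) a.
Proof. by apply/rpiP; rewrite /rpi reprK. Qed.

Definition rquo_opp (x : rquo) := rpi (ROpp (repr x)).
Definition rquo_add (x y : rquo) := rpi (RAdd (repr x) (repr y)).
Definition rquo_mul (x y : rquo) := rpi (RMul (repr x) (repr y)).

Lemma rquo_oppE a : rquo_opp (rpi a) = rpi (ROpp a).
Proof. by apply/rpiP/rcong_opp; apply: rpi_repr. Qed.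
Lemma rquo_addE a b : rquo_add (rpi a) (rpi b) = rpi (RAdd a b).
Proof. by apply/rpiP/rcong_add; apply: rpi_repr. Qed.
Lemma rquo_mulE a b : rquo_mul (rpi a) (rpi b) = rpi (RMul a b).
Proof. by apply/rpiP/rcong_mul; apply: rpi_repr. Qed.
Let E := (rquo_oppE, rquo_addE, rquo_mulE).

Lemma rquo_ind (P : rquo -> Prop) : (forall a, P (rpi a)) -> forall x, P x.
Proof. by move=> Pp x; rewrite -[x]reprK; apply: Pp. Qed.

Lemma rquo_addA : associative rquo_add.
Proof.
elim/rquo_ind => a; elim/rquo_ind => b; elim/rquo_ind => c.
by rewrite !E; apply/rpiP/rcong_addA.
Qed.
Lemma rquo_addC : commutative rquo_add.
Proof.
by elim/rquo_ind => a; elim/rquo_ind => b; rewrite !E; apply/rpiP/rcong_addC.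
Qed.
Lemma rquo_add0 : left_id (rpi (RCst 0)) rquo_add.
Proof. by elim/rquo_ind => a; rewrite !E; apply/rpiP/rcong_add0. Qed.
Lemma rquo_addN : left_inverse (rpi (RCst 0)) rquo_opp rquo_add.
Proof. by elim/rquo_ind => a; rewrite !E; apply/rpiP/rcong_addN. Qed.

HB.instance Definition _ :=
  GRing.isZmodule.Build rquo rquo_addA rquo_addC rquo_add0 rquo_addN.

Lemma rquo_mulA : associative rquo_mul.
Proof.
elim/rquo_ind => a; elim/rquo_ind => b; elim/rquo_ind => c.
by rewrite !E; apply/rpiP/rcong_mulA.
Qed.
Lemma rquo_mul1 : left_id (rpi (RCst 1)) rquo_mul.
Proof. by elim/rquo_ind => a; rewrite !E; apply/rpiP/rcong_mul1. Qed.
Lemma rquo_1mul : right_id (rpi (RCst 1)) rquo_mul.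
Proof. by elim/rquo_ind => a; rewrite !E; apply/rpiP/rcong_1mul. Qed.
Lemma rquo_mulDl : left_distributive rquo_mul +%R.
Proof.
elim/rquo_ind => a; elim/rquo_ind => b; elim/rquo_ind => c.
by rewrite -[_ + _]/(rquo_add _ _) -[RHS]/(rquo_add _ _) !E;
  apply/rpiP/rcong_mulDl.
Qed.
Lemma rquo_mulDr : right_distributive rquo_mul +%R.
Proof.
elim/rquo_ind => a; elim/rquo_ind => b; elim/rquo_ind => c.
by rewrite -[_ + _]/(rquo_add _ _) -[RHS]/(rquo_add _ _) !E;
  apply/rpiP/rcong_mulDr.
Qed.

HB.instance Definition _ := GRing.Zmodule_isPzRing.Build rquo
  rquo_mulA rquo_mul1 rquo_1mul rquo_mulDl rquo_mulDr.

Lemma rpiN a : rpi (ROpp a) = - rpi a.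
Proof. by rewrite -rquo_oppE. Qed.
Lemma rpiD a b : rpi (RAdd a b) = rpi a + rpi b.
Proof. by rewrite -rquo_addE. Qed.
Lemma rpiM a b : rpi (RMul a b) = rpi a * rpi b.
Proof. by rewrite -rquo_mulE. Qed.

Definition rgen (i : I) : rquo := rpi (RGen i).
Definition rcst (x : R) : rquo := rpi (RCst x).

Lemma rcstD x y : rcst (x + y) = rcst x + rcst y.
Proof. by rewrite /rcst -rpiD; apply/rpiP/rcong_cstD. Qed.
Lemma rcst_zmod_morphism : zmod_morphism rcst.
Proof. by move=> x y; apply/eqP; rewrite eq_sym subr_eq -rcstD subrK. Qed.
Lemma rcst_monoid_morphism : monoid_morphism rcst.
Proof.
by split=> // x y; rewrite /rcst -rpiM; apply/rpiP/rcong_cstM.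
Qed.
HB.instance Definition _ :=
  GRing.isZmodMorphism.Build R rquo rcst rcst_zmod_morphism.
HB.instance Definition _ :=
  GRing.isMonoidMorphism.Build R rquo rcst rcst_monoid_morphism.

Definition rquo_scale (x : R) (a : rquo) : rquo := rcst x * a.

Fact rquo_scaleA x y a :
  rquo_scale x (rquo_scale y a) = rquo_scale (x * y) a.
Proof. by rewrite /rquo_scale rmorphM mulrA. Qed.
Fact rquo_scale1 : left_id 1 rquo_scale.
Proof. by move=> a; rewrite /rquo_scale rmorph1 mul1r. Qed.
Fact rquo_scaleDr : right_distributive rquo_scale +%R.
Proof. by move=> x a b; rewrite /rquo_scale mulrDr. Qed.
Fact rquo_scaleDl a : {morph rquo_scale^~ a : x y / x + y}.
Proof. by move=> x y; rewrite /rquo_scale rmorphD mulrDl. Qed.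
HB.instance Definition _ := GRing.Zmodule_isLmodule.Build R rquo
  rquo_scaleA rquo_scale1 rquo_scaleDr rquo_scaleDl.

Lemma rscaleE (x : R) (a : rquo) : x *: a = rcst x * a.
Proof. by []. Qed.

(* Universal property. *)
Section Lift.
Variables (B : pzRingType) (f : {rmorphism R -> B}) (g : I -> B).

Fixpoint reval (a : rterm) : B :=
  match a with
  | RCst x => f x
  | RGen i => g i
  | ROpp a => - reval a
  | RAdd a b => reval a + reval b
  | RMul a b => reval a * reval b
  end.

Hypothesis reval_rel : forall a b, rel a b -> reval a = reval b.

Lemma reval_cong a b : rcong a b -> reval a = reval b.
Proof.
elim=> {a b} //=.
- by move=> a b c _ -> _ ->.
- by move=> a a' _ ->.
- by move=> a a' b b' _ -> _ ->.
- by move=> a a' b b' _ -> _ ->.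
- by move=> a b c; rewrite addrA.
- by move=> a b; rewrite addrC.
- by move=> a; rewrite rmorph0 add0r.
- by move=> a; rewrite addNr rmorph0.
- by move=> a b c; rewrite mulrA.
- by move=> a; rewrite rmorph1 mul1r.
- by move=> a; rewrite rmorph1 mulr1.
- by move=> a b c; rewrite mulrDl.
- by move=> a b c; rewrite mulrDr.
- by move=> x y; rewrite rmorphD.
- by move=> x y; rewrite rmorphM.
Qed.

Definition rlift of (forall a b, rel a b -> reval a = reval b) :=
  fun x : rquo => reval (repr x).

Local Notation lift := (rlift reval_rel).

Lemma rlift_pi a : lift (rpi a) = reval a.
Proof. exact: reval_cong (rpi_repr a). Qed.

Lemma rlift_zmod_morphism : zmod_morphism lift.
Proof.
by elim/rquo_ind => a; elim/rquo_ind => b; rewrite -rpiN -rpiD !rlift_pi.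
Qed.
Lemma rlift_monoid_morphism : monoid_morphism lift.
Proof.
split; first by rewrite rlift_pi /= rmorph1.
by elim/rquo_ind => a; elim/rquo_ind => b; rewrite -rpiM !rlift_pi.
Qed.
HB.instance Definition _ :=
  GRing.isZmodMorphism.Build rquo B lift rlift_zmod_morphism.
HB.instance Definition _ :=
  GRing.isMonoidMorphism.Build rquo B lift rlift_monoid_morphism.

End Lift.
End RingPresentation.

Definition freeRing (R : pzRingType) (I : Type) :=
  rquo (fun _ _ : rterm R I => False).
HB.instance Definition _ R I := GRing.PzRing.on (freeRing R I).

Definition freeCst (R : pzRingType) (I : Type) : R -> freeRing R I :=
  @rcst R I _.
HB.instance Definition _ R I := GRing.RMorphism.on (@freeCst R I).
Definition freeGen (R : pzRingType) (I : Type) : I -> freeRing R I :=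
  @rgen R I _.

Definition presRing (R : pzRingType) (I : Type)
    (rel : freeRing R I -> freeRing R I -> Prop) :=
  rquo (fun a b : rterm R I => rel (rpi _ a) (rpi _ b)).
HB.instance Definition _ R I rel := GRing.PzRing.on (@presRing R I rel).
HB.instance Definition _ R I rel := GRing.Lmodule.on (@presRing R I rel).

Section PresRing.
Variables (R : pzRingType) (I : Type) (rel : freeRing R I -> freeRing R I -> Prop).

Definition presCst : R -> presRing rel := @rcst R I _.
HB.instance Definition _ := GRing.RMorphism.on presCst.
Definition presGen : I -> presRing rel := @rgen R I _.

Variables (B : pzRingType) (f : {rmorphism R -> B}) (g : I -> B).

Lemma reval_False (a b : rterm R I) : False -> reval f g a = reval f g b.
Proof. by []. Qed.

Definition freeLift : freeRing R I -> B := rlift reval_False.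
HB.instance Definition _ := GRing.RMorphism.on freeLift.

Lemma freeLift_pi a : freeLift (rpi _ a) = reval f g a.
Proof. exact: rlift_pi. Qed.
Lemma freeLift_cst x : freeLift (freeCst I x) = f x.
Proof. exact: freeLift_pi. Qed.
Lemma freeLift_gen i : freeLift (freeGen R i) = g i.
Proof. exact: freeLift_pi. Qed.

Definition respects := forall x y, rel x y -> freeLift x = freeLift y.

Lemma respects_reval : respects ->
  forall a b, rel (rpi _ a) (rpi _ b) -> reval f g a = reval f g b.
Proof. by move=> relP a b /relP; rewrite !freeLift_pi. Qed.

Definition presLift (relP : respects) : presRing rel -> B :=
  rlift (respects_reval relP).
HB.instance Definition _ relP := GRing.RMorphism.on (presLift relP).

Lemma presLift_cst relP x : presLift relP (presCst x) = f x.
Proof. exact: rlift_pi. Qed.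
Lemma presLift_gen relP i : presLift relP (presGen i) = g i.
Proof. exact: rlift_pi. Qed.

End PresRing.

Section PresRingRel.
Variables (R : pzRingType) (I : Type) (rel : freeRing R I -> freeRing R I -> Prop).

Definition free_to_pres := freeLift (@presCst R I rel) (@presGen R I rel).
HB.instance Definition _ := GRing.RMorphism.on free_to_pres.

Lemma free_to_pres_pi a : free_to_pres (rpi _ a) = rpi _ a.
Proof.
rewrite /free_to_pres freeLift_pi.
by elim: a => //= [a -> | a -> b -> | a -> b ->]; rewrite ?rpiN ?rpiD ?rpiM.
Qed.

Lemma free_to_pres_cst x : free_to_pres (freeCst I x) = presCst rel x.
Proof. exact: freeLift_cst. Qed.
Lemma free_to_pres_gen i : free_to_pres (freeGen R i) = presGen rel i.
Proof. exact: freeLift_gen. Qed.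

Lemma pres_rel x y : rel x y -> free_to_pres x = free_to_pres y.
Proof.
elim/rquo_ind: x => a; elim/rquo_ind: y => b ab.
by rewrite !free_to_pres_pi; apply/rpiP/rcong_rel.
Qed.

End PresRingRel.

Section Modules.
Variables (R : pzRingType) (M : lmodType R).
Implicit Types (S : set M).

(* The family (b x), x in P, is a basis of the submodule S of M. *)
Definition is_basis (X : choiceType) (S : set M) (P : set X) (b : X -> M) :=
  [/\ forall x, P x -> S (b x),
      forall v, S v -> exists (s : seq X) (c : X -> R),
        {in s, forall x, P x} /\ v = \sum_(x <- s) c x *: b x
    & forall (s : seq X) (c : X -> R), uniq s -> {in s, forall x, P x} ->
        \sum_(x <- s) c x *: b x = 0 -> {in s, forall x, c x = 0}].

Definition is_free S :=
  exists (X : choiceType) (b : X -> M), is_basis S [set: X] b.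

Definition is_free_of_rank S (n : nat) :=
  exists b : 'I_n -> M, is_basis S [set: 'I_n] b.

End Modules.

(* For an injective iota, this says that the family b', which lies in the image
   of iota, is a basis of S when M is identified with that image. *)
Definition is_basis_along (R : pzRingType) (M M' : lmodType R) (iota : M -> M')
    (X : choiceType) (S : set M) (P : set X) (b' : X -> M') :=
  exists b : X -> M, (forall x, P x -> iota (b x) = b' x) /\ is_basis S P b.

Section QuotientModule.
Variables (R : pzRingType) (M : lmodType R) (G : submodClosed M).

Definition submod_pred : {pred M} := G.
HB.instance Definition _ := GRing.isZmodClosed.Build M submod_pred
  (GRing.submod_closedB (GRing.submodClosedP G)).

Definition quomod := Quotient.quot submod_pred.
HB.instance Definition _ := GRing.Zmodule.on quomod.

Definition quopi (v : M) : quomod := \pi v.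

Definition quo_scale (x : R) (v : quomod) : quomod := quopi (x *: repr v).

Lemma quopiP u v : quopi u = quopi v <-> u - v \in G.
Proof.
by rewrite -[_ \in G]/(_ \in submod_pred) Quotient.idealrBE; split=> [uv|/eqP//]; apply/eqP.
Qed.

Lemma quo_scaleE x v : quo_scale x (quopi v) = quopi (x *: v).
Proof.
apply/quopiP; rewrite -scalerBr rpredZ //.
by apply/quopiP; rewrite /quopi reprK.
Qed.

Lemma quopiD u v : quopi (u + v) = quopi u + quopi v.
Proof. by rewrite /quopi Quotient.pi_add. Qed.

Lemma quo_ind (P : quomod -> Prop) : (forall v, P (quopi v)) -> forall x, P x.
Proof. by move=> Pp x; rewrite -[x]reprK; apply: Pp. Qed.

Fact quo_scaleA x y v : quo_scale x (quo_scale y v) = quo_scale (x * y) v.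
Proof. by elim/quo_ind: v => v; rewrite !quo_scaleE scalerA. Qed.
Fact quo_scale1 : left_id 1 quo_scale.
Proof. by elim/quo_ind => v; rewrite quo_scaleE scale1r. Qed.
Fact quo_scaleDr : right_distributive quo_scale +%R.
Proof.
move=> x; elim/quo_ind => u; elim/quo_ind => v.
by rewrite -quopiD !quo_scaleE -quopiD scalerDr.
Qed.
Fact quo_scaleDl v : {morph quo_scale^~ v : x y / x + y}.
Proof.
by move=> x y; elim/quo_ind: v => v; rewrite !quo_scaleE -quopiD scalerDl.
Qed.
HB.instance Definition _ := GRing.Zmodule_isLmodule.Build R quomod
  quo_scaleA quo_scale1 quo_scaleDr quo_scaleDl.

End QuotientModule.

Section Filtration.
Variables (R : pzRingType) (M : lmodType R).

Definition zeromod : {pred M} := fun v => v == 0.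
Lemma zeromod_submod_closed : submod_closed zeromod.
Proof.
split=> [|x u v]; rewrite !unfold_in ?eqxx // => /eqP -> /eqP ->.
by rewrite scaler0 addr0.
Qed.
HB.instance Definition _ :=
  GRing.isSubmodClosed.Build R M zeromod zeromod_submod_closed.

Variable F : nat -> submodClosed M.

(* F^(N-1), with F^(-1) = 0. *)
Definition filprev (N : nat) : submodClosed M :=
  if N is n.+1 then F n else zeromod.

(* F^N / F^(N-1), as a submodule of M / F^(N-1). *)
Definition gr (N : nat) : set (quomod (filprev N)) :=
  [set quopi (filprev N) v | v in [set` F N]].

(* sum_N (h N) z^N is the Hilbert series of the filtration. *)
Definition hilbert_series (h : nat -> nat) :=
  forall N, is_free_of_rank (@gr N) (h N).

End Filtration.
Arguments gr {R M} F N.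

Inductive diagram := D4 | E6 | E7 | E8.

Definition dseq (D : diagram) : seq nat :=
  match D with
  | D4 => [:: 2; 2; 2; 2]
  | E6 => [:: 3; 3; 3]
  | E7 => [:: 2; 4; 4]
  | E8 => [:: 2; 3; 6]
  end.

Definition m (D : diagram) : nat := size (dseq D).
(* Indices k = 1, ..., m become k = 0, ..., m - 1 in 'I_m, and k + 1 modulo m
   is [ordS k]. *)
Definition d (D : diagram) (k : 'I_(m D)) : nat := nth 0 (dseq D) k.

(* The Kronecker delta_(k,m). *)
Definition delta (D : diagram) (k : 'I_(m D)) : nat := (k.+1 == m D).

Section Torus.
Variables (C : fieldType) (D : diagram).

(* As all d k are at least 2, 'Z_(d k) is Z/(d k); the index j = d k is 0. *)
Record torus := Torus {
  tcoord : forall k : 'I_(m D), 'Z_(d k) -> C;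
  tcoord_neq0 : forall k j, @tcoord k j != 0;
  tcoord_prod : forall k, \prod_j @tcoord k j = 1 }.

Definition points : Type := torus * {x : C | x != 0}.

Definition t_fun (k : 'I_(m D)) (j : 'Z_(d k)) : points -> C :=
  fun p => tcoord p.1 j.
Definition tV_fun (k : 'I_(m D)) (j : 'Z_(d k)) : points -> C :=
  fun p => (tcoord p.1 j)^-1.
Definition q_fun : points -> C := fun p => val p.2.
Definition qV_fun : points -> C := fun p => (val p.2)^-1.

(* C[T] (x) C[q, q^-1] is the coordinate ring of T x C^*, i.e. the ring of
   functions generated by the constants, the coordinates and their inverses. *)
Inductive regular : (points -> C) -> Prop :=
  | regular_cst c : regular (cst c)
  | regular_t k j : regular (@t_fun k j)
  | regular_tV k j : regular (@tV_fun k j)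
  | regular_q : regular q_fun
  | regular_qV : regular qV_fun
  | regular_add f g : regular f -> regular g -> regular (f + g)
  | regular_mul f g : regular f -> regular g -> regular (f * g).

Definition regularb : {pred points -> C} := fun f => `[< regular f >].

Lemma regularbP f : reflect (regular f) (f \in regularb).
Proof. exact: asboolP. Qed.

Lemma regularb_subring_closed : subring_closed regularb.
Proof.
have regN f : regular f -> regular (- f).
  by move=> rf; rewrite -mulN1r; apply/regular_mul/rf/(regular_cst (- 1)).
split=> [|f g /regularbP rf /regularbP rg|f g /regularbP rf /regularbP rg].
- by apply/regularbP/(regular_cst 1).
- by apply/regularbP/regular_add/regN.
- by apply/regularbP/regular_mul.
Qed.
HB.instance Definition _ :=
  GRing.isSubringClosed.Build _ regularb regularb_subring_closed.

Record coordRing := CoordRing {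
  coordRing_fun :> points -> C;
  coordRing_regular : coordRing_fun \in regularb }.

HB.instance Definition _ := [isSub for coordRing_fun].
HB.instance Definition _ := [Choice of coordRing by <:].
HB.instance Definition _ := GRing.SubChoice_isSubComPzRing.Build
  (points -> C) regularb coordRing (GRing.subringClosedP regularb).

Definition mkregular f (rf : regular f) : coordRing :=
  CoordRing (introT (regularbP f) rf).

Definition rc (c : C) : coordRing := mkregular (regular_cst c).
Definition rt (k : 'I_(m D)) (j : 'Z_(d k)) : coordRing :=
  mkregular (regular_t j).
Definition rtV (k : 'I_(m D)) (j : 'Z_(d k)) : coordRing :=
  mkregular (regular_tV j).
Definition rq : coordRing := mkregular regular_q.
Definition rqV : coordRing := mkregular regular_qV.

Lemma coordRing_eq (f g : coordRing) : (forall p, f p = g p) -> f = g.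
Proof. by move=> fg; apply/val_inj/funext. Qed.

Lemma rqVK : rq * rqV = 1.
Proof.
by apply: coordRing_eq => p; apply: mulfV; apply: (valP p.2).
Qed.

(* The bar automorphism is composition with the involution
   (t, q) |-> ((t_(k,-j)^-1), q^-1) of T x C^*. *)
Lemma torus_bar_neq0 (t : torus) k (j : 'Z_(d k)) : (tcoord t (- j))^-1 != 0.
Proof. by rewrite invr_eq0 tcoord_neq0. Qed.

Lemma torus_bar_prod (t : torus) k :
  \prod_(j : 'Z_(d k)) (tcoord t (- j))^-1 = 1.
Proof.
rewrite prodfV (reindex_inj oppr_inj) /=.
by under eq_bigr do rewrite opprK; rewrite tcoord_prod invr1.
Qed.

Definition torus_bar (t : torus) : torus :=
  Torus (torus_bar_neq0 t) (torus_bar_prod t).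

Lemma cstar_inv_neq0 (x : {x : C | x != 0}) : (val x)^-1 != 0.
Proof. by rewrite invr_eq0 (valP x). Qed.

Definition points_bar (p : points) : points :=
  (torus_bar p.1, exist _ (val p.2)^-1 (cstar_inv_neq0 p.2)).

Lemma regular_bar f : regular f -> regular (f \o points_bar).
Proof.
elim=> {f} [c|k j|k j|||f g _ rf _ rg|f g _ rf _ rg].
- exact: regular_cst.
- exact: (regular_tV (- j)).
- rewrite (_ : _ \o _ = t_fun (- j)); first exact: regular_t.
  by apply/funext => p; rewrite /tV_fun /= invrK.
- exact: regular_qV.
- rewrite (_ : _ \o _ = q_fun); first exact: regular_q.
  by apply/funext => p; rewrite /qV_fun /= invrK.
- exact: regular_add rf rg.
- exact: regular_mul rf rg.
Qed.

Definition bar (f : coordRing) : coordRing :=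
  mkregular (regular_bar (elimT (regularbP f) (coordRing_regular f))).

Lemma bar_zmod_morphism : zmod_morphism bar.
Proof. by move=> f g; apply: coordRing_eq. Qed.
Lemma bar_monoid_morphism : monoid_morphism bar.
Proof. by split=> [|f g]; apply: coordRing_eq. Qed.
HB.instance Definition _ :=
  GRing.isZmodMorphism.Build coordRing coordRing bar bar_zmod_morphism.
HB.instance Definition _ :=
  GRing.isMonoidMorphism.Build coordRing coordRing bar bar_monoid_morphism.

Lemma bar_cst c : bar (rc c) = rc c.
Proof. exact: coordRing_eq. Qed.
Lemma bar_q : bar rq = rqV.
Proof. exact: coordRing_eq. Qed.
Lemma bar_t k (j : 'Z_(d k)) : bar (rt j) = rtV (- j).
Proof. exact: coordRing_eq. Qed.

Lemma points_barK : involutive points_bar.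
Proof.
have torus_eq (t t' : torus) :
    (forall k (j : 'Z_(d k)), tcoord t j = tcoord t' j) -> t = t'.
  case: t t' => [a a0 a1] [b b0 b1] /= ab.
  have {}ab : a = b by apply: functional_extensionality_dep => k; apply/funext.
  by subst b; congr Torus; apply: Prop_irrelevance.
case=> t x; congr pair; last by apply/val_inj/invrK.
by apply: torus_eq => k j /=; rewrite invrK opprK.
Qed.

Lemma barK : involutive bar.
Proof. by move=> f; apply: coordRing_eq => p /=; rewrite points_barK. Qed.

End Torus.

Section WeylGroup.
Variable D : diagram.
Local Notation s := (@ggen 'I_(m D) _).
Local Open Scope group_scope.

Inductive relW : freeGroup 'I_(m D) -> freeGroup 'I_(m D) -> Prop :=
  | relW_sq k : relW (s k ^+ 2) 1
  | relW_braid k : relW ((s k * s (ordS k)) ^+ d k) 1.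

Definition W := presGroup relW.
HB.instance Definition _ := Group.on W.

Definition sW (k : 'I_(m D)) : W := @ggen 'I_(m D) _ k.

Definition wordW (w : seq 'I_(m D)) : W := \prod_(k <- w) sW k.

Lemma sW_sq k : sW k * sW k = 1.
Proof.
have E : s k ^+ 2 = gpi _ (GMul (GGen k) (GGen k)) :> freeGroup 'I_(m D).
  exact: gquo_mulE.
rewrite -[LHS]/(gquo_mul (gpi _ _) (gpi _ _)) gquo_mulE.
by apply/gpiP/gcong_rel; have := relW_sq k; rewrite E.
Qed.

Lemma wordW_surj (x : W) : exists w, wordW w = x.
Proof.
elim/gquo_ind: x; elim=> [|k|a [w wE]|a [w wE] b [v vE]].
- by exists [::]; rewrite /wordW big_nil.
- by exists [:: k]; rewrite /wordW big_seq1.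
- exists (rev w); rewrite -gquo_invE -wE.
  elim: w {wE} => [|k w IHw]; rewrite /wordW ?big_nil; first by rewrite -[LHS]invg1.
  rewrite rev_cons -cats1 big_cat big_seq1 big_cons /=.
  rewrite -[RHS]/((sW k * wordW w)^-1) invgM; congr (_ * _); first exact: IHw.
  by rewrite -[LHS]mulg1 -(mulgV (sW k)) mulgA sW_sq mul1g.
- by exists (w ++ v); rewrite -gquo_mulE -wE -vE /wordW big_cat.
Qed.

Lemma length_proof (x : W) :
  exists n, `[< exists2 w, wordW w = x & size w = n >].
Proof.
by have [w wE] := wordW_surj x; exists (size w); apply/asboolP; exists w.
Qed.

Definition lengthW (x : W) : nat := ex_minn (length_proof x).

Definition evenW : set W := [set x | ~~ odd (lengthW x)].

Definition reduced_decomposition (x : W) (w : seq 'I_(m D)) :=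
  wordW w = x /\ size w = lengthW x.

(* sum_N (h N) z^N is the Hilbert series of the subset P for the length. *)
Definition length_series (P : set W) (h : nat -> nat) :=
  forall N, ([set x | P x /\ lengthW x = N] #= `I_(h N))%card.

End WeylGroup.

Lemma prod_comm_mull (B : pzRingType) (J : finType) (a : B) (F : J -> B) :
  (forall j, a * F j = F j * a) ->
  exists n, \prod_j (a * F j) = a ^+ n * \prod_j F j.
Proof.
move=> aF; elim: (index_enum J) => [|j s [n IHs]].
  by exists 0; rewrite !big_nil mul1r.
exists n.+1; rewrite !big_cons IHs.
have E : F j * a ^+ n = a ^+ n * F j.
  by apply: commrX; rewrite /GRing.comm aF.
by rewrite exprS mulrA -(mulrA a) E !mulrA.
Qed.

Lemma prod_cyclic (B : pzRingType) (n : nat) (s : 'I_n -> B) (x : B) :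
    (0 < n)%N -> (forall k, s k * s k = 1) ->
    (forall k l, s k * (s l * x * s l) * s k = x) ->
  \prod_(k < n) (x ^+ (k.+1 == n) * s k * s (ordS k)) = x.
Proof.
case: n s => // n s _ ss sx; rewrite big_ord_recr /= eqxx expr1.
pose sn i := s (inord i).
have -> : \prod_(i < n) (x ^+ ((widen_ord (leqnSn n) i).+1 == n.+1) *
    s (widen_ord (leqnSn n) i) * s (ordS (widen_ord (leqnSn n) i))) =
    \prod_(i < n) (sn i * sn i.+1).
  apply: eq_bigr => i _; rewrite /= eqSS ltn_eqF // expr0 mul1r.
  have lin : (i < n.+1)%N := ltnW (ltn_ord i).
  have lin1 : (i.+1 < n.+1)%N := ltn_ord i.
  rewrite /sn; congr (_ * _); congr s; apply: val_inj; rewrite /= inordK //.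
  by rewrite modn_small.
have tel p : \prod_(i < p) (sn i * sn i.+1) = sn 0 * sn p.
  elim: p => [|p IHp]; first by rewrite big_ord0 ss.
  by rewrite big_ord_recr IHp /= mulrA -(mulrA (sn 0)) ss mulr1.
rewrite (tel n).
have -> : ordS (@ord_max n) = inord 0.
  by apply: val_inj; rewrite /= inordK // modnn.
have -> : @ord_max n = inord n by apply: val_inj; rewrite /= inordK.
by rewrite -{2}(sx (inord 0) (inord n)) !mulrA.
Qed.

Section Algebras.
Variables (K : realType) (D : diagram).

Definition RR := coordRing K[i] D.
HB.instance Definition _ := GRing.ComPzRing.on RR.

(* e^(ix) *)
Definition cexp (x : K) : K[i] := cos x +i* sin x.

Definition u (k : 'I_(m D)) (j : 'Z_(d k)) : RR :=
  rc D (cexp (2 * pi * j%:R / (d k)%:R)) * rt K[i] j.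

Local Notation q := (rq K[i] D : RR).
Local Notation qV := (rqV K[i] D : RR).
Local Notation c := (@freeCst RR 'I_(m D)).
Local Notation X := (@freeGen RR 'I_(m D)).
Local Notation free := (freeRing RR 'I_(m D)).

Inductive relA : free -> free -> Prop :=
  | relA_sq k : relA (X k ^+ 2) 1
  | relA_bar k f : relA (X k * c f) (c (bar f) * X k)
  | relA_poly k :
      relA (\prod_j (X k * X (ordS k) - c (qV ^+ delta k * @u k j))) 0.

Definition A := presRing relA.
HB.instance Definition _ := GRing.PzRing.on A.
HB.instance Definition _ := GRing.Lmodule.on A.

Definition cstA : RR -> A := @presCst RR 'I_(m D) relA.
HB.instance Definition _ := GRing.RMorphism.on cstA.
Definition sA : 'I_(m D) -> A := @presGen RR 'I_(m D) relA.

Inductive relH : free -> free -> Prop :=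
  | relH_central k f : relH (X k * c f) (c f * X k)
  | relH_poly k : relH (\prod_j (X k - c (@u k j))) 0
  | relH_prod : relH (\prod_(k < m D) X k) (c q).

Definition H := presRing relH.
HB.instance Definition _ := GRing.PzRing.on H.
HB.instance Definition _ := GRing.Lmodule.on H.

Definition cstH : RR -> H := @presCst RR 'I_(m D) relH.
HB.instance Definition _ := GRing.RMorphism.on cstH.
Definition TH : 'I_(m D) -> H := @presGen RR 'I_(m D) relH.

Lemma sA_sq k : sA k * sA k = 1.
Proof.
have := pres_rel (relA_sq k).
by rewrite rmorphXn rmorph1 /= free_to_pres_gen expr2.
Qed.

Lemma sA_cst k f : sA k * cstA f = cstA (bar f) * sA k.
Proof.
have := pres_rel (relA_bar k f).
by rewrite !rmorphM /= !free_to_pres_cst free_to_pres_gen.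
Qed.

Lemma sA_poly k :
  \prod_j (sA k * sA (ordS k) - cstA (qV ^+ delta k * @u k j)) = 0.
Proof.
have := pres_rel (relA_poly k); rewrite rmorph0 rmorph_prod => <-.
apply: eq_bigr => j _.
rewrite rmorphB /= free_to_pres_cst; congr (_ - _).
by rewrite rmorphM /= !free_to_pres_gen.
Qed.

Definition etaT (k : 'I_(m D)) : A := cstA (q ^+ delta k) * sA k * sA (ordS k).

Lemma ssA_cst k f :
  sA k * sA (ordS k) * cstA f = cstA f * (sA k * sA (ordS k)).
Proof. by rewrite -mulrA sA_cst mulrA sA_cst barK mulrA. Qed.

Lemma etaT_prod : \prod_(k < m D) etaT k = cstA q.
Proof.
under eq_bigr do rewrite /etaT rmorphXn.
apply: prod_cyclic => [|k|k l]; first by case: (D).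
  exact: sA_sq.
rewrite sA_cst -(mulrA (cstA _)) sA_sq mulr1 sA_cst -mulrA sA_sq mulr1.
by rewrite barK.
Qed.

Lemma eta_respects : respects relH cstA etaT.
Proof.
move=> x y [k f|k|].
- rewrite !rmorphM /= !freeLift_cst freeLift_gen /etaT.
  rewrite -!mulrA [X in _ * X]mulrA ssA_cst !mulrA -!rmorphM.
  by rewrite [_ * f]mulrC.
- rewrite rmorph_prod rmorph0.
  set v := fun j => cstA (qV ^+ delta k * u (k := k) j).
  transitivity (\prod_(j : 'Z_(d k))
    (cstA (q ^+ delta k) * (sA k * sA (ordS k) - v j))).
    apply: eq_bigr => j _; rewrite rmorphB /= freeLift_cst freeLift_gen.
    rewrite mulrBr /etaT mulrA; congr (_ - _); rewrite /v -rmorphM mulrA.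
    by rewrite -exprMn rqVK expr1n mul1r.
  have [j|n ->] := @prod_comm_mull A _ (cstA (q ^+ delta k))
    (fun j => sA k * sA (ordS k) - v j); last by rewrite sA_poly mulr0.
  by rewrite mulrBr mulrBl ssA_cst /v -!rmorphM [_ * (qV ^+ _ * _)]mulrC.
- rewrite rmorph_prod /= freeLift_cst.
  by under eq_bigr do rewrite freeLift_gen; exact: etaT_prod.
Qed.

Definition etaHA : H -> A := presLift eta_respects.
HB.instance Definition _ := GRing.RMorphism.on etaHA.

Lemma eta_cst f : etaHA (cstH f) = cstA f.
Proof. exact: presLift_cst. Qed.
Lemma eta_T k : etaHA (TH k) = cstA (q ^+ delta k) * sA k * sA (ordS k).
Proof. exact: presLift_gen. Qed.

Lemma eta_scale f a : etaHA (f *: a) = f *: etaHA a.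
Proof. by rewrite (rmorphM etaHA (cstH f) a) /= eta_cst. Qed.

(* length_le n is F_L^n A: the smallest ring filtration with R in degree 0 and
   the s_k in degree 1. *)
Inductive length_le : nat -> A -> Prop :=
  | length_le_cst f : length_le 0 (cstA f)
  | length_le_s k : length_le 1 (sA k)
  | length_le_leq n p a : (n <= p)%N -> length_le n a -> length_le p a
  | length_le_add n a b : length_le n a -> length_le n b -> length_le n (a + b)
  | length_le_mul n p a b :
      length_le n a -> length_le p b -> length_le (n + p) (a * b).

Definition FLA_pred (N : nat) : {pred A} := fun a => `[< length_le N a >].
Definition FLH_pred (N : nat) : {pred H} := fun h => etaHA h \in FLA_pred N.

Lemma FLA_submod_closed N : submod_closed (FLA_pred N).
Proof.
split=> [|f a b /asboolP la /asboolP lb]; apply/asboolP.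
  by rewrite -(rmorph0 cstA); apply: (length_le_leq (leq0n N)); constructor.
apply: length_le_add => //; rewrite -[N]add0n -[_ *: _]/(cstA f * a).
by apply: length_le_mul => //; constructor.
Qed.
HB.instance Definition _ N :=
  GRing.isSubmodClosed.Build RR A (FLA_pred N) (FLA_submod_closed N).

Lemma FLH_submod_closed N : submod_closed (FLH_pred N).
Proof.
split=> [|f a b]; rewrite /FLH_pred -!topredE /=; first by rewrite rmorph0 rpred0.
by move=> la lb; rewrite rmorphD /= eta_scale rpredD ?rpredZ.
Qed.
HB.instance Definition _ N :=
  GRing.isSubmodClosed.Build RR H (FLH_pred N) (FLH_submod_closed N).

Definition FLA (N : nat) : submodClosed A := FLA_pred N.
Definition FLH (N : nat) : submodClosed H := FLH_pred N.

Definition T_ (w : seq 'I_(m D)) : A := \prod_(k <- w) sA k.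

End Algebras.

(* Main.v *)
Require Import Defs.
From HB Require Import structures.
From mathcomp Require Import all_boot all_order all_algebra.
From mathcomp Require Import complex.
From mathcomp Require Import boolp classical_sets functions cardinality reals.
From mathcomp Require Import trigo.
From mathcomp Require Import zify.

Set Implicit Arguments.
Unset Strict Implicit.
Unset Printing Implicit Defensive.

(** Write s_k for the generators both of W and of A, l for the length of W, and
    X_k = s_k s_(k+1).  The relation of A attached to k is P_k(X_k) = 0,
    where P_k is monic of degree d_k and its constant term is a unit of the
    coefficient ring R.  Multiplied by the alternating word of length d_k
    which starts with s_(k+1), it becomes a braid relation up to a unit and up
    to strictly shorter alternating words ([braid_T]).

    Spanning.  By induction on N, two reduced words of the same element of
    length N give the same element of A up to a unit and up to combinations of
    the T_(w(x)) with l(x) < N, and left multiplication by s_k raises the length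
    by at most one ([span_step_all]).  This is the usual proof that reduced
    words are related by braid moves: if two reduced words of y begin with
    different letters, both letters are left descents of y, so they generate a
    finite dihedral group and y = w_0 z, with w_0 the longest element of that
    group and z minimal in its coset ([double_desc]).

    Independence.  A module M over A is constructed on the finitely supported
    functions on W, with semilinear operators in place of the s_k.  The operator
    of s_k is defined on the basis element of x by recursion on l(x).  It maps
    the basis element of x to that of s_k x whenever s_k x > x, except when s_k x
    has two left descents: then one of the two operators which reach s_k x is
    normalised in this way along an alternating word, and the other is dictated
    by the braid relation.  No further condition arises, because no element of W
    has three left descents: an element of which every generator is a descent
    is a longest element, while W is infinite, and for D_4 opposite generators
    are never both descents.  Hence the squares of the operators are 1 ([sopK])
    and the braid polynomials vanish ([braid_endo0]): the braid polynomial kills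
    a vector obtained from a minimal coset representative, its kernel is stable
    under s_k and s_(k+1), and such vectors generate M triangularly.  For a
    reduced word of x, T_w applied to the basis element of 1 is a unit multiple
    of the basis element of x plus terms of smaller length ([act_T_lead]),
    so the T_(w(x)) are linearly independent ([T_free]).

    The subalgebra H.  A acts on H + H by letting f act as (f, bar f) and s_k
    exchange the two summands, up to the partial products of T_1 ... T_m; the
    restriction of this action to H contains left multiplication, so eta is
    injective ([eta_inj]).  Products s_k s_l lie in the image of eta, and the
    automorphism s_k |-> - s_k of A fixes that image, so that it is spanned by
    the T_(w(x)) with x even.

    The combinatorics of W rests on the exchange condition ([exchange]), proved
    with the action of W on W x {0, 1} which counts reflections, and on an
    action of W on the integral plane by affine reflections, which shows that
    s_k s_(k+1) has order exactly d_k, that W is infinite for m = 3, and that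
    opposite generators have a product of infinite order for D_4. *)

Local Open Scope classical_set_scope.

(** * Actions of groups given by generators and relations *)

Section GroupAction.
Variables (I T : Type) (a : I -> T -> T).
Hypothesis aK : forall i, involutive (a i).

(** The action of a group term, together with that of its inverse, when the
    generators act by the involutions a i. *)
Fixpoint gterm_act (x : gterm I) : (T -> T) * (T -> T) :=
  match x with
  | GOne => (id, id)
  | GGen i => (a i, a i)
  | GInv x => ((gterm_act x).2, (gterm_act x).1)
  | GMul x y => ((gterm_act x).1 \o (gterm_act y).1, (gterm_act y).2 \o (gterm_act x).2)
  end.

Lemma gterm_actK x : cancel (gterm_act x).1 (gterm_act x).2 /\
  cancel (gterm_act x).2 (gterm_act x).1.
Proof.
elim: x => //= [i|x [K1 K2]|x [K1 K2] y [K3 K4]]; first by split; exact: aK.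
  by [].
by split; apply: can_comp.
Qed.

Lemma gterm_act_cong (rel : gterm I -> gterm I -> Prop) :
    (forall x y, rel x y -> (gterm_act x).1 =1 (gterm_act y).1) ->
  forall x y, gcong rel x y -> (gterm_act x).1 =1 (gterm_act y).1.
Proof.
move=> relP x y; elim=> {x y} //=.
- by move=> x y _ IH t; rewrite IH.
- by move=> x y z _ IH1 _ IH2 t; rewrite IH1 IH2.
- by move=> x x' y y' _ IH1 _ IH2 t /=; rewrite IH1 IH2.
- move=> x x' _ IH t; have [K1 K2] := gterm_actK x; have [K3 K4] := gterm_actK x'.
  by rewrite -{1}(K4 t) -IH K1.
- by move=> x t /=; have [-> _] := gterm_actK x.
- by move=> x t /=; have [_ ->] := gterm_actK x.
Qed.

(** The induced action of the free group. *)
Definition freeG_act (x : freeGroup I) : T -> T := (gterm_act (repr x)).1.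

Lemma freeG_act_pi x : freeG_act (gpi _ x) =1 (gterm_act x).1.
Proof. by apply: gterm_act_cong (gpi_repr _ x) => // ? ? []. Qed.

Local Open Scope group_scope.

Lemma freeG_act1 : freeG_act 1 =1 id. Proof. exact: freeG_act_pi. Qed.
Lemma freeG_actM x y : freeG_act (x * y) =1 freeG_act x \o freeG_act y.
Proof.
elim/gquo_ind: x => x; elim/gquo_ind: y => y t.
by rewrite -[_ * _]/(gquo_mul _ _) gquo_mulE freeG_act_pi /= !freeG_act_pi.
Qed.
Lemma freeG_act_gen i : freeG_act (ggen _ i) =1 a i. Proof. exact: freeG_act_pi. Qed.
Lemma freeG_actX x n : freeG_act (x ^+ n) =1 iter n (freeG_act x).
Proof.
elim: n => [|n IHn] t; first by rewrite expg0 freeG_act1.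
by rewrite expgS freeG_actM /= IHn.
Qed.

(** Involutions of T that satisfy the relations extend to an action. *)
Lemma presGroup_action (rel : freeGroup I -> freeGroup I -> Prop) :
    (forall x y, rel x y -> freeG_act x =1 freeG_act y) ->
  exists rho : presGroup rel -> T -> T,
    [/\ rho 1 =1 id, forall x y, rho (x * y) =1 rho x \o rho y
      & forall i, rho (ggen _ i) =1 a i].
Proof.
move=> relP.
have piP x : (gterm_act (repr (gpi (fun a b => rel (gpi _ a) (gpi _ b)) x))).1
    =1 (gterm_act x).1.
  apply: gterm_act_cong (gpi_repr _ x) => y z /relP yz t.
  by have := yz t; rewrite !freeG_act_pi.
exists (fun x => (gterm_act (repr x)).1); split=> [|x y|i] //; last exact: piP.
  exact: piP.
elim/gquo_ind: x => x; elim/gquo_ind: y => y t.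
by rewrite -[_ * _]/(gquo_mul _ _) gquo_mulE piP /= !piP.
Qed.

End GroupAction.

Section PresGroupRel.
Variables (I : Type) (rel : freeGroup I -> freeGroup I -> Prop).
Local Open Scope group_scope.
Local Notation relG := (fun a b => rel (gpi _ a) (gpi _ b)).

(** The projection of the free group onto the presented group. *)
Definition freeG_pi (x : freeGroup I) : presGroup rel := gpi relG (repr x).

Lemma freeG_pi_gpi a : freeG_pi (gpi _ a) = gpi relG a.
Proof.
have freeP b c : gcong (fun _ _ => False) b c -> gcong relG b c; last first.
  exact/gpiP/freeP/gpi_repr.
elim=> {a b c}.
- by [].
- exact: gcong_refl.
- by move=> a b _; apply: gcong_sym.
- by move=> a b c _ ab _; apply: gcong_trans.
- by move=> a a' b b' _ aa' _; apply: gcong_mul.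
- by move=> a a' _; apply: gcong_inv.
- exact: gcong_mulA.
- exact: gcong_mul1.
- exact: gcong_1mul.
- exact: gcong_mulV.
- exact: gcong_Vmul.
Qed.

Lemma freeG_piM x y : freeG_pi (x * y) = freeG_pi x * freeG_pi y.
Proof.
elim/gquo_ind: x => x; elim/gquo_ind: y => y.
rewrite -[_ * _ in LHS]/(gquo_mul _ _) gquo_mulE !freeG_pi_gpi.
by rewrite -[RHS]/(gquo_mul _ _) gquo_mulE.
Qed.

Lemma freeG_piX x n : freeG_pi (x ^+ n) = freeG_pi x ^+ n.
Proof.
elim: n => [|n IHn]; first by rewrite !expg0 freeG_pi_gpi.
by rewrite !expgS freeG_piM IHn.
Qed.

Lemma freeG_pi_rel x y : rel x y -> freeG_pi x = freeG_pi y.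
Proof.
elim/gquo_ind: x => x; elim/gquo_ind: y => y xy.
by rewrite !freeG_pi_gpi; apply/gpiP/gcong_rel.
Qed.

End PresGroupRel.

(** * The exchange condition *)

Section CoxeterGroup.
Variable D : diagram.
Local Notation W := (W D).
Local Notation I := ('I_(m D)).
Local Notation s := (@sW D).
Local Notation len := (@lengthW D).
Local Open Scope group_scope.
Implicit Types (x y z t : W) (w u v : seq I) (i j k l : I).

(** Involutions that satisfy the relations of W define an action of W. *)
Lemma W_action (T : Type) (a : I -> T -> T) :
    (forall k, involutive (a k)) ->
    (forall k, iter (d k) (a k \o a (ordS k)) =1 id) ->
  exists rho : W -> T -> T,
    [/\ rho 1 =1 id, forall x y, rho (x * y) =1 rho x \o rho y
      & forall k, rho (s k) =1 a k].
Proof.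
move=> aK aX; apply: presGroup_action => // x y [k|k] t.
  by rewrite freeG_actX // (freeG_act1 aK) /= !(freeG_act_gen aK) aK.
rewrite freeG_actX // (freeG_act1 aK) /= -[RHS](aX k); apply: eq_iter => {}t.
by rewrite freeG_actM //= !(freeG_act_gen aK).
Qed.

Lemma wordW0 : wordW [::] = 1 :> W. Proof. by rewrite /wordW big_nil. Qed.
Lemma wordW_cons k w : wordW (k :: w) = s k * wordW w.
Proof. by rewrite /wordW big_cons. Qed.
Lemma wordW_cat w v : wordW (w ++ v) = wordW w * wordW v.
Proof. by rewrite /wordW big_cat. Qed.

Lemma sK k x : s k * (s k * x) = x.
Proof. by rewrite mulgA sW_sq mul1g. Qed.

Lemma sW_inv k : (s k)^-1 = s k.
Proof. by rewrite -[RHS]mul1g -(mulVg (s k)) -mulgA sW_sq mulg1. Qed.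

Lemma wordW_rev w : wordW (rev w) = (wordW w)^-1.
Proof.
elim: w => [|k w IHw]; first by rewrite wordW0 invg1.
by rewrite rev_cons -cats1 wordW_cat !wordW_cons IHw wordW0 mulg1 invgM sW_inv.
Qed.

Lemma len_word w : (len (wordW w) <= size w)%N.
Proof.
rewrite /lengthW; case: ex_minnP => n _; apply.
by apply/asboolP; exists w.
Qed.

Lemma reduced_ex x : exists w, wordW w = x /\ size w = len x.
Proof.
rewrite /lengthW; case: ex_minnP => n /asboolP [w wE wn] _.
by exists w.
Qed.

Lemma len1 : len 1 = 0%N.
Proof. by apply/eqP; rewrite -leqn0 -wordW0; apply: len_word. Qed.

Lemma len_eq0 x : len x = 0%N -> x = 1.
Proof.
have [w [<- <-]] := reduced_ex x; case: w => // _; exact: wordW0.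
Qed.

Lemma len_sW_le k x : (len (s k * x)%g <= (len x).+1)%N.
Proof.
by have [w [<- <-]] := reduced_ex x; rewrite -wordW_cons; apply: len_word.
Qed.

(** The parity of the length is multiplicative: W acts on the booleans, each
    generator acting by negation. *)
Lemma odd_len_word w : odd (len (wordW w)) = odd (size w).
Proof.
have [k|k t|rho [rho1 rhoM rhos]] := @W_action bool (fun _ => negb).
- exact: negbK.
- by rewrite -{2}(iter_fix (d k) (erefl t)); apply: eq_iter => ? /=; apply: negbK.
have rhoE v : rho (wordW v) false = odd (size v).
  elim: v => [|k v IHv]; first by rewrite wordW0 rho1.
  by rewrite wordW_cons rhoM /= rhos IHv.
have [v [vE <-]] := reduced_ex (wordW w).
by rewrite -rhoE vE rhoE.
Qed.

Lemma odd_len_sW k x : odd (len (s k * x)) = ~~ odd (len x).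
Proof.
by have [w [<- _]] := reduced_ex x; rewrite -wordW_cons !odd_len_word.
Qed.

Lemma len_sW_cases k x :
  len (s k * x) = (len x).+1 \/ len x = (len (s k * x)%g).+1.
Proof.
have := len_sW_le k x; have := len_sW_le k (s k * x); rewrite sK.
have := odd_len_sW k x; lia.
Qed.

Lemma sW_braid k : (s k * s (ordS k)) ^+ d k = 1.
Proof.
have := freeG_pi_rel (relW_braid k).
by rewrite freeG_piX freeG_piM !freeG_pi_gpi.
Qed.

Section Exchange.

Let refl k (p : W * bool) : W * bool :=
  (s k * p.1 * s k, p.2 (+) (p.1 == s k)).

Let reflK k : involutive (refl k).
Proof.
case=> t e; rewrite /refl /= -!mulgA sW_sq mulg1 sK; congr pair.
rewrite -addbA [X in _ (+) X](_ : _ = false) ?addbF //.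
have -> : (s k * (t * s k) == s k) = (t == s k); last by rewrite addbb.
apply/eqP/eqP => [E|->]; last by rewrite sK.
by rewrite -[LHS]mulg1 -(sW_sq k) mulgA -(sK k (t * _)) E sW_sq mul1g.
Qed.

Let sX k l n : s l * (s k * s l) ^+ n * s l = ((s k * s l) ^+ n)^-1.
Proof.
elim: n => [|n IHn]; first by rewrite expg0 mulg1 sW_sq invg1.
rewrite {1}expgSr expgS invgM -IHn invgM !sW_inv -!mulgA; congr (_ * (_ * _)).
by rewrite sK sW_sq mulg1.
Qed.

Let eq_sandwich x y z t : (x * t * y == z) = (t == x^-1 * z * y^-1).
Proof.
by apply/eqP/eqP => [<-|->]; rewrite ?mulgA ?mulVg ?mul1g ?mulgK // mulgV mul1g mulgVK.
Qed.

(** The boolean counts the p < 2 n such that t = s_l (s_k s_l)^p. *)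
Let refl_iter k l n t e : iter n (refl k \o refl l) (t, e) =
  ((s k * s l) ^+ n * t * ((s k * s l) ^+ n)^-1,
   e (+) \big[addb/false]_(p < n.*2) (t == s l * (s k * s l) ^+ p)).
Proof.
elim: n => [|n IHn]; first by rewrite expg0 invg1 mul1g mulg1 big_ord0 addbF.
rewrite iterS IHn /refl /=; set X := s k * s l; congr pair.
  by rewrite expgS invgM /X invgM !sW_inv !mulgA.
rewrite doubleS !big_ord_recr /= !addbA; congr (_ (+) _ (+) _).
  rewrite eq_sandwich invgK -sX -/X -!mulgA -addnn expgnDr; congr (_ == _).
  by rewrite (mulgA (s l) (s l)) sW_sq mul1g.
rewrite eq_sandwich sW_inv eq_sandwich invgK -sX -/X; congr (_ == _).
rewrite -addnn -addSn expgnDr expgSr /X -!mulgA; congr (_ * (_ * _)).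
by rewrite sK.
Qed.

(** As (s_k s_(k+1))^(d k) = 1, the terms p and p + d k cancel. *)
Let refl_braid k : iter (d k) (refl k \o refl (ordS k)) =1 id.
Proof.
case=> t e; rewrite refl_iter sW_braid invg1 mulg1 mul1g; congr pair.
rewrite -addnn big_split_ord /= [X in _ (+) (_ (+) X)](_ : _ =
  \big[addb/false]_(p < d k) (t == s (ordS k) * (s k * s (ordS k)) ^+ p)).
  by rewrite addbb addbF.
by apply: eq_bigr => p _; rewrite expgnDr sW_braid mul1g.
Qed.

(** The exchange condition, for an arbitrary word w.  The generator s_k acts on
    W x bool by (t, e) |-> (s_k t s_k, e + [t = s_k]); the boolean counts, modulo
    2, the reflections by which a letter of w is deleted. *)
Lemma exchange k w : (len (s k * wordW w)%g < len (wordW w))%N ->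
  exists w1 j w2, w = w1 ++ j :: w2 /\ s k * wordW w = wordW (w1 ++ w2).
Proof.
have [rho [rho1 rhoM rhos]] := W_action reflK refl_braid.
(* the parity of the number of letters whose deletion multiplies x by t *)
pose N x t := (rho x^-1 (t, false)).2.
have rho_e x t e : (rho x (t, e)).2 = e (+) (rho x (t, false)).2.
  have [w' [<- _]] := reduced_ex x; elim: w' t e {w} => [|j w IHw] t e.
    by rewrite wordW0 !rho1 /= addbF.
  have rho_1 v : (rho (wordW v) (t, e)).1 = (rho (wordW v) (t, false)).1.
    elim: v => [|i v IHv]; first by rewrite wordW0 !rho1.
    by rewrite wordW_cons !rhoM /= !rhos /= IHv.
  by rewrite wordW_cons !rhoM /= !rhos /= IHw rho_1 addbA.
have N_del v t : N (wordW v) t ->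
    exists w1 j w2, v = w1 ++ j :: w2 /\ t * wordW v = wordW (w1 ++ w2).
  elim: v t => [|j v IHv] t; first by rewrite /N wordW0 invg1 rho1.
  rewrite /N wordW_cons invgM rhoM /= sW_inv rhos /refl /= rho_e.
  case: eqP => [-> _|_ /IHv [w1 [i [w2 [-> E]]]]].
    by exists [::], j, v; rewrite sK.
  exists (j :: w1), i, w2; split=> //=.
  by rewrite wordW_cons -E !mulgA sW_sq mul1g.
have Nsk x : N (s k * x) (s k) = ~~ N x (s k).
  by rewrite /N invgM rhoM /= sW_inv rhos /refl /= eqxx sW_sq mul1g rho_e.
(* otherwise s_k would shorten s_k x *)
move=> lt; apply: (N_del); apply/negPn/negP => /negbTE Nw.
have [v [vE sv]] := reduced_ex (s k * wordW w).
have := Nsk (wordW w); rewrite Nw -vE => /N_del [w1 [j [w2 [wE]]]].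
rewrite vE sK => E; have := len_word (w1 ++ w2); rewrite -E.
by move: lt; rewrite -sv wE !size_cat /=; lia.
Qed.

End Exchange.

End CoxeterGroup.

(** * Cosets of dihedral subgroups *)

Section Dihedral.
Variable D : diagram.
Local Notation W := (W D).
Local Notation I := ('I_(m D)).
Local Notation s := (@sW D).
Local Notation len := (@lengthW D).
Local Open Scope group_scope.
Implicit Types (x y z t : W) (w u v : seq I) (i j k l : I).

(** The alternating word a b a ... with n letters. *)
Fixpoint alt (J : Type) (a b : J) n : seq J :=
  if n is n'.+1 then a :: alt b a n' else [::].

Lemma size_alt (J : Type) (a b : J) n : size (alt a b n) = n.
Proof. by elim: n a b => //= n IHn a b; rewrite IHn. Qed.

Lemma alt_pair j k n : all (pred2 j k) (alt j k n).
Proof.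
elim: n j k => //= n IHn j k; rewrite eqxx /=.
by apply: sub_all (IHn k j) => i /=; rewrite orbC.
Qed.

Lemma alt_double j k n : wordW (alt j k n.*2) = (s j * s k) ^+ n.
Proof.
elim: n => [|n IHn]; first by rewrite wordW0.
by rewrite doubleS /= !wordW_cons IHn mulgA expgS.
Qed.

Lemma expg_swap j k n : (s k * s j) ^+ n = ((s j * s k) ^+ n)^-1.
Proof. by rewrite -expVgn invgM !sW_inv. Qed.

Lemma alt_mulr j k q i : (0 < q)%N -> pred2 j k i ->
  exists q', (q' = q.-1 \/ q' = q.+1) /\
    wordW (alt j k q) * s i = wordW (alt j k q').
Proof.
elim: q j k => // -[_ j k _|q IHq j k _].
  case/orP => /eqP ->; rewrite /= wordW_cons wordW0 mulg1.
    by exists 0%N; split; [left | rewrite sW_sq wordW0].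
  by exists 2; split; [right | rewrite /= !wordW_cons wordW0 mulg1].
rewrite /= orbC => /(IHq k j isT) [q' [q'E E]].
exists q'.+1; split; first by case: q'E => ->; [left | right].
by rewrite wordW_cons -mulgA E -wordW_cons.
Qed.

(** A short word in s_j, s_k cannot cancel the first letter of an alternating
    word. *)
Lemma alt_mul_word j k q u : all (pred2 j k) u -> (size u < q)%N ->
  exists q', [/\ (q - size u <= q')%N, (q' <= q + size u)%N,
    odd q' = odd (q + size u) &
    wordW (alt j k q) * wordW u = wordW (alt j k q')].
Proof.
elim/last_ind: u => [|u i IHu]; first by exists q; rewrite wordW0 mulg1; split=> //=; lia.
rewrite all_rcons size_rcons => /andP [ji ju] lt.
have [|q' [le1 le2 od E]] := IHu ju; first lia.
have [|q'' [q''E E']] := @alt_mulr j k q' i _ ji; first lia.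
exists q''; split; try (by case: q''E => ->; lia).
by rewrite -cats1 wordW_cat wordW_cons wordW0 mulg1 mulgA E.
Qed.

(** z has minimal length in its coset z |-> u z, where u runs over the subgroup
    generated by s_j and s_k. *)
Definition coset_min j k z :=
  forall u, all (pred2 j k) u -> (len z <= len (wordW u * z)%g)%N.

Lemma coset_minC j k z : coset_min j k z -> coset_min k j z.
Proof.
by move=> zmin u ju; apply: zmin; apply: sub_all ju => i /=; rewrite orbC.
Qed.

Lemma coset_min_ex j k x : exists u z,
  [/\ all (pred2 j k) u, coset_min j k z & x = wordW u * z].
Proof.
have ex : exists n, `[< exists2 u, all (pred2 j k) u & len (wordW u * x) = n >].
  by exists (len x); apply/asboolP; exists [::]; rewrite // wordW0 mul1g.
case: (ex_minnP ex) => n /asboolP [u ju <-] nmin.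
exists (rev u), (wordW u * x); split; first by rewrite all_rev.
  move=> v jv; apply: nmin; apply/asboolP; exists (v ++ u).
    by rewrite all_cat jv ju.
  by rewrite wordW_cat mulgA.
by rewrite wordW_rev mulKg.
Qed.

(** s_j s_k has order at least N. *)
Definition free_upto N j k :=
  forall e, (0 < e < N)%N -> (s j * s k) ^+ e <> 1.

Lemma free_uptoC N j k : free_upto N j k -> free_upto N k j.
Proof.
move=> jk e /jk; apply: contra_not; rewrite expg_swap => /eqP.
by rewrite invg_eq1 => /eqP.
Qed.

Lemma cat_eq_cat_cons (J : Type) (a b c e : seq J) (i : J) : a ++ b = c ++ i :: e ->
  (exists2 a', a = c ++ i :: a' & e = a' ++ b) \/
  (exists2 c', b = c' ++ i :: e & c = a ++ c').
Proof.
elim: a c => [|h a IHa] c /=; first by move=> ->; right; exists c.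
case: c => [|h' c] /= [-> E]; first by left; exists a.
by have [[a' -> ->]|[c' -> ->]] := IHa _ E; [left; exists a' | right; exists c'].
Qed.

(** Lengths add in the coset of a minimal element, as long as the alternating
    word is reduced in the dihedral group. *)
Lemma len_alt N j k z p : free_upto N j k -> coset_min j k z -> (p <= N)%N ->
  len (wordW (alt j k p) * z) = (p + len z)%N.
Proof.
elim: p j k => [|p IHp] j k jkN zmin le; first by rewrite wordW0 mul1g.
have := IHp k j (free_uptoC jkN) (coset_minC zmin) (ltnW le).
rewrite /= wordW_cons -mulgA.
have [->|lt] := len_sW_cases j (wordW (alt k j p) * z); first by move=> ->; lia.
have [wz [wzE wzs]] := reduced_ex z.
move: lt; rewrite -wzE -wordW_cat => lt lenE; exfalso.
(* The deleted letter lies in the alternating word, against the order of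
   s_j s_k, or in the word of z, against the minimality of z. *)
have [|w1 [i [w2 [E del]]]] := @exchange D j (alt k j p ++ wz).
  by rewrite lt.
have {E} [[a' E w2E]|[c' E w1E]] := cat_eq_cat_cons E.
  set u := w1 ++ a'.
  have [ju szu] : all (pred2 j k) (rev u) /\ size u = p.-1.
    split; last by rewrite -(size_alt k j p) E !size_cat /= addnS.
    have := alt_pair k j p; rewrite E all_rev !all_cat /= => /andP [j1 /andP [_ ja']].
    by apply/andP; split; [apply: sub_all j1 | apply: sub_all ja'] => h /=; rewrite orbC.
  have p0 : (0 < p)%N by rewrite -(size_alt k j p) E size_cat /= addnS.
  have delu : wordW (alt j k p.+1) = wordW u.
    apply: (mulIg (wordW wz)); rewrite /= wordW_cons -mulgA -!wordW_cat del w2E.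
    by rewrite catA.
  have [|q [le1 le2 od]] := @alt_mul_word j k p.+1 _ ju; first by rewrite size_rev szu; lia.
  move: le1 le2 od; rewrite size_rev szu => le1 le2 od.
  rewrite wordW_rev delu mulgV => /esym.
  have -> : q = q./2.*2 by lia.
  by rewrite alt_double; apply: jkN; lia.
have := zmin (rev (alt k j p) ++ j :: alt k j p).
have -> : wordW (rev (alt k j p) ++ j :: alt k j p) * z = wordW (c' ++ w2).
  apply: (mulgI (wordW (alt k j p))).
  rewrite -[RHS]wordW_cat catA -w1E -del -wzE !wordW_cat wordW_cons wordW_rev.
  by rewrite !mulgA mulgV mul1g.
have := len_word (c' ++ w2); rewrite -wzs E !size_cat /= => le1 le2.
suff /le2 : all (pred2 j k) (rev (alt k j p) ++ j :: alt k j p) by lia.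
rewrite all_cat all_rev /= eqxx /= andbb; apply: sub_all (alt_pair k j p) => h /=.
by rewrite orbC.
Qed.

(** s_k is a left descent of x. *)
Definition desc k x := (len (s k * x)%g < len x)%N.

Lemma len_desc k x : desc k x -> len x = (len (s k * x)).+1.
Proof. by rewrite /desc; case: (len_sW_cases k x) => ->; lia. Qed.

Lemma len_asc k x : ~~ desc k x -> len (s k * x) = (len x).+1.
Proof. by rewrite /desc; case: (len_sW_cases k x) => ->; lia. Qed.

Lemma desc_sW k x : desc k (s k * x) = ~~ desc k x.
Proof. by rewrite /desc sK; case: (len_sW_cases k x) => ->; lia. Qed.

Lemma pair_word j k u : all (pred2 j k) u ->
  exists q, wordW u = wordW (alt j k q) \/ wordW u = wordW (alt k j q).
Proof.
elim: u => [|i u IHu /= /andP [ji /IHu [q E]]]; first by exists 0%N; left.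
wlog E' : j k ji {IHu E} / wordW u = wordW (alt j k q).
  move=> IH; case: E => E; first exact: IH E.
  have [|q' E'] := IH k j _ E; first by rewrite orbC.
  by exists q'; case: E'; [right | left].
rewrite wordW_cons E'; case/orP: ji => /eqP ->; last by exists q.+1; right; rewrite /= wordW_cons.
case: q {E'} => [|q]; first by exists 1%N; left; rewrite /= !wordW_cons.
by exists q; right; rewrite /= wordW_cons sK.
Qed.

(** Two generators whose product has infinite order are not both descents. *)
Lemma infinite_pair_desc j k x : (forall N, free_upto N j k) ->
  desc j x -> ~~ desc k x.
Proof.
move=> jk dj; apply/negP => dk.
have [u [z [ju zmin xE]]] := coset_min_ex j k x.
have [q qE] := pair_word ju; rewrite xE in dj dk.
wlog qE' : j k jk dj dk ju zmin {qE} / wordW u = wordW (alt j k q).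
  move=> IH; case: qE => qE; first exact: (IH j k).
  apply: (IH k j) => //; first by move=> N; apply: free_uptoC.
    by apply: sub_all ju => i /=; rewrite orbC.
  exact: coset_minC.
have := len_alt (free_uptoC (jk q.+1)) (coset_minC zmin) (leqnn q.+1).
rewrite /= wordW_cons -mulgA -qE'; move: dk; rewrite /desc.
rewrite {2}qE' (len_alt (jk q) zmin (leqnn q)) => /[swap] ->; lia.
Qed.

Section FinitePair.
Variables (n : nat) (j k : I).
Hypotheses (n_gt0 : (0 < n)%N) (jkn : (s j * s k) ^+ n = 1).

Lemma alt_flip p : (p <= n.*2)%N ->
  wordW (alt j k p) = wordW (alt k j (n.*2 - p)) /\
  wordW (alt k j p) = wordW (alt j k (n.*2 - p)).
Proof.
elim: p => [|p IHp] le.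
  by rewrite subn0 !alt_double expg_swap jkn invg1 wordW0.
have [E1 E2] := IHp (ltnW le).
rewrite /= !wordW_cons E1 E2.
have -> : (n.*2 - p = (n.*2 - p.+1).+1)%N by lia.
by rewrite /= !wordW_cons !sK.
Qed.

Lemma alt_top : wordW (alt j k n) = wordW (alt k j n).
Proof.
have [|-> _] := @alt_flip n; first lia.
by congr (wordW (alt _ _ _)); lia.
Qed.

Lemma finite_pair_word u : all (pred2 j k) u ->
  exists2 q, (q <= n)%N &
    wordW u = wordW (alt j k q) \/ wordW u = wordW (alt k j q).
Proof.
elim: u => [|i u IHu /= /andP [ji /IHu [q le E]]]; first by exists 0%N => //; left.
have [lt|ge] := ltnP q n.
  case/orP: ji => /eqP ->; rewrite wordW_cons; case: E => ->.
  - case: q {le} lt => [|q] lt; first by exists 1%N => //; left; rewrite /= wordW_cons.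
    by exists q; [lia | right; rewrite /= wordW_cons sK].
  - by exists q.+1 => //; left; rewrite /= wordW_cons.
  - by exists q.+1 => //; right; rewrite /= wordW_cons.
  - case: q {le} lt => [|q] lt; first by exists 1%N => //; right; rewrite /= wordW_cons.
    by exists q; [lia | left; rewrite /= wordW_cons sK].
have {le ge} qn : q = n by lia.
have {E} E : wordW u = wordW (alt j k n.-1.+1).
  by rewrite prednK // -qn; case: E => ->; rewrite qn // alt_top.
have E2 : wordW u = wordW (alt k j n.-1.+1).
  by rewrite E prednK // alt_top.
exists n.-1; first lia.
rewrite wordW_cons; case/orP: ji => /eqP ->.
  by right; rewrite E /= wordW_cons sK.
by left; rewrite E2 /= wordW_cons sK.
Qed.

Lemma coset_decomposition x : exists z q, [/\ coset_min j k z, (q <= n)%N &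
  x = wordW (alt j k q) * z \/ x = wordW (alt k j q) * z].
Proof.
have [u [z [/finite_pair_word [q le E] zmin ->]]] := coset_min_ex j k x.
by exists z, q; split=> //; case: E => ->; [left | right].
Qed.

End FinitePair.

(** If two generators of a finite dihedral group are descents of x, then x is
    the longest element of that group times a minimal representative. *)
Lemma double_desc n j k x : (0 < n)%N -> (s j * s k) ^+ n = 1 ->
    free_upto n j k -> desc j x -> desc k x ->
  exists2 z, coset_min j k z & x = wordW (alt j k n) * z.
Proof.
move=> n_gt0 jkn jk_free dj dk.
have [z [q [zmin le xE]]] := coset_decomposition n_gt0 jkn x.
exists z => //; have [lt|ge] := ltnP q n; last first.
  have {ge}qn : q = n by lia.
  by case: xE => ->; rewrite qn // (alt_top n_gt0 jkn).
exfalso.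
wlog xE' : j k jkn jk_free dj dk zmin {xE} / x = wordW (alt j k q) * z.
  move=> IH; case: xE => xE; first exact: (IH j k).
  apply: (IH k j) => //; last exact: coset_minC.
    by rewrite expg_swap jkn invg1.
  exact: free_uptoC.
have := len_alt (free_uptoC jk_free) (coset_minC zmin) lt.
rewrite /= wordW_cons -mulgA -xE'; move: dk; rewrite /desc.
rewrite {2}xE' (len_alt jk_free zmin le) => /[swap] ->; lia.
Qed.

End Dihedral.

(** * W as a group of affine reflections of the plane *)

Section AffineReflections.
Import GRing.Theory.
Local Open Scope ring_scope.

(** The generators as affine reflections of the plane, in integral coordinates:
    the reflections in the sides of a rectangle for D_4, and in the sides of a
    triangle with angles pi/d_k otherwise. *)
Definition affine_refl (D : diagram) (k : nat) (p : int * int) : int * int :=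
  let: (x, y) := p in
  match D, k with
  | D4, 0 => (- x, y) | D4, 1 => (x, - y) | D4, 2 => (1 - x, y)
  | D4, _ => (x, 1 - y)
  | E6, 0 => (1 - y, 1 - x) | E6, 1 => (- x, x + y) | E6, _ => (x + y, - y)
  | E7, 0 => (- x, y) | E7, 1 => (x, - y) | E7, _ => (1 - y, 1 - x)
  | E8, 0 => (- x, y + 3 * x) | E8, 1 => (x, 1 - 3 * x - y)
  | E8, _ => (x + y, - y)
  end.

Lemma affine_reflK D k : involutive (affine_refl D k).
Proof.
by case=> x y; case: D => /=; case: k => [|[|[|k]]] /=; congr pair; lia.
Qed.

Variable D : diagram.
Local Notation W := (W D).
Local Notation I := ('I_(m D)).
Local Notation s := (@sW D).
Local Notation len := (@lengthW D).

Lemma affine_refl_braid (k : I) : iter (d k) (affine_refl D k \o affine_refl D (ordS k)) =1 id.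
Proof.
by case: D k => -[[|[|[|[|k]]]] ltk] // [x y]; rewrite /d /=; congr pair; lia.
Qed.

Lemma affine_refl_action : exists rho : W -> int * int -> int * int,
    [/\ rho 1%g =1 id, forall x y, rho (x * y)%g =1 rho x \o rho y
      & forall k, rho (s k) =1 affine_refl D k].
Proof. by apply: W_action; [move=> k; apply: affine_reflK | apply: affine_refl_braid]. Qed.

Lemma affine_refl_word : exists rho : W -> int * int -> int * int,
  rho 1%g =1 id /\ forall w n p,
    rho ((wordW w) ^+ n)%g p = iter n (fun p => foldr (fun k : I => affine_refl D k) p w) p.
Proof.
have [rho [rho1 rhoM rhos]] := affine_refl_action; exists rho; split=> // w n p.
have rhow q : rho (wordW w) q = foldr (fun k : I => affine_refl D k) q w.
  elim: w => [|k w IHw]; first by rewrite wordW0 rho1.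
  by rewrite wordW_cons rhoM /= rhos IHw.
elim: n => [|n IHn]; first by rewrite expg0 rho1.
by rewrite expgS rhoM /= rhow IHn.
Qed.

(** s_k s_(k+1) has order at least d_k: no power with exponent in between 0 and
    d_k fixes the point (3, 100). *)
Lemma free_upto_d (k : I) : free_upto (d k) k (ordS k).
Proof.
have [rho [rho1 rhow]] := affine_refl_word.
move=> e; have := rhow [:: k; ordS k] e (3, 100).
rewrite !wordW_cons wordW0 mulg1 => E lt E1; move: E; rewrite E1 rho1 {rho rho1 rhow E1}.
by case: D k e lt => -[[|[|[|[|k]]]] ltk] // [|[|[|[|[|[|e]]]]]].
Qed.

Lemma D4_opposite_free (j k : I) N :
  D = D4 -> (k = j.+2 :> nat)%N -> free_upto N j k.
Proof.
have [rho [rho1 rhow]] := affine_refl_word.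
move=> DE jk e; have := rhow [:: j; k] e (0, 0).
rewrite !wordW_cons wordW0 mulg1 => E /andP [lt _] E1; move: E.
rewrite E1 rho1 /= jk {rho rho1 rhow E1}.
have lt2 : (j < 2)%N.
  by have := ltn_ord k; rewrite jk; move: (nat_of_ord j) => j'; rewrite DE.
move: (nat_of_ord j) lt2 => {jk} [|[|j']] //= _; rewrite DE.
  have -> : iter e (fun p => affine_refl D4 0 (affine_refl D4 2 p)) (0, 0) = (- e%:Z, 0).
    by elim: e {lt} => //= e ->; rewrite /=; congr pair; lia.
  by case; lia.
have -> : iter e (fun p => affine_refl D4 1 (affine_refl D4 3 p)) (0, 0) = (0, - e%:Z).
  by elim: e {lt} => //= e ->; rewrite /=; congr pair; lia.
by case; lia.
Qed.

(** The elements of length at most n, without repetition. *)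
Fixpoint ball (n : nat) : seq W :=
  if n is n'.+1 then undup (ball n' ++ [seq s k * x | x <- ball n', k <- enum 'I_(m D)])%g
  else [:: 1%g].

Lemma mem_ball n x : (x \in ball n) = (len x <= n)%N.
Proof.
elim: n x => [|n IHn] x.
  rewrite inE leqn0; apply/eqP/eqP => [->|]; [exact: len1 | exact: len_eq0].
rewrite mem_undup mem_cat IHn; apply/orP/idP => [[le|/allpairsP [[y k] /= [yn _ ->]]]|le].
- exact: leqW.
- by apply: leq_trans (len_sW_le _ _) _; rewrite ltnS -IHn.
- have [w [wE ws]] := reduced_ex x.
  case: w wE ws => [|k w] wE ws; first by left; rewrite -ws.
  right; apply/allpairsP; exists (wordW w, k); rewrite /= -wordW_cons wE mem_enum IHn.
  by split=> //; apply: leq_trans (len_word w) _; rewrite -ltnS [(size w).+1]ws.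
Qed.

Lemma ball_uniq n : uniq (ball n).
Proof. by case: n => // n; apply: undup_uniq. Qed.

(** For m = 3 the group W is infinite: the square of s_1 s_2 s_3 acts by a
    translation whose second coordinate is not 0. *)
Lemma len_unbounded N : m D = 3 -> exists x : W, (N < len x)%N.
Proof.
move=> mD; apply: contrapT => noex.
have le (x : W) : (len x <= N)%N by rewrite leqNgt; apply/negP => lt; apply: noex; exists x.
have [rho [rho1 rhow]] := affine_refl_word.
have lt0 : (0 < m D)%N by rewrite mD.
have lt1 : (1 < m D)%N by rewrite mD.
have lt2 : (2 < m D)%N by rewrite mD.
pose w := [:: Ordinal lt0; Ordinal lt1; Ordinal lt2].
pose c : int := match D with E6 => 3 | E7 => -2 | _ => 2 end.
have gE x y : (affine_refl D 0 (affine_refl D 1 (affine_refl D 2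
    (affine_refl D 0 (affine_refl D 1 (affine_refl D 2 (x, y))))))).2 = c + y.
  by rewrite /c; case: (D) mD => //= _; lia.
have iterE n : (iter n (fun p => foldr (fun k : I => affine_refl D k) p (w ++ w))
    (0, 0)).2 = c *+ n.
  elim: n => // n IHn; rewrite iterS mulrS -IHn; case: (iter _ _ _) => x y.
  exact: gE.
pose h x : nat := `|(rho x (0%R, 0%R)).2|%N.
pose B := \max_(x <- ball N) h x.
have hB x : (h x <= B)%N by apply: leq_bigmax_seq; rewrite ?mem_ball.
have := hB (wordW (w ++ w) ^+ B.+1)%g.
have -> : h (wordW (w ++ w) ^+ B.+1)%g = `|c *+ B.+1|%N by rewrite /h rhow -iterE.
clear iterE gE.
by rewrite /c; case: (D) mD => //= _; lia.
Qed.

End AffineReflections.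

(** * Left descents *)

Section Descents.
Variable D : diagram.
Local Notation W := (W D).
Local Notation I := ('I_(m D)).
Local Notation s := (@sW D).
Local Notation len := (@lengthW D).
Local Open Scope group_scope.
Implicit Types (x y z t : W) (w u v : seq I) (i j k l : I).

Lemma len_word_mul w x : (len (wordW w * x)%g <= size w + len x)%N.
Proof.
elim: w => [|h w IH]; first by rewrite wordW0 mul1g.
by rewrite wordW_cons -mulgA; apply: leq_trans (len_sW_le _ _) _.
Qed.

(** If every generator is a descent of x, every reduced word is a prefix of a
    reduced word of x. *)
Lemma all_desc_longest x w : (forall k, desc k x) ->
  size w = len (wordW w) ->
  exists v : W, x = wordW w * v /\ len x = (size w + len v)%N.
Proof.
move=> dx; elim: w => [|k w IHw] wred; first by exists x; rewrite wordW0 mul1g.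
have wred' : size w = len (wordW w).
  have wred1 : (size w).+1 = len (wordW (k :: w)) := wred.
  apply/eqP; rewrite eqn_leq len_word andbT -ltnS wred1 wordW_cons.
  exact: len_sW_le.
have [v [xE xl]] := IHw wred'.
have [wv [vE vs]] := reduced_ex v.
have : desc k (wordW (w ++ wv)) by rewrite wordW_cat vE -xE.
move=> /exchange [w1 [j [w2 [E del]]]].
have [[a' E1 w2E]|[c' E1 w1E]] := cat_eq_cat_cons E.
  have := len_word (w1 ++ a'); have -> : wordW (w1 ++ a') = wordW (k :: w).
    apply: (mulIg v); rewrite wordW_cons -vE -mulgA -!wordW_cat del w2E.
    by rewrite catA.
  by rewrite -wred /= E1 !size_cat /=; lia.
exists (wordW (c' ++ w2)).
have xE' : wordW (w ++ wv) = wordW (k :: w) * wordW (c' ++ w2).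
  by rewrite wordW_cons -mulgA -wordW_cat catA -w1E -del sK.
have xE2 : x = wordW (k :: w) * wordW (c' ++ w2) by rewrite -xE' wordW_cat vE.
split=> //; have := len_word (c' ++ w2); have := len_word_mul (k :: w) (wordW (c' ++ w2)).
rewrite -xE2 xl -vs E1 !size_cat /=; lia.
Qed.

Lemma m_cases : D = D4 \/ m D = 3.
Proof. by case: D; [left | right | right | right]. Qed.

Lemma d_gt1 k : (1 < d k)%N.
Proof. by case: D k => -[[|[|[|[|k]]]] ltk]. Qed.

Lemma ordS_neq k : ordS k != k.
Proof. by case: D k => -[[|[|[|[|k]]]] ltk]. Qed.

(** Three generators are never all descents. *)
Lemma not_all_desc x : m D = 3 -> exists k, ~~ desc k x.
Proof.
move=> mD; apply: contrapT => nex.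
have dx k : desc k x by apply/negPn/negP => nk; apply: nex; exists k.
have [y lty] := @len_unbounded D (len x) mD.
have [w [wE ws]] := reduced_ex y.
have [v [_]] := @all_desc_longest x w dx (etrans ws (congr1 _ (esym wE))).
by rewrite ws; lia.
Qed.

Lemma opposite_desc j k x : D = D4 -> (k = j.+2 :> nat)%N ->
  desc j x -> ~~ desc k x.
Proof.
by move=> DE jk; apply: infinite_pair_desc => N; apply: D4_opposite_free DE jk.
Qed.

Lemma desc_adjacent j k x : desc j x -> desc k x -> j != k ->
  k = ordS j \/ j = ordS k.
Proof.
have [DE|mD] := m_cases.
  move=> dj dk jk.
  have mD : m D = 4 by rewrite DE.
  have n1 : k <> j.+2 :> nat by move=> /(opposite_desc DE) /(_ dj); rewrite dk.
  have n2 : j <> k.+2 :> nat by move=> /(opposite_desc DE) /(_ dk); rewrite dj.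
  move/eqP: jk => jk.
  have jk' : j <> k :> nat by move=> E; apply: jk; apply: val_inj.
  have ltj : (j < 4)%N by rewrite -mD ltn_ord.
  have ltk : (k < 4)%N by rewrite -mD ltn_ord.
  suff [E|E] : k = j.+1 %% m D :> nat \/ j = k.+1 %% m D :> nat.
  - by left; apply: val_inj.
  - by right; apply: val_inj.
  move: (nat_of_ord j) (nat_of_ord k) n1 n2 jk' ltj ltk => j' k'.
  rewrite mD => n1 n2 jk' ltj ltk; lia.
move=> _ _ jk; have ltj := ltn_ord j; have ltk := ltn_ord k.
have jk' : j <> k :> nat by move=> E; case/eqP: jk; apply: val_inj.
suff [E|E] : k = j.+1 %% m D :> nat \/ j = k.+1 %% m D :> nat.
- by left; apply: val_inj.
- by right; apply: val_inj.
by move: (nat_of_ord j) (nat_of_ord k) ltj ltk jk' => j' k'; rewrite mD; lia.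
Qed.

(** Both generators of the k-th braid relation are descents of x. *)
Definition pair_desc k x := desc k x && desc (ordS k) x.

(** At most one braid relation ends at a given element of W. *)
Lemma pair_desc_inj j k x : pair_desc j x -> pair_desc k x -> j = k.
Proof.
move=> /andP [d1 d2] /andP [d3 d4]; apply: contrapT => jk.
have jk' : j <> k :> nat by move=> E; apply: jk; apply: val_inj.
have ltj := ltn_ord j; have ltk := ltn_ord k.
have [DE|mD] := m_cases.
  have mD : m D = 4 by rewrite DE.
  have n p q : desc p x -> desc q x -> q <> p.+2 :> nat.
    by move=> dp dq /(opposite_desc DE) /(_ dp); rewrite dq.
  have v1 : ordS j = j.+1 %% 4 :> nat by rewrite -mD.
  have v2 : ordS k = k.+1 %% 4 :> nat by rewrite -mD.
  have := n _ _ d1 d3; have := n _ _ d3 d1; have := n _ _ d2 d4.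
  have := n _ _ d4 d2; have := n _ _ d1 d4; have := n _ _ d4 d1.
  have := n _ _ d2 d3; have := n _ _ d3 d2.
  rewrite v1 v2.
  by move: (nat_of_ord j) (nat_of_ord k) jk' ltj ltk => j' k'; rewrite mD; lia.
have [i /negP []] := not_all_desc x mD.
have lti := ltn_ord i.
have v1 : ordS j = j.+1 %% 3 :> nat by rewrite -mD.
have v2 : ordS k = k.+1 %% 3 :> nat by rewrite -mD.
have : [\/ i = j :> nat, i = k :> nat, i = ordS j :> nat | i = ordS k :> nat].
  rewrite v1 v2.
  have : [|| i == j :> nat, i == k :> nat, i == j.+1 %% 3 :> nat | i == k.+1 %% 3 :> nat].
    move: (nat_of_ord j) (nat_of_ord k) (nat_of_ord i) jk' ltj ltk lti => j' k' i'.
    by rewrite mD; lia.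
  by case/or4P => /eqP; [constructor 1 | constructor 2 | constructor 3 | constructor 4].
by case=> /val_inj ->.
Qed.

Lemma pair_desc_top k x : pair_desc k x ->
  exists2 z, coset_min k (ordS k) z & x = wordW (alt k (ordS k) (d k)) * z.
Proof.
case/andP => d1 d2; apply: double_desc => //.
- exact: leq_trans (d_gt1 k).
- exact: sW_braid.
- exact: free_upto_d.
Qed.

Lemma alt_topC k : wordW (alt k (ordS k) (d k)) = wordW (alt (ordS k) k (d k)).
Proof.
by apply: alt_top; [exact: ltnW (d_gt1 k) | exact: sW_braid].
Qed.

Lemma len_alt_l k z p : coset_min k (ordS k) z -> (p <= d k)%N ->
  len (wordW (alt k (ordS k) p) * z) = (p + len z)%N.
Proof. by apply: len_alt; exact: free_upto_d. Qed.

Lemma len_alt_r k z p : coset_min k (ordS k) z -> (p <= d k)%N ->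
  len (wordW (alt (ordS k) k p) * z) = (p + len z)%N.
Proof.
move=> /coset_minC; apply: len_alt; apply: free_uptoC; exact: free_upto_d.
Qed.

Lemma top_pair_desc k z : coset_min k (ordS k) z ->
  pair_desc k (wordW (alt k (ordS k) (d k)) * z).
Proof.
move=> zmin; have d0 := ltnW (d_gt1 k).
have topE a b : s a * (wordW (alt a b (d k)) * z) = wordW (alt b a (d k).-1) * z.
  by rewrite -{1}(prednK d0) /= wordW_cons -mulgA sK.
apply/andP; split; rewrite /desc.
  by rewrite topE (len_alt_l zmin) // (len_alt_r zmin) ?leq_pred //; lia.
rewrite alt_topC topE (len_alt_r zmin) // (len_alt_l zmin) ?leq_pred //; lia.
Qed.

Lemma coset_decomp k x : exists z p, [/\ coset_min k (ordS k) z, (p <= d k)%N &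
  x = wordW (alt k (ordS k) p) * z \/ x = wordW (alt (ordS k) k p) * z].
Proof.
by apply: coset_decomposition; [exact: ltnW (d_gt1 k) | exact: sW_braid].
Qed.

End Descents.

Import Order.TTheory GRing.Theory Num.Theory.
Local Open Scope complex_scope.
Local Open Scope ring_scope.

(** * Finitely supported functions on W *)

Section Model.
Variables (D : diagram) (R : comPzRingType).
Local Notation W := (W D).
Local Notation len := (@lengthW D).
Implicit Types (x y z : W) (n p : nat).

(** f is supported in length less than n. *)
Definition below n (f : W -> R) := forall y, (n <= len y)%N -> f y = 0.

Definition finsupp : {pred W -> R} := fun f => `[< exists n, below n f >].

Lemma finsupp_zmod_closed : zmod_closed finsupp.
Proof.
split=> [|f g /asboolP [n fn] /asboolP [p gp]]; apply/asboolP.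
  by exists 0%N.
exists (maxn n p) => y; rewrite geq_max => /andP [ny py].
by rewrite -[LHS]/(f y - g y) fn // gp // subr0.
Qed.
HB.instance Definition _ :=
  GRing.isZmodClosed.Build _ finsupp finsupp_zmod_closed.

(** The free R-module on W, as the functions with support of bounded length;
    there are finitely many elements of each length. *)
Record model := Model {
  model_fun :> W -> R;
  model_finsupp : model_fun \in finsupp }.

HB.instance Definition _ := [isSub for model_fun].
HB.instance Definition _ := [Choice of model by <:].
HB.instance Definition _ := [SubChoice_isSubZmodule of model by <:].

Implicit Types (u v : model).

Lemma model_eq u v : (forall x, u x = v x) -> u = v.
Proof. by move=> uv; apply/val_inj/funext. Qed.

Lemma modelD u v x : (u + v) x = u x + v x. Proof. by []. Qed.
Lemma modelN u x : (- u) x = - u x. Proof. by []. Qed.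
Lemma model0 x : (0 : model) x = 0. Proof. by []. Qed.

Lemma model_sum J (r : seq J) (F : J -> model) x :
  (\sum_(j <- r) F j) x = \sum_(j <- r) F j x.
Proof. by elim: r => [|j r IHr]; rewrite ?big_nil // !big_cons modelD IHr. Qed.

Lemma model_scale_subproof (c : R) v : (fun x => c * v x) \in finsupp.
Proof.
have /asboolP [n vn] := model_finsupp v; apply/asboolP; exists n => y ny.
by rewrite vn // mulr0.
Qed.
Definition model_scale c v : model := Model (model_scale_subproof c v).

Fact model_scaleA a b v :
  model_scale a (model_scale b v) = model_scale (a * b) v.
Proof. by apply: model_eq => x /=; rewrite mulrA. Qed.
Fact model_scale1 : left_id 1 model_scale.
Proof. by move=> v; apply: model_eq => x /=; rewrite mul1r. Qed.
Fact model_scaleDr : right_distributive model_scale +%R.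
Proof. by move=> a u v; apply: model_eq => x /=; rewrite -mulrDr. Qed.
Fact model_scaleDl v : {morph model_scale^~ v : a b / a + b}.
Proof. by move=> a b; apply: model_eq => x; apply: mulrDl. Qed.
HB.instance Definition _ := GRing.Zmodule_isLmodule.Build R model
  model_scaleA model_scale1 model_scaleDr model_scaleDl.

Lemma modelZ c v x : (c *: v) x = c * v x. Proof. by []. Qed.

Lemma delta_subproof x : (fun y => (y == x)%:R : R) \in finsupp.
Proof.
apply/asboolP; exists (len x).+1 => y; case: eqP => [-> |] //.
by rewrite ltnn.
Qed.
(** The basis element attached to x. *)
Definition bas x : model := Model (delta_subproof x).

Lemma basE x y : bas x y = (y == x)%:R. Proof. by []. Qed.

Lemma below_le n p v : (n <= p)%N -> below n v -> below p v.
Proof. by move=> np vn y py; apply: vn (leq_trans np py). Qed.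
Lemma below0 n : below n (0 : model). Proof. by []. Qed.
Lemma belowD n u v : below n u -> below n v -> below n (u + v).
Proof. by move=> un vn y ny; rewrite modelD un ?vn ?addr0. Qed.
Lemma belowN n u : below n u -> below n (- u).
Proof. by move=> un y ny; rewrite modelN un ?oppr0. Qed.
Lemma belowB n u v : below n u -> below n v -> below n (u - v).
Proof. by move=> un /belowN; apply: belowD. Qed.
Lemma belowZ n c u : below n u -> below n (c *: u).
Proof. by move=> un y ny; rewrite modelZ un ?mulr0. Qed.
Lemma below_sum n J (r : seq J) (P : pred J) (F : J -> model) :
  (forall j, P j -> below n (F j)) -> below n (\sum_(j <- r | P j) F j).
Proof. by move=> FP; elim/big_rec: _ => // j v Pj; apply: belowD; apply: FP. Qed.
Lemma below_bas x : below (len x).+1 (bas x).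
Proof. by move=> y; rewrite basE; case: eqP => [->|//]; rewrite ltnn. Qed.

Lemma below_ex v : exists n, below n v.
Proof. exact/asboolP/model_finsupp. Qed.

Section Ext.
Variables (sg : {rmorphism R -> R}) (L : lmodType R).
Implicit Type o : W -> L.

(** The sg-semilinear map which sends [bas x] to o x. *)
Definition sext o v : L := \sum_(x <- ball D (projT1 (cid (below_ex v)))) sg (v x) *: o x.

Lemma ball_sum n p (F : W -> L) : (n <= p)%N ->
    (forall x, (n < len x)%N -> F x = 0) ->
  \sum_(x <- ball D p) F x = \sum_(x <- ball D n) F x.
Proof.
move=> np F0; rewrite (bigID (fun x => x \in ball D n)) /= [X in _ + X]big1 => [|x].
  rewrite addr0 -big_filter; apply: perm_big; apply: uniq_perm.
  - by rewrite filter_uniq // ball_uniq.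
  - exact: ball_uniq.
  move=> x; rewrite mem_filter !mem_ball.
  by case: leqP => //= le; rewrite (leq_trans le np).
by rewrite mem_ball -ltnNge; apply: F0.
Qed.

Lemma sextE o n v : below n v -> sext o v = \sum_(x <- ball D n) sg (v x) *: o x.
Proof.
move=> vn; rewrite /sext; case: cid => p vp /=.
have E q q' : below q v -> (q <= q')%N ->
    \sum_(x <- ball D q') sg (v x) *: o x = \sum_(x <- ball D q) sg (v x) *: o x.
  move=> vq le; apply: ball_sum => // x lt.
  by rewrite vq ?rmorph0 ?scale0r // ltnW.
by case: (leqP n p) => [|/ltnW] le; [rewrite (E n) | rewrite -(E p n)].
Qed.

Lemma sext_bas o x : sext o (bas x) = o x.
Proof.
rewrite (sextE o (@below_bas x)) (bigD1_seq x) ?ball_uniq ?mem_ball //=.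
rewrite eqxx rmorph1 scale1r big1 ?addr0 // => y /negbTE yx.
by rewrite yx rmorph0 scale0r.
Qed.

Lemma sextD o u v : sext o (u + v) = sext o u + sext o v.
Proof.
have [n un] := below_ex u; have [p vp] := below_ex v.
have uN : below (maxn n p) u by apply: below_le un; rewrite leq_maxl.
have vN : below (maxn n p) v by apply: below_le vp; rewrite leq_maxr.
rewrite (sextE o uN) (sextE o vN) (sextE o (belowD uN vN)) -big_split /=.
by apply: eq_bigr => x _; rewrite rmorphD scalerDl.
Qed.

Lemma sextZ o c v : sext o (c *: v) = sg c *: sext o v.
Proof.
have [n vn] := below_ex v.
rewrite (sextE o vn) (sextE o (@belowZ n c v vn)) scaler_sumr.
by apply: eq_bigr => x _; rewrite rmorphM scalerA.
Qed.

Lemma sextN o v : sext o (- v) = - sext o v.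
Proof. by rewrite -(scaleN1r v) sextZ rmorphN1 scaleN1r. Qed.

Lemma sextB o u v : sext o (u - v) = sext o u - sext o v.
Proof. by rewrite sextD sextN. Qed.

Lemma sext0 o : sext o 0 = 0.
Proof. by rewrite -(subrr 0) sextB subrr. Qed.

Lemma eq_sext o o' n v : below n v ->
  (forall x, (len x < n)%N -> o x = o' x) -> sext o v = sext o' v.
Proof.
move=> vn oo'; rewrite !(sextE _ vn); apply: eq_bigr => x _.
by case: (ltnP (len x) n) => le; [rewrite oo' | rewrite vn // rmorph0 !scale0r].
Qed.

End Ext.

Lemma below_sext sg n p (o : W -> model) v : below n v ->
  (forall x, (len x < n)%N -> below p (o x)) -> below p (sext sg o v).
Proof.
move=> vn op; rewrite (sextE _ _ vn); apply: below_sum => x _.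
case: (ltnP (len x) n) => le; first exact/belowZ/op.
by rewrite vn // rmorph0 scale0r.
Qed.

End Model.

(** * The operators of the generators *)

(** Right invertibility, which is invertibility if R is commutative. *)
Definition has_inv (R : pzRingType) (a : R) := exists b, a * b = 1.

Lemma has_inv1 (R : pzRingType) : has_inv (1 : R).
Proof. by exists 1; rewrite mulr1. Qed.
Lemma has_invM (R : comPzRingType) (a b : R) :
  has_inv a -> has_inv b -> has_inv (a * b).
Proof. by case=> a' E [b' E']; exists (a' * b'); rewrite mulrACA E E' mulr1. Qed.
Lemma has_invN (R : pzRingType) (a : R) : has_inv a -> has_inv (- a).
Proof. by case=> b E; exists (- b); rewrite mulrNN. Qed.
Lemma has_inv_rmorph (R S : pzRingType) (f : {rmorphism R -> S}) a :
  has_inv a -> has_inv (f a).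
Proof. by case=> b E; exists (f b); rewrite -rmorphM E rmorph1. Qed.

Section Operators.
Variables (D : diagram) (R : comPzRingType) (bar : {rmorphism R -> R}).
Hypothesis barK : involutive bar.
Local Notation W := (W D).
Local Notation I := ('I_(m D)).
Local Notation s := (@sW D).
Local Notation len := (@lengthW D).
Variable c : I -> nat -> R.
Hypothesis c0 : forall k, has_inv (c k 0).
Local Notation M := (model D R).
Local Notation bas := (@bas D R).
Implicit Types (x y z : W) (k l : I) (n p : nat) (u v : M) (o : I -> W -> M) (w : seq I).

(** v is a unit multiple of [bas x], up to functions supported in smaller
    length. *)
Definition has_lead x v := has_inv (v x) /\ below (len x) (v - v x *: bas x).

Lemma lead_bas x : has_lead x (bas x).
Proof.
rewrite /has_lead basE eqxx scale1r subrr; split; first exact: has_inv1.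
exact: below0.
Qed.

Lemma leadZ x a v : has_inv a -> has_lead x v -> has_lead x (a *: v).
Proof.
move=> ai [vi vx]; split; first exact: has_invM.
by rewrite modelZ -scalerA -scalerBr; apply: belowZ.
Qed.

Lemma leadD x u v : has_lead x u -> below (len x) v -> has_lead x (u + v).
Proof.
move=> [ui ux] vx; rewrite /has_lead modelD (vx x) // addr0; split=> //.
by rewrite addrAC; apply: belowD.
Qed.

Lemma lead_below x v : has_lead x v -> below (len x).+1 v.
Proof.
move=> [_ vx]; rewrite -(subrK (v x *: bas x) v); apply: belowD.
  exact: below_le vx.
by apply: belowZ; apply: below_bas.
Qed.

(** An inverse of a if there is one, and 0 otherwise. *)
Definition some_inv (a : R) : R := xget 0 [set b | a * b = 1].
Lemma some_invP a : has_inv a -> a * some_inv a = 1.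
Proof. by case=> b ab; apply: (@xgetPex _ 0 [set b | a * b = 1]); exists b. Qed.

(** The word w applied to u, when s_k acts on basis elements by o k. *)
Definition word_op o w u : M := foldr (fun k => sext bar (o k)) u w.

(** The i-th power of X_k = s_k s_(k+1), applied to the alternating word of
    length d k which starts with s_(k+1): the word shrinks by two letters at each
    step, and after the middle it grows again with first letter s_k. *)
Definition orbit_word k (i : nat) : seq I :=
  if (i.*2 <= d k)%N then alt (ordS k) k (d k - i.*2)
  else alt k (ordS k) (i.*2 - d k).

(** The element z of which y is the product by the longest element. *)
Definition coset_bottom k y : W :=
  (wordW (rev (alt k (ordS k) (d k))) * y)%g.

(** The value imposed by the braid relation on the alternating word of length
    d k which starts with s_k.  The term i = 0 is [bas y], which is by convention
    the alternating word that starts with s_(k+1). *)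
Definition top_target o k y : M :=
  - \sum_(i < d k) c k i *:
     (if i == 0%N :> nat then bas y else word_op o (orbit_word k i) (bas (coset_bottom k y))).

(** A pair (v, t) such that s_k v = t determines s_k on [bas x], v having leading
    term at x. *)
Definition op_data o k x : M * M :=
  let y := (s k * x)%g in
  if desc k x then (o k y, bas y)
  else if [pick i | pair_desc i y] is Some i then
    let z := coset_bottom i y in
    if k == ordS i then (word_op o (alt i (ordS i) (d i).-1) (bas z), bas y)
    else (word_op o (alt (ordS i) i (d i).-1) (bas z), top_target o i y)
  else (bas x, bas y).

(** The value on [bas x] of the semilinear operator which maps v to t and is
    given by o in smaller length. *)
Definition op_solve o k x : M :=
  let: (v, t) := op_data o k x in
  bar (some_inv (v x)) *: (t - sext bar (o k) (v - v x *: bas x)).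

(** The recursion on the length: [op_upto n] is significant in length < n. *)
Fixpoint op_upto n : I -> W -> M :=
  if n is n'.+1 then fun k x =>
    if (len x < n')%N then op_upto n' k x else op_solve (op_upto n') k x
  else fun _ _ => 0.

Definition op k x : M := op_upto (len x).+1 k x.

Lemma op_uptoE n k x : (len x < n)%N -> op_upto n k x = op k x.
Proof.
elim: n => // n IHn; rewrite ltnS leq_eqVlt => /orP [/eqP <- //|lt].
by rewrite /= lt IHn.
Qed.

Lemma opE k x : op k x = op_solve (op_upto (len x)) k x.
Proof. by rewrite /op /= ltnn. Qed.

(** The semilinear operator of s_k on the whole module. *)
Definition sop k := sext bar (op k).

Lemma sop_upto n k v : below n v -> sext bar (op_upto n k) v = sop k v.
Proof. by move=> vn; apply: (eq_sext _ vn) => x; apply: op_uptoE. Qed.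

(** The invariant of the recursion: in length < n, s_k does not raise the
    length if s_k is a descent of x, and has leading term at s_k x otherwise. *)
Definition op_triangular n := forall x k, (len x < n)%N ->
  if desc k x then below (len x).+1 (op k x) else has_lead (s k * x)%g (op k x).

Lemma op_triangular_below n x k : op_triangular n -> (len x < n)%N -> below (len x).+2 (op k x).
Proof.
move=> gn lt; have := gn x k lt; case: ifP => dk; first exact: below_le.
by move/lead_below; rewrite len_asc ?dk.
Qed.

Lemma sop_below n p k v : op_triangular n -> (p <= n)%N -> below p v -> below p.+1 (sop k v).
Proof.
move=> gn le vp; apply: below_sext vp _ => x lt.
exact: below_le (op_triangular_below k gn (leq_trans lt le)).
Qed.

Lemma sop_lead n k x v : op_triangular n -> (len x < n)%N -> ~~ desc k x ->
  has_lead x v -> has_lead (s k * x)%g (sop k v).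
Proof.
move=> gn lt dk [vi vx]; rewrite -(subrK (v x *: bas x) v) /sop sextD sextZ sext_bas.
rewrite addrC; apply: leadD.
  apply: leadZ; first exact: has_inv_rmorph.
  by have := gn x k lt; rewrite (negbTE dk).
rewrite len_asc //; apply: (sop_below _ gn) vx; exact: ltnW.
Qed.

Lemma word_op_below n w z : op_triangular n -> (size w + len z <= n)%N ->
  below (size w + len z).+1 (word_op op w (bas z)).
Proof.
move=> gn; elim: w => [|k w IHw] le /=; first exact: below_bas.
exact: (sop_below _ gn) (IHw (ltnW le)).
Qed.

Lemma word_op_upto n w z : op_triangular n -> (size w + len z <= n)%N ->
  word_op (op_upto n) w (bas z) = word_op op w (bas z).
Proof.
move=> gn; elim: w => //= k w IHw le; rewrite IHw; last exact: ltnW.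
by apply: sop_upto; apply: below_le (word_op_below gn (ltnW le)).
Qed.

Lemma word_op_lead n w z : op_triangular n -> (size w + len z <= n)%N ->
    len (wordW w * z)%g = (size w + len z)%N ->
  has_lead (wordW w * z)%g (word_op op w (bas z)).
Proof.
move=> gn; elim: w => [|k w IHw] le /= lenE.
  by rewrite wordW0 mul1g; apply: lead_bas.
have lew := len_word_mul w z; move: lenE; rewrite wordW_cons -mulgA.
move=> lenE; have le2 := len_sW_le k (wordW w * z)%g.
have lenE' : len (wordW w * z)%g = (size w + len z)%N.
  by apply/eqP; rewrite eqn_leq lew /=; move: le2; rewrite lenE addSn ltnS.
apply: (sop_lead gn); last exact: IHw (ltnW le) lenE'.
  by rewrite lenE'.
by rewrite /desc lenE lenE' -leqNgt addSn leqW.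
Qed.

Lemma pair_desc_mem i k y : pair_desc i y -> desc k y -> k = i \/ k = ordS i.
Proof.
move=> di dk; case: (eqVneq k i) => [|ki]; [by left | right].
have /andP [di1 _] := di.
have [E|//] := desc_adjacent dk di1 ki.
by case/eqP: ki; apply: pair_desc_inj di; rewrite /pair_desc dk -E.
Qed.

Lemma coset_bottomK i z :
  coset_bottom i (wordW (alt i (ordS i) (d i)) * z)%g = z.
Proof. by rewrite /coset_bottom wordW_rev mulKg. Qed.

Lemma size_orbit_word k i : (0 < i < d k)%N -> (size (orbit_word k i) < (d k).-1)%N.
Proof. by rewrite /orbit_word; case: ifP => _; rewrite size_alt; lia. Qed.

Lemma top_targetE n i z : op_triangular n -> coset_min i (ordS i) z ->
    ((d i).-1 + len z <= n)%N ->
  top_target (op_upto n) i (wordW (alt i (ordS i) (d i)) * z)%g =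
  top_target op i (wordW (alt i (ordS i) (d i)) * z)%g.
Proof.
move=> gn zmin le; congr (- _); apply: eq_bigr => -[p ltp] _ /=.
case: p ltp => //= p ltp; congr (_ *: _).
rewrite coset_bottomK; apply: word_op_upto gn _.
by have := @size_orbit_word i p.+1 ltp; lia.
Qed.

Lemma top_target_lead n i z : op_triangular n -> coset_min i (ordS i) z ->
    ((d i).-1 + len z <= n)%N ->
  let y := (wordW (alt i (ordS i) (d i)) * z)%g in has_lead y (top_target op i y).
Proof.
move=> gn zmin le y; have d0 := ltnW (d_gt1 i).
rewrite /top_target (bigD1 (Ordinal d0)) //= opprD -scaleNr; apply: leadD.
  by apply: leadZ; [apply/has_invN/c0 | apply: lead_bas].
apply/belowN/below_sum => -[p ltp] /=; rewrite -val_eqE /= => p0.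
rewrite (negbTE p0); apply: belowZ; rewrite coset_bottomK.
have lt : (0 < p < d i)%N by rewrite lt0n p0.
have := size_orbit_word lt.
rewrite (len_alt_l zmin) // => lt2.
by apply: below_le (word_op_below gn _); lia.
Qed.

(** Under the invariant, the data of the recursion do not depend on the stage,
    and they have the expected leading terms. *)
Lemma op_dataP n k x : op_triangular n -> len x = n ->
  [/\ op_data (op_upto n) k x = op_data op k x, has_lead x (op_data op k x).1
    & if desc k x then (op_data op k x).2 = bas (s k * x)%g
      else has_lead (s k * x)%g (op_data op k x).2].
Proof.
move=> gn xn; rewrite /op_data; case: ifPn => dk.
  have lt : (len (s k * x)%g < n)%N by rewrite -xn.
  rewrite op_uptoE //; split=> //=.
  have := gn _ k lt; rewrite desc_sW dk /=.
  by rewrite sK.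
(* s_k is a descent of s_k x, hence one of the two letters of the braid relation
   that ends at s_k x, if there is one. *)
case: pickP => [i di|_]; last by split=> //; apply: lead_bas.
have [z zmin yE] := pair_desc_top di.
have dky : desc k (s k * x)%g by rewrite desc_sW.
have lenx : (len x).+1 = (d i + len z)%N.
  by rewrite -(len_asc dk) yE (len_alt_l zmin).
have d0 := ltnW (d_gt1 i).
have le : ((d i).-1 + len z <= n)%N by lia.
have xE : x = (s k * (s k * x))%g by rewrite sK.
have [ki|ki] := pair_desc_mem di dky; subst k.
  rewrite eq_sym (negbTE (ordS_neq i)) yE coset_bottomK.
  rewrite word_op_upto ?size_alt // top_targetE //.
  split=> //=; last exact: top_target_lead zmin le.
  have {}xE : x = (wordW (alt (ordS i) i (d i).-1) * z)%g.
    by rewrite xE yE -{1}(prednK d0) /= wordW_cons -mulgA sK.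
  by rewrite {1}xE; apply: (word_op_lead gn); rewrite size_alt // -xE; lia.
rewrite eqxx yE coset_bottomK.
rewrite word_op_upto ?size_alt //; split=> //=; last exact: lead_bas.
have {}xE : x = (wordW (alt i (ordS i) (d i).-1) * z)%g.
  by rewrite xE yE alt_topC -{1}(prednK d0) /= wordW_cons -mulgA sK.
by rewrite {1}xE; apply: (word_op_lead gn); rewrite size_alt // -xE; lia.
Qed.

Lemma op_solveE n k x : op_triangular n -> len x = n ->
  op k x = bar (some_inv ((op_data op k x).1 x)) *:
    ((op_data op k x).2 - sop k ((op_data op k x).1 - (op_data op k x).1 x *: bas x)).
Proof.
move=> gn xn; have [E ld _] := op_dataP k gn xn.
rewrite opE xn /op_solve E; case: (op_data op k x) ld => v t /= [_ vx].
by rewrite sop_upto // -xn.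
Qed.

Lemma has_inv_some_inv a : has_inv a -> has_inv (some_inv a).
Proof. by move=> /some_invP ai; exists a; rewrite mulrC. Qed.

Lemma op_triangularP n : op_triangular n.
Proof.
elim: n => // n gn x k; rewrite ltnS leq_eqVlt => /orP [/eqP xn|]; last exact: gn.
have [_ ld tP] := op_dataP k gn xn.
rewrite (op_solveE k gn xn).
move: (op_data op k x).1 (op_data op k x).2 ld tP => v t [vi vx] tP.
have lowS : below (len x).+1 (sop k (v - v x *: bas x)).
  by apply: (sop_below _ gn) vx; rewrite xn.
case: ifPn tP => dk tP.
  apply: belowZ; apply: belowB lowS; rewrite tP.
  by apply: below_le (@below_bas _ _ _); rewrite -len_desc.
apply: leadZ; first exact/has_inv_rmorph/has_inv_some_inv.
by apply: leadD => //; apply: belowN; rewrite len_asc.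
Qed.

(** The equations by which the operators were defined. *)
Lemma sop_data k x : sop k (op_data op k x).1 = (op_data op k x).2.
Proof.
have := op_solveE k (@op_triangularP (len x)) erefl.
have [_ ld _] := op_dataP k (@op_triangularP (len x)) erefl.
move: (op_data op k x).1 (op_data op k x).2 ld => v t [vi vx] E.
rewrite -{1}(subrK (v x *: bas x) v) /sop sextD sextZ sext_bas -/(sop k _) E.
by rewrite scalerA -rmorphM some_invP // rmorph1 scale1r addrC subrK.
Qed.

Lemma sopD k u v : sop k (u + v) = sop k u + sop k v. Proof. exact: sextD. Qed.
Lemma sopB k u v : sop k (u - v) = sop k u - sop k v. Proof. exact: sextB. Qed.
Lemma sopZ k a v : sop k (a *: v) = bar a *: sop k v. Proof. exact: sextZ. Qed.

(** To prove a linear property, it is enough to find for each x a vector with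
    leading term at x that has it. *)
Lemma model_lead_ind (P : M -> Prop) :
    P 0 -> (forall u v, P u -> P v -> P (u + v)) -> (forall a v, P v -> P (a *: v)) ->
    (forall x, (forall v, below (len x) v -> P v) -> exists2 v, has_lead x v & P v) ->
  forall v, P v.
Proof.
move=> P0 PD PZ Plead.
have PB n v : below n v -> P v.
  elim: n v => [|n IHn] v vn.
    by rewrite (_ : v = 0) //; apply: model_eq => x; rewrite vn.
  have -> : v = \sum_(x <- ball D n.+1) v x *: bas x.
    apply: model_eq => x; rewrite model_sum.
    have [xb|xb] := boolP (x \in ball D n.+1); last first.
      rewrite mem_ball -ltnNge in xb.
      rewrite vn ?(ltnW xb) // big_seq big1 // => y; rewrite mem_ball => yn.
      rewrite modelZ basE; case: eqP yn => [<-|_ _]; last by rewrite mulr0.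
      by rewrite leqNgt xb.
    rewrite (bigD1_seq x) ?ball_uniq //= eqxx mulr1 big1 ?addr0 // => y yx.
    by rewrite eq_sym (negbTE yx) mulr0.
  elim/big_ind: _ => // x _; case: (ltnP (len x) n.+1) => lt; last first.
    by rewrite vn // scale0r.
  apply: (PZ); have [v' v'b|u [ui ux] Pu] := Plead x.
    by apply: IHn; apply: below_le v'b.
  have [a ua] := ui.
  have -> : bas x = a *: u - a *: (u - u x *: bas x).
    by rewrite -scalerBr opprB addrC subrK scalerA mulrC ua scale1r.
  apply: (PD); first exact: (PZ).
  by rewrite -scaleN1r; apply: (PZ); apply: (PZ); apply: IHn; apply: below_le ux.
by move=> v; have [n vn] := below_ex v; apply: (PB n).
Qed.

Lemma sop_desc k x : desc k x -> sop k (sop k (bas (s k * x)%g)) = bas (s k * x)%g.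
Proof.
move=> dk; have := sop_data k x; rewrite /op_data dk /= => E.
rewrite -[RHS]E; congr (sop k _).
by rewrite /sop sext_bas.
Qed.

(** The operators are involutions: one of x and s_k x has s_k as a descent, and
    the value there was defined by inverting the other one. *)
Lemma sopK k v : sop k (sop k v) = v.
Proof.
elim/model_lead_ind: v => [|u v IHu IHv|a v IHv|x IHx].
- by rewrite /sop !sext0.
- by rewrite !sopD IHu IHv.
- by rewrite !sopZ barK IHv.
case: (boolP (desc k x)) => dk; last first.
  exists (bas x); first exact: lead_bas.
  by have := @sop_desc k (s k * x)%g; rewrite sK desc_sW; apply.
exists (sop k (bas (s k * x)%g)); last by rewrite sop_desc.
have := @sop_lead _ k (s k * x)%g (bas (s k * x)%g) (@op_triangularP (len x)).
by rewrite sK; apply; [ | rewrite desc_sW dk | apply: lead_bas].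
Qed.

End Operators.

(** * The ring of additive endomorphisms *)

Section Endomorphisms.
Variable M : zmodType.

Definition additiveb : {pred M -> M} := fun f => `[< zmod_morphism f >].

Lemma additiveb_zmod_closed : zmod_closed additiveb.
Proof.
split=> [|f g /asboolP fM /asboolP gM]; apply/asboolP => x y.
  by rewrite -[LHS]/(0 : M) -[RHS]/(0 - 0 : M) subr0.
rewrite -[LHS]/(f (x - y) - g (x - y)) fM gM.
rewrite -[RHS]/(f x - g x - (f y - g y)) !opprB addrACA [RHS]addrACA.
by congr (_ + _); rewrite addrC.
Qed.
HB.instance Definition _ :=
  GRing.isZmodClosed.Build _ additiveb additiveb_zmod_closed.

(** The additive endomorphisms of M, a ring under composition. *)
Record endo := Endo { endo_fun :> M -> M; endo_additive : endo_fun \in additiveb }.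
HB.instance Definition _ := [isSub for endo_fun].
HB.instance Definition _ := [Choice of endo by <:].
HB.instance Definition _ := [SubChoice_isSubZmodule of endo by <:].

Lemma endo_eq (f g : endo) : (forall x, f x = g x) -> f = g.
Proof. by move=> fg; apply/val_inj/funext. Qed.

Lemma endoB (f : endo) x y : f (x - y) = f x - f y.
Proof. by have /asboolP -> := endo_additive f. Qed.
Lemma endo0 (f : endo) : f 0 = 0.
Proof. by have := endoB f 0 0; rewrite !subrr. Qed.
Lemma endoN (f : endo) x : f (- x) = - f x.
Proof. by rewrite -[- x]sub0r endoB endo0 sub0r. Qed.
Lemma endoD (f : endo) x y : f (x + y) = f x + f y.
Proof. by rewrite -{1}(opprK y) endoB endoN opprK. Qed.

Definition mkendo (f : M -> M) (fM : zmod_morphism f) : endo :=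
  Endo (introT (asboolP _) fM).

Lemma id_additive : zmod_morphism (@id M). Proof. by []. Qed.
Lemma comp_additive (f g : endo) : zmod_morphism (f \o g).
Proof. by move=> x y /=; rewrite !endoB. Qed.

Definition endo1 : endo := mkendo id_additive.
Definition endoM (f g : endo) : endo := mkendo (comp_additive f g).

Lemma endo_mulA : associative endoM. Proof. by move=> f g h; apply: endo_eq. Qed.
Lemma endo_mul1 : left_id endo1 endoM. Proof. by move=> f; apply: endo_eq. Qed.
Lemma endo_1mul : right_id endo1 endoM. Proof. by move=> f; apply: endo_eq. Qed.
Lemma endo_mulDl : left_distributive endoM +%R.
Proof. by move=> f g h; apply: endo_eq. Qed.
Lemma endo_mulDr : right_distributive endoM +%R.
Proof. by move=> f g h; apply: endo_eq => x /=; rewrite endoD. Qed.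
HB.instance Definition _ := GRing.Zmodule_isPzRing.Build endo
  endo_mulA endo_mul1 endo_1mul endo_mulDl endo_mulDr.

Lemma endo_mulE (f g : endo) x : (f * g) x = f (g x). Proof. by []. Qed.
Lemma endo_oneE x : (1 : endo) x = x. Proof. by []. Qed.
Lemma endo_zeroE x : (0 : endo) x = 0. Proof. by []. Qed.
Lemma endo_sumE J (r : seq J) P (F : J -> endo) x :
  (\sum_(j <- r | P j) F j) x = \sum_(j <- r | P j) F j x.
Proof. by elim/big_rec2: _ => // j y f _ <-. Qed.

End Endomorphisms.

(** * Products of commuting linear factors *)

Section Coef.
Variable R : comPzRingType.

(** The coefficients of the monic polynomial with roots s. *)
Fixpoint root_coef (s : seq R) (i : nat) : R :=
  if s is a :: s' then (if i is i'.+1 then root_coef s' i' else 0) - a * root_coef s' i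
  else (i == 0%N)%:R.

Lemma root_coef_oversize s i : (size s < i)%N -> root_coef s i = 0.
Proof.
elim: s i => [|a s IHs] [|i] //=; rewrite ltnS => lt.
by rewrite !IHs ?mulr0 ?subr0 // ltnW.
Qed.

Lemma root_coef_size s : root_coef s (size s) = 1.
Proof. by elim: s => //= a s ->; rewrite root_coef_oversize // mulr0 subr0. Qed.

Lemma root_coef_0 s : root_coef s 0 = \prod_(a <- s) (- a).
Proof. by elim: s => [|a s IHs]; rewrite ?big_nil // big_cons /= IHs sub0r mulNr. Qed.

Variables (B : pzRingType) (f : {rmorphism R -> B}) (X : B).
Hypothesis fX : forall a, X * f a = f a * X.

Lemma prod_coef s :
  \prod_(a <- s) (X - f a) = \sum_(i < (size s).+1) f (root_coef s i) * X ^+ i.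
Proof.
elim: s => [|a s IHs].
  by rewrite big_nil big_ord_recl big_ord0 rmorph1 mul1r expr0 addr0.
rewrite big_cons IHs mulrBl !mulr_sumr.
transitivity (\sum_(i < (size s).+2)
   ((if (i : nat) is i'.+1 then f (root_coef s i') else 0)
    * X ^+ i - f a * (f (root_coef s i) * X ^+ i))).
  rewrite sumrB [in RHS]big_ord_recl /= mul0r add0r; congr (_ - _).
    by apply: eq_bigr => i _; rewrite mulrA fX exprS mulrA.
  rewrite [in RHS]big_ord_recr /= root_coef_oversize // rmorph0 mul0r mulr0 addr0.
  by [].
apply: eq_bigr => -[[|i] lti] _ /=; rewrite rmorphB rmorphM mulrBl -mulrA //.
by rewrite rmorph0.
Qed.

End Coef.

Section CommProd.
Variables (B : pzRingType) (J : eqType) (F : J -> B).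
Hypothesis FC : forall i j, F i * F j = F j * F i.

(** A product of commuting factors does not depend on their order. *)
Lemma comm_prod_perm s1 s2 : perm_eq s1 s2 ->
  \prod_(j <- s1) F j = \prod_(j <- s2) F j.
Proof.
elim: s1 s2 => [|j s1 IHs] s2.
  by rewrite perm_sym => /perm_nilP ->.
have comm r : F j * \prod_(i <- r) F i = \prod_(i <- r) F i * F j.
  elim: r => [|i r IHr]; first by rewrite big_nil mulr1 mul1r.
  by rewrite big_cons mulrA FC -!mulrA IHr.
move=> ps; have js2 : j \in s2 by rewrite -(perm_mem ps) mem_head.
case/splitPr: js2 ps => u1 u2 ps; rewrite big_cons big_cat big_cons /=.
rewrite (IHs (u1 ++ u2)); first by rewrite big_cat /= !mulrA comm.
by rewrite -(perm_cons j) (permPl ps) -cat1s perm_catCA.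
Qed.

End CommProd.

(** * The braid polynomials on the module *)

Section BraidPolynomial.
Variables (R : comPzRingType) (bar : {rmorphism R -> R}) (n : nat) (v : 'Z_n -> R).
Hypothesis bar_v : forall j, bar (v j) * v (- j) = 1.
Variables (B : pzRingType) (f : {rmorphism R -> B}) (e1 e2 : B).
Hypotheses (e1K : e1 * e1 = 1) (e2K : e2 * e2 = 1).
Hypothesis e1f : forall a, e1 * f a = f (bar a) * e1.
Hypothesis e2f : forall a, e2 * f a = f (bar a) * e2.
Hypothesis barK : involutive bar.

Let X := e1 * e2.
Let Y := e2 * e1.

Lemma braid_comm a : X * f a = f a * X.
Proof. by rewrite /X -mulrA e2f mulrA e1f barK mulrA. Qed.

(** The braid polynomial of X = e1 e2 moves past e1 and e2 up to a left factor:
    conjugation by e turns X into its inverse and v j into bar (v j), which is the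
    inverse of v (- j), so that the set of roots is preserved. *)
Lemma braid_poly_semicomm e : X * e = e * Y -> (forall a, e * f a = f (bar a) * e) ->
  exists g, \prod_j (X - f (v j)) * e = g * \prod_j (X - f (v j)).
Proof.
move=> Xe ef.
have YX : Y * X = 1 by rewrite /X /Y -mulrA (mulrA e1) e1K mul1r e2K.
have XY : X * Y = 1 by rewrite /X /Y -mulrA (mulrA e2) e2K mul1r e1K.
have Yf a : Y * f a = f a * Y by rewrite /Y -mulrA e1f mulrA e2f barK mulrA.
pose F j := X - f (v j); pose h j := - (f (bar (v j)) * Y).
have Fe j : F j * e = e * (h j * F (- j)).
  rewrite /F /h mulNr mulrBr -mulrA YX mulr1 -mulrA Yf mulrA -rmorphM bar_v rmorph1 mul1r.
  by rewrite opprB mulrBr mulrBl Xe ef barK.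
have Ff j a : F j * f a = f a * F j.
  by rewrite /F mulrBl mulrBr braid_comm -!rmorphM [a * _]mulrC.
have FX j : F j * X = X * F j by rewrite /F mulrBl mulrBr braid_comm.
have FC i j : F i * F j = F j * F i.
  have commB (a b b' : B) : a * b = b * a -> a * b' = b' * a ->
      a * (b - b') = (b - b') * a.
    by move=> E E'; rewrite mulrBr mulrBl E E'.
  exact: commB (FX i) (Ff i _).
have FY j : F j * Y = Y * F j by rewrite /F mulrBl mulrBr XY YX Yf.
have Fh i j : F i * h j = h j * F i.
  by rewrite /h mulrN mulNr; congr (- _); rewrite mulrA Ff -mulrA FY mulrA.
have [H [_ E]] : exists H, (forall i, F i * H = H * F i) /\
    \prod_j F j * e = e * H * \prod_j F (- j).
  elim: (index_enum _) => [|j r [H [FH IHr]]].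
    by exists 1; split=> [i|]; rewrite ?big_nil !(mul1r, mulr1).
  exists (h j * H); split=> [i|]; first by rewrite mulrA Fh -!mulrA FH.
  rewrite !big_cons -mulrA IHr -!mulrA [F j * (e * _)]mulrA Fe -!mulrA.
  by congr (_ * (_ * _)); rewrite !mulrA FH.
exists (e * H); rewrite [LHS]E; congr (_ * _).
rewrite -(big_map -%R xpredT F).
have -> // := @comm_prod_perm B _ F FC
  [seq - i | i <- index_enum 'Z_n] (index_enum 'Z_n).
apply: uniq_perm; rewrite ?index_enum_uniq ?(map_inj_uniq oppr_inj) ?index_enum_uniq //.
move=> j; rewrite mem_index_enum; apply/mapP; exists (- j); rewrite ?opprK //.
exact: mem_index_enum.
Qed.

End BraidPolynomial.

Section ModelRelations.
Variables (D : diagram) (R : comPzRingType) (bar : {rmorphism R -> R}).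
Hypothesis barK : involutive bar.
Local Notation W := (W D).
Local Notation I := ('I_(m D)).
Local Notation s := (@sW D).
Local Notation len := (@lengthW D).
Variable v : forall k : I, 'Z_(d k) -> R.
Hypothesis bar_v : forall k (j : 'Z_(d k)), bar (v j) * v (- j) = 1.
Local Notation M := (model D R).
Local Notation bas := (@bas D R).
Implicit Types (x y z : W) (k l : I) (u : M) (w : seq I).

(** The coefficients of the k-th braid polynomial. *)
Definition braid_coef k (i : nat) : R := root_coef [seq v j | j <- index_enum 'Z_(d k)] i.

Lemma size_roots k : size [seq v j | j <- index_enum 'Z_(d k)] = d k.
Proof.
rewrite size_map; have := d_gt1 k.
have -> : size (index_enum 'Z_(d k)) = #|'Z_(d k)| by rewrite cardT enumT.
by rewrite card_ord; case: (d k) => [|[|n]].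
Qed.

Lemma braid_coef_d k : braid_coef k (d k) = 1.
Proof.
by have := root_coef_size [seq @v k j | j <- index_enum 'Z_(d k)]; rewrite size_roots.
Qed.

Lemma braid_coef_0 k : has_inv (braid_coef k 0).
Proof.
rewrite /braid_coef root_coef_0 big_map; elim/big_ind: _ => [|a b|j _].
- exact: has_inv1.
- exact: has_invM.
- apply: has_invN; exists (bar (v (- j))).
  by rewrite mulrC -[X in _ * v X]opprK bar_v.
Qed.

Local Notation sop := (sop bar braid_coef).
Local Notation word_op := (word_op bar (op bar braid_coef)).

Lemma sop_additive k : zmod_morphism (sop k).
Proof. by move=> u u'; apply: sopB. Qed.
Definition sop_endo k : endo M := mkendo (sop_additive k).

Lemma scale_additive (a : R) : zmod_morphism (fun u : M => a *: u).
Proof. by move=> u u'; apply: scalerBr. Qed.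
Definition scale_endo a : endo M := mkendo (scale_additive a).

Lemma scale_endo_zmod_morphism : zmod_morphism scale_endo.
Proof. by move=> a b; apply: endo_eq => u; apply: scalerBl. Qed.
Lemma scale_endo_monoid_morphism : monoid_morphism scale_endo.
Proof.
split=> [|a b]; apply: endo_eq => u; first exact: scale1r.
by rewrite endo_mulE /= scalerA.
Qed.
HB.instance Definition _ :=
  GRing.isZmodMorphism.Build R (endo M) scale_endo scale_endo_zmod_morphism.
HB.instance Definition _ :=
  GRing.isMonoidMorphism.Build R (endo M) scale_endo scale_endo_monoid_morphism.

Lemma sop_endo_sq k : sop_endo k * sop_endo k = 1.
Proof. by apply: endo_eq => u; rewrite endo_mulE /= sopK // => i; apply: braid_coef_0. Qed.

Lemma sop_endo_scale k a : sop_endo k * scale_endo a = scale_endo (bar a) * sop_endo k.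
Proof. by apply: endo_eq => u; rewrite !endo_mulE /= sopZ. Qed.

(** The k-th braid polynomial, evaluated on the operators. *)
Definition braid_endo k : endo M :=
  \prod_j (sop_endo k * sop_endo (ordS k) - scale_endo (@v k j)).

Lemma braid_endoE k u : braid_endo k u =
  \sum_(i < (d k).+1) braid_coef k i *: iter i (sop k \o sop (ordS k)) u.
Proof.
have comm a : sop_endo k * sop_endo (ordS k) * scale_endo a =
    scale_endo a * (sop_endo k * sop_endo (ordS k)).
  exact: (braid_comm (sop_endo_scale k) (sop_endo_scale (ordS k)) barK).
rewrite /braid_endo.
rewrite -(big_map (@v k) xpredT
  (fun a => sop_endo k * sop_endo (ordS k) - scale_endo a)).
rewrite (prod_coef comm) size_roots endo_sumE.
apply: eq_bigr => i _; rewrite endo_mulE /=; congr (_ *: _).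
elim: (i : nat) => [|n IHn]; first by rewrite expr0.
by rewrite exprS endo_mulE IHn iterS.
Qed.

(** The kernel of the braid polynomial is stable under s_k and s_(k+1). *)
Lemma braid_endo_S k i u : pred2 k (ordS k) i ->
  braid_endo k u = 0 -> braid_endo k (sop i u) = 0.
Proof.
move=> ki u0.
have [g E] : exists g, braid_endo k * sop_endo i = g * braid_endo k.
  apply: (braid_poly_semicomm (@bar_v k) (sop_endo_sq _) (sop_endo_sq _)
    (sop_endo_scale _) (sop_endo_scale _) barK); last exact: sop_endo_scale.
  case/orP: ki => /eqP ->; first by rewrite -mulrA.
  by rewrite -mulrA sop_endo_sq mulr1 mulrA sop_endo_sq mul1r.
by rewrite -[LHS]/((braid_endo k * sop_endo i) u) E endo_mulE u0 endo0.
Qed.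

Lemma sop_invol k u : sop k (sop k u) = u.
Proof. by apply: sopK => // i; apply: braid_coef_0. Qed.

Lemma braid_endo_word_op k w u : all (pred2 k (ordS k)) w ->
  braid_endo k (word_op w u) = 0 <-> braid_endo k u = 0.
Proof.
elim: w => //= i w IHw /andP [ki /IHw <-]; split; last exact: braid_endo_S.
by move=> /(braid_endo_S ki); rewrite sop_invol.
Qed.

(** The two alternating words of length d k, applied to a minimal coset
    representative. *)
Lemma orbit_top k z : coset_min k (ordS k) z ->
  let y := (wordW (alt k (ordS k) (d k)) * z)%g in
  word_op (alt (ordS k) k (d k)) (bas z) = bas y /\
  word_op (alt k (ordS k) (d k)) (bas z) = top_target bar braid_coef (op bar braid_coef) k y.
Proof.
move=> zmin y; have d0 := ltnW (d_gt1 k).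
have /andP [dk dl] := top_pair_desc zmin.
have step i : desc i y -> sop i (op_data bar braid_coef (op bar braid_coef) i (s i * y)%g).1 =
    (op_data bar braid_coef (op bar braid_coef) i (s i * y)%g).2.
  by move=> _; apply: sop_data; apply: braid_coef_0.
have pickE : [pick i | pair_desc i y] = Some k.
  case: pickP => [i di|/(_ k)]; last by rewrite top_pair_desc.
  by congr Some; apply: pair_desc_inj di (top_pair_desc zmin).
have := step _ dl; have := step _ dk.
rewrite /op_data !desc_sW dk dl /= !sK pickE eqxx eq_sym (negbTE (ordS_neq k)) /=.
have wdE a b u : word_op (alt a b (d k)) u = sop a (word_op (alt b a (d k).-1) u).
  by rewrite -{1}(prednK d0).
by rewrite !coset_bottomK !wdE => -> ->.
Qed.

Lemma braid_endo_top k z : coset_min k (ordS k) z -> braid_endo k (bas z) = 0.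
Proof.
move=> zmin; have [E1 E2] := orbit_top zmin.
apply/(@braid_endo_word_op k (alt (ordS k) k (d k))).
  by apply: sub_all (alt_pair _ _ _) => i /=; rewrite orbC.
(* the powers of X_k applied to the alternating word of length d k *)
pose G i := word_op (orbit_word k i) (bas z).
have G0 : G 0%N = word_op (alt (ordS k) k (d k)) (bas z).
  by rewrite /G /orbit_word double0 subn0.
have GS i : (i < d k)%N -> sop k (sop (ordS k) (G i)) = G i.+1.
  move=> lt; rewrite /G /orbit_word; case: (leqP i.+1.*2 (d k)) => le.
    have -> : (i.*2 <= d k)%N by lia.
    have -> : (d k - i.*2 = (d k - i.+1.*2).+2)%N by lia.
    by rewrite /= !sop_invol.
  case: (ltngtP i.*2 (d k)) => le2.
  - have -> : (d k - i.*2 = 1)%N by lia.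
    have -> : (i.+1.*2 - d k = 1)%N by lia.
    by rewrite /= sop_invol.
  - by have -> : (i.+1.*2 - d k = (i.*2 - d k).+2)%N by lia.
  - have -> : (i.+1.*2 - d k = 2)%N by lia.
    by rewrite le2 subnn.
have iterG i : (i <= d k)%N -> iter i (sop k \o sop (ordS k)) (G 0%N) = G i.
  by elim: i => //= i IHi lt; rewrite IHi ?GS // ltnW.
rewrite -G0 braid_endoE big_ord_recr /= braid_coef_d scale1r iterG //.
have -> : G (d k) = word_op (alt k (ordS k) (d k)) (bas z).
  rewrite /G /orbit_word; case: leqP => [|lt]; first by have := d_gt1 k; lia.
  by rewrite -addnn addnK.
rewrite E2 /top_target coset_bottomK; apply/eqP; rewrite subr_eq0; apply/eqP.
apply: eq_bigr => i _; rewrite iterG 1?ltnW //; congr (_ *: _).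
case: (i : nat) => // ; by rewrite G0 E1.
Qed.

(** The vectors obtained from minimal coset representatives by alternating words
    are killed, and they have leading terms at all elements of W. *)
Lemma braid_endo0 k : braid_endo k = 0.
Proof.
apply: endo_eq => u; rewrite endo_zeroE.
elim/(model_lead_ind): u => [|u u' IHu IHu'|a u IHu|x IHx].
- exact: endo0.
- by rewrite endoD IHu IHu' addr0.
- have : braid_endo k * scale_endo a = scale_endo a * braid_endo k.
    rewrite /braid_endo; elim/big_rec: _ => [|j Q _ IHQ]; first by rewrite mul1r mulr1.
    rewrite -mulrA IHQ !mulrA mulrBl mulrBr -!rmorphM [_ * a]mulrC.
    by rewrite (braid_comm (sop_endo_scale k) (sop_endo_scale (ordS k)) barK).
  by move=> E; rewrite -[LHS]/((braid_endo k * scale_endo a) u) E endo_mulE IHu endo0.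
have [z [p [zmin le xE]]] := coset_decomp k x.
have goodn := @op_triangularP D R bar _ braid_coef_0 (d k + len z).
have leadP w : x = (wordW w * z)%g -> size w = p -> all (pred2 k (ordS k)) w ->
    len (wordW w * z)%g = (p + len z)%N ->
    exists2 u, has_lead x u & braid_endo k u = 0.
  move=> xw wp kw lenw; exists (word_op w (bas z)).
    by rewrite xw; apply: word_op_lead goodn _ _ => //; rewrite wp // leq_add2r.
  by apply/braid_endo_word_op => //; apply: braid_endo_top.
case: xE => xE; apply: leadP xE _ _ _; rewrite ?size_alt ?alt_pair //.
- exact: len_alt_l.
- by apply: sub_all (alt_pair _ _ _) => i /=; rewrite orbC.
- exact: len_alt_r.
Qed.

End ModelRelations.

(** * The action of A and linear independence *)

Section Roots.
Variables (K : realType) (D : diagram).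
Local Notation R := (RR K D).

Lemma cexpD (x y : K) : cexp x * cexp y = cexp (x + y).
Proof.
rewrite /cexp cosD sinD; apply/eqP; rewrite eq_complex /=.
by rewrite [_ * sin y + _]addrC !eqxx.
Qed.

Lemma cexp0 : cexp (0 : K) = 1.
Proof. by rewrite /cexp cos0 sin0. Qed.

Lemma cexp2pi : cexp (2 * pi : K) = 1.
Proof. by rewrite /cexp mulr_natl cos2pi sin2pi. Qed.

Lemma cexp_opp n (j : 'Z_n) : (1 < n)%N ->
  cexp (2 * pi * (j : nat)%:R / n%:R) * cexp (2 * pi * ((- j : 'Z_n) : nat)%:R / n%:R)
    = 1 :> K[i].
Proof.
case: n j => [|[|n]] // j _; rewrite cexpD /=.
have [-> | j0] := eqVneq j 0.
  by rewrite /= subn0 modnn !mulr0 !mul0r addr0 cexp0.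
have jpos : (0 < j)%N by rewrite lt0n.
have ltj : (j < n.+2)%N := ltn_ord j.
have -> : ((n.+2 - j) %% (Zp_trunc n.+2).+2)%N = (n.+2 - j)%N.
  by apply: modn_small; rewrite /Zp_trunc /= -[ltnLHS]/(n.+2 - j)%N; lia.
rewrite -mulrDl -mulrDr -natrD subnKC; last exact: ltnW.
by rewrite mulfK ?cexp2pi // pnatr_eq0.
Qed.

Lemma rcM (a b : K[i]) : rc D a * rc D b = rc D (a * b).
Proof. exact: coordRing_eq. Qed.
Lemma rc1 : rc D (1 : K[i]) = 1.
Proof. exact: coordRing_eq. Qed.

Lemma rtVK k (j : 'Z_(d k)) : rt K[i] j * rtV K[i] j = 1 :> coordRing K[i] D.
Proof. by apply: coordRing_eq => p; apply: mulfV; apply: tcoord_neq0. Qed.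

Lemma bar_u k (j : 'Z_(d k)) : bar (@u K D k j) * @u K D k (- j) = 1.
Proof.
rewrite /u rmorphM /= bar_cst bar_t mulrACA rcM cexp_opp ?d_gt1 // rc1 mul1r.
by rewrite mulrC rtVK.
Qed.

Lemma bar_qV : bar (rqV K[i] D) = rq K[i] D.
Proof. by apply: coordRing_eq => p /=; rewrite /qV_fun /= invrK. Qed.

(** The roots of the k-th braid polynomial of A. *)
Definition braid_root k (j : 'Z_(d k)) : R := (rqV K[i] D : R) ^+ delta k * @u K D k j.

Lemma bar_braid_root k (j : 'Z_(d k)) :
  bar (braid_root j) * braid_root (- j) = 1 :> R.
Proof.
rewrite /braid_root rmorphM rmorphXn /= bar_qV mulrACA bar_u mulr1 -exprMn.
by rewrite rqVK expr1n.
Qed.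

End Roots.

Section ModelModule.
Variables (K : realType) (D : diagram).
Local Notation R := (RR K D).
Local Notation A := (A K D).
Local Notation W := (W D).
Local Notation I := ('I_(m D)).
Local Notation M := (model D R).
Local Notation br := (@braid_root K D).
Local Notation barR := (@bar K[i] D : {rmorphism R -> R}).

Local Notation E := (@sop_endo D R barR br).
Local Notation F := (@scale_endo D R).

Lemma model_respects : respects (@relA K D) F E.
Proof.
move=> x y [k|k f|k].
- rewrite rmorphXn /= freeLift_gen rmorph1 expr2.
  exact: (sop_endo_sq (@barK _ _) (@bar_braid_root K D)).
- rewrite !rmorphM /= !freeLift_cst freeLift_gen; exact: sop_endo_scale.
- rewrite rmorph_prod rmorph0.
  rewrite -[RHS](braid_endo0 (@barK _ _) (@bar_braid_root K D) k).
  apply: eq_bigr => j _; rewrite rmorphB /= freeLift_cst; congr (_ - _).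
  by rewrite rmorphM /= !freeLift_gen.
Qed.

(** The action of A on the module. *)
Definition act_model : A -> endo M := presLift model_respects.
HB.instance Definition _ := GRing.RMorphism.on act_model.

Lemma act_cst f v : act_model (cstA f) v = f *: v.
Proof. by rewrite /act_model presLift_cst. Qed.
Lemma act_s k v : act_model (sA K k) v = sop barR (braid_coef br) k v.
Proof. by rewrite /act_model presLift_gen. Qed.

Lemma act_scale f a v : act_model (f *: a) v = f *: act_model a v.
Proof. by rewrite rscaleE rmorphM endo_mulE act_cst. Qed.

Lemma T_0 : T_ K [::] = 1 :> A. Proof. by rewrite /T_ big_nil. Qed.
Lemma T_cons k w : T_ K (k :: w) = sA K k * T_ K w :> A.
Proof. by rewrite /T_ big_cons. Qed.
Lemma T_cat w v : T_ K (w ++ v) = T_ K w * T_ K v :> A.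
Proof. by rewrite /T_ big_cat. Qed.

Lemma act_T_lead w : size w = lengthW (wordW w) ->
  has_lead (wordW w) (act_model (T_ K w) (bas R 1%g)).
Proof.
move=> wred.
have actE v u : act_model (T_ K v) u = word_op barR (op barR (braid_coef br)) v u.
  elim: v => [|k v IHv]; first by rewrite T_0 rmorph1.
  by rewrite T_cons rmorphM endo_mulE IHv act_s.
rewrite actE -[X in has_lead X _]mulg1.
have c0 k : has_inv (braid_coef br k 0) := braid_coef_0 (@bar_braid_root K D) k.
apply: (word_op_lead (@op_triangularP D R barR _ c0 (size w))); rewrite ?len1 ?addn0 //.
by rewrite mulg1 wred.
Qed.

Lemma T_free (w : W -> seq I) (w_red : forall x, reduced_decomposition x (w x))
    (s : seq W) (c : W -> R) : uniq s ->
  \sum_(x <- s) c x *: T_ K (w x) = 0 -> {in s, forall x, c x = 0}.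
Proof.
move=> us s0.
have wl x : has_lead x (act_model (T_ K (w x)) (bas R 1%g)).
  by have [E E'] := w_red x; rewrite -{1}E; apply: act_T_lead; rewrite E.
pose b x := act_model (T_ K (w x)) (bas R 1%g).
have sum0 : \sum_(x <- s) c x *: b x = 0.
  transitivity (act_model (\sum_(x <- s) c x *: T_ K (w x)) (bas R 1%g)).
    rewrite rmorph_sum endo_sumE; apply: eq_bigr => x _.
    by rewrite -act_scale.
  by rewrite s0 rmorph0 endo_zeroE.
suff main : forall n x, x \in s -> (n <= lengthW x)%N -> c x = 0.
  by move=> x xs; apply: (main 0%N).
move=> n x.
have [N Nmax] : exists N, forall x, x \in s -> (lengthW x < N)%N.
  exists (\max_(y <- s) (@lengthW D y).+1) => y ys.
  exact: (@leq_bigmax_seq _ s xpredT (fun x => (lengthW x).+1)).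
(* descending induction on the length *)
have [le|/ltnW le] := leqP n N; last first.
  by move=> xs nx; have := Nmax x xs; lia.
move: x; rewrite -(subKn le); elim: (N - n)%N => [|p IHp] x xs lex.
  by have := Nmax x xs; rewrite subn0 in lex; lia.
have [lt|ge] := ltnP (N - p.+1)%N (lengthW x); first by apply: IHp => //; lia.
have := congr1 (fun v : M => v x) sum0; rewrite model_sum model0.
rewrite (bigD1_seq x) // modelZ big1_seq => [|y /andP [yx ys]].
  rewrite [X in X = _]addr0; have [[a ba] _] := wl x => cb.
  by rewrite -[c x]mulr1 -ba mulrA cb mul0r.
rewrite modelZ; have [lt|ge'] := ltnP (N - p.+1)%N (lengthW y).
  by rewrite IHp ?mul0r //; lia.
suff -> : b y x = 0 by rewrite mulr0.
have [_ /(_ x)] := wl y.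
have le2 : (lengthW y <= lengthW x)%N by lia.
move=> /(_ le2); rewrite modelD modelN modelZ basE eq_sym (negbTE yx) mulr0 subr0.
by [].
Qed.

End ModelModule.

(** * Reduced words span A *)

Section Spanning.
Variables (K : realType) (D : diagram).
Local Notation R := (RR K D).
Local Notation A := (A K D).
Local Notation W := (W D).
Local Notation I := ('I_(m D)).
Local Notation br := (@braid_root K D).
Local Notation bc := (@braid_coef D R br).
Local Notation len := (@lengthW D).
Local Notation s := (sA K).
Local Notation T_ := (@T_ K D).
Variables (w : W -> seq I) (w_red : forall x, reduced_decomposition x (w x)).
Implicit Types (x y z : W) (k j : I) (a b : A) (N n : nat) (u v : seq I).
Local Notation T x := (T_ (w x)).

Lemma scaleA a (f : R) : f *: a = cstA f * a. Proof. by []. Qed.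
Lemma scale_mull (f : R) a b : f *: a * b = f *: (a * b).
Proof. by rewrite !scaleA mulrA. Qed.
Lemma s_scale k (f : R) a : s k * (f *: a) = @bar K[i] D f *: (s k * a).
Proof. by rewrite !scaleA mulrA sA_cst mulrA. Qed.

(** a is a combination of the T_(w(x)) with x of length less than N. *)
Definition lower N a := exists c : W -> R,
  a = \sum_(x <- ball D N | (len x < N)%N) c x *: T x.

Lemma lower0 N : lower N 0.
Proof. by exists (fun _ => 0); rewrite big1 // => x _; rewrite scale0r. Qed.
Lemma lowerD N a b : lower N a -> lower N b -> lower N (a + b).
Proof.
move=> [c ->] [e ->]; exists (fun x => c x + e x); rewrite -big_split /=.
by apply: eq_bigr => x _; rewrite scalerDl.
Qed.
Lemma lowerZ N (f : R) a : lower N a -> lower N (f *: a).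
Proof.
move=> [c ->]; exists (fun x => f * c x); rewrite scaler_sumr.
by apply: eq_bigr => x _; rewrite scalerA.
Qed.
Lemma lowerN N a : lower N a -> lower N (- a).
Proof. by rewrite -scaleN1r; apply: lowerZ. Qed.
Lemma lower_T N x : (len x < N)%N -> lower N (T x).
Proof.
move=> lt; exists (fun y => (y == x)%:R).
rewrite -big_filter (bigD1_seq x) ?filter_uniq ?ball_uniq //=; last first.
  by rewrite mem_filter lt mem_ball ltnW.
rewrite eqxx scale1r big1 ?addr0 // => y /negbTE ->; exact: scale0r.
Qed.
Lemma lower_sum N J (r : seq J) (P : pred J) (F : J -> A) :
  (forall i : J, P i -> lower N (F i)) -> lower N (\sum_(i <- r | P i) F i).
Proof. by move=> FP; apply: big_ind => //; [exact: lower0 | exact: lowerD]. Qed.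
Lemma lower_le n N a : (n <= N)%N -> lower n a -> lower N a.
Proof.
move=> le [c ->]; apply: lower_sum => x lt; apply/lowerZ/lower_T.
exact: leq_trans lt le.
Qed.

(** a and b agree up to a unit of R and up to terms of length less than N. *)
Definition assoc_mod N a b := exists2 f : R, has_inv f & lower N (a - f *: b).

Lemma assoc_mod_sym N a b : assoc_mod N a b -> assoc_mod N b a.
Proof.
move=> [f [g fg] lab]; exists g; first by exists f; rewrite mulrC.
have -> : b - g *: a = - (g *: (a - f *: b)).
  by rewrite scalerBr scalerA mulrC fg scale1r opprB.
exact/lowerN/lowerZ.
Qed.
Lemma assoc_mod_trans N a b e : assoc_mod N a b -> assoc_mod N b e -> assoc_mod N a e.
Proof.
move=> [f fi lab] [g gi lbe]; exists (f * g); first exact: has_invM.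
have -> : a - (f * g) *: e = (a - f *: b) + f *: (b - g *: e).
  by rewrite scalerBr scalerA addrA subrK.
by apply: lowerD => //; apply: lowerZ.
Qed.
Lemma assoc_mod_lower N n a b : (N <= n)%N -> assoc_mod N a b -> lower n b -> lower n a.
Proof.
move=> le [f _ lab] lb; rewrite -(subrK (f *: b) a); apply: lowerD.
  exact: lower_le lab.
exact: lowerZ.
Qed.

(** The braid relation in A: the alternating word which starts with s_k, in terms
    of the one which starts with s_(k+1) (the term i = 0) and of shorter words. *)
Lemma braid_T k : T_ (alt k (ordS k) (d k)) =
  - \sum_(i < d k) bc k i *: T_ (orbit_word k i).
Proof.
have comm f : s k * s (ordS k) * cstA f = cstA f * (s k * s (ordS k)).
  exact: ssA_cst.
have := sA_poly K k.
rewrite -(big_map (@br k) xpredT (fun f : R => s k * s (ordS k) - cstA f)).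
rewrite (prod_coef comm) (size_roots br).
move=> /(congr1 (fun a => a * T_ (alt (ordS k) k (d k)))).
have GS i : (i < d k)%N ->
    s k * s (ordS k) * T_ (orbit_word k i) = T_ (orbit_word k i.+1).
  have sK j a : s j * (s j * a) = a by rewrite mulrA sA_sq mul1r.
  move=> lt; rewrite /orbit_word -mulrA; case: (leqP i.+1.*2 (d k)) => le.
    have -> : (i.*2 <= d k)%N by lia.
    have -> : (d k - i.*2 = (d k - i.+1.*2).+2)%N by lia.
    by rewrite /= !T_cons !sK.
  case: (ltngtP i.*2 (d k)) => le2.
  - have -> : (d k - i.*2 = 1)%N by lia.
    have -> : (i.+1.*2 - d k = 1)%N by lia.
    by rewrite /= !T_cons sK.
  - have -> : (i.+1.*2 - d k = (i.*2 - d k).+2)%N by lia.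
    by rewrite /= !T_cons.
  - have -> : (i.+1.*2 - d k = 2)%N by lia.
    by rewrite le2 subnn /= !T_cons.
have iterG i : (i <= d k)%N ->
    (s k * s (ordS k)) ^+ i * T_ (alt (ordS k) k (d k)) = T_ (orbit_word k i).
  elim: i => [|i IHi] lt; first by rewrite expr0 mul1r /orbit_word double0 subn0.
  by rewrite exprS -mulrA IHi ?GS // ltnW.
rewrite /= mul0r mulr_suml big_ord_recr /= -[root_coef _ (d k)]/(bc k (d k)).
rewrite braid_coef_d rmorph1 mul1r iterG //.
have -> : orbit_word k (d k) = alt k (ordS k) (d k).
  rewrite /orbit_word; case: leqP => [|lt]; first by have := d_gt1 k; lia.
  by rewrite -addnn addnK.
rewrite addrC => /eqP; rewrite addr_eq0 => /eqP ->; congr (- _).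
by apply: eq_bigr => i _; rewrite -mulrA iterG 1?ltnW.
Qed.

Lemma orbit_word0 k : orbit_word k 0 = alt (ordS k) k (d k).
Proof. by rewrite /orbit_word double0 subn0. Qed.

(** The two statements about length N that are proved together by induction. *)
Definition span_step N :=
  (forall u v, size u = N -> size v = N -> wordW u = wordW v ->
    len (wordW u) = N -> assoc_mod N (T_ u) (T_ v)) /\
  (forall k a, lower N a -> lower N.+1 (s k * a)).

Lemma lower_word N u n a : (forall p, (p < N)%N -> span_step p) ->
  (size u + n <= N)%N -> lower n a -> lower (size u + n) (T_ u * a).
Proof.
move=> IH; elim: u => [|k u IHu] le la; first by rewrite T_0 mul1r.
rewrite T_cons -mulrA; have [_] := IH (size u + n)%N le; apply.
exact: IHu (ltnW le) la.
Qed.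

Lemma assoc_mod_same_head N k u v : (forall p, (p < N)%N -> span_step p) ->
    size (k :: u) = N -> size (k :: v) = N ->
    wordW (k :: u) = wordW (k :: v) -> len (wordW (k :: u)) = N ->
  assoc_mod N (T_ (k :: u)) (T_ (k :: v)).
Proof.
case: N => // N IH [su] [sv]; rewrite !wordW_cons => /mulgI E lenE.
have [IH1 IH2] := IH N (ltnSn N).
have lenu : len (wordW u) = N.
  have := len_word u; have := len_sW_le k (wordW u); rewrite lenE su; lia.
have [f fi lf] := IH1 u v su sv E lenu.
exists (@bar K[i] D f); first exact: has_inv_rmorph.
by rewrite !T_cons -s_scale -mulrBr; apply: IH2.
Qed.

Lemma assoc_mod_braid N k z u : (forall p, (p < N)%N -> span_step p) ->
    coset_min k (ordS k) z -> wordW u = z -> size u = len z ->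
    N = (d k + len z)%N ->
  assoc_mod N (T_ (alt k (ordS k) (d k) ++ u)) (T_ (alt (ordS k) k (d k) ++ u)).
Proof.
move=> IH zmin uz su NE; have d1 := d_gt1 k.
exists (- bc k 0); first exact/has_invN/braid_coef_0/bar_braid_root.
rewrite !T_cat braid_T.
have ltd : (0 < d k)%N by exact: ltnW.
rewrite (bigD1 (Ordinal ltd)) //= orbit_word0 opprD mulrDl -scaleNr scale_mull.
rewrite addrAC subrr add0r mulNr mulr_suml; apply/lowerN/lower_sum => i i0.
rewrite scale_mull; apply: lowerZ.
have lti : (0 < i < d k)%N.
  rewrite ltn_ord lt0n andbT; apply: contraNneq i0 => i0.
  exact/eqP/val_inj.
have lto := size_orbit_word lti.
have lu : lower (len z).+1 (T_ u).
  have [IH1 _] : span_step (len z) by apply: IH; lia.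
  have [wE ws] := w_red z.
  apply: assoc_mod_lower (leqnSn _) (IH1 u (w z) su ws _ _) (lower_T (leqnn _)).
    by rewrite uz wE.
  by rewrite uz.
apply: lower_le (lower_word IH _ lu); lia.
Qed.

Lemma assoc_mod_reduced N u v : (forall p, (p < N)%N -> span_step p) ->
    size u = N -> size v = N -> wordW u = wordW v -> len (wordW u) = N ->
  assoc_mod N (T_ u) (T_ v).
Proof.
move=> IH; case: u v => [|k u] [|j v].
- move=> _ _ _ _; exists 1; first exact: has_inv1.
  by rewrite scale1r subrr; apply: lower0.
- by move=> <-.
- by move=> <-.
have [-> | kj] := eqVneq k j; first exact: assoc_mod_same_head.
move=> su sv E lenE.
have dk : desc k (wordW (k :: u)).
  by rewrite /desc lenE wordW_cons sK -su; apply: (len_word u).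
have dj : desc j (wordW (k :: u)).
  by rewrite /desc lenE E wordW_cons sK -sv; apply: (len_word v).
(* k and j are the letters of one braid relation, in one order or the other. *)
wlog jk : k j u v kj su sv E lenE dk dj / j = ordS k.
  move=> IHw; have [jk|jk] := desc_adjacent dk dj kj; first exact: IHw.
  by apply: assoc_mod_sym; apply: IHw => //; rewrite -?E // eq_sym.
subst j; set y := wordW (k :: u) in E lenE dk dj *.
have [|z zmin yE] := @pair_desc_top D k y; first by rewrite /pair_desc dk.
have [r [rz sr]] := reduced_ex z.
have NE : N = (d k + len z)%N by rewrite -lenE yE len_alt_l.
have [c1 c2] : wordW (alt k (ordS k) (d k) ++ r) = y /\
    wordW (alt (ordS k) k (d k) ++ r) = y.
  by rewrite !wordW_cat -alt_topC rz yE.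
have := assoc_mod_braid IH zmin rz sr NE.
have altE (i i' : I) : alt i i' (d k) = i :: alt i' i (d k).-1.
  by rewrite -{1}(prednK (ltnW (d_gt1 k))).
rewrite !altE !cat_cons in c1 c2 * => cb.
have szN (v' : seq I) : size v' = (d k).-1 -> (size (v' ++ r)).+1 = N.
  by rewrite size_cat sr NE => ->; have := d_gt1 k; lia.
apply: assoc_mod_trans (assoc_mod_trans _ cb) _; apply: assoc_mod_same_head => //.
- by rewrite /= szN ?size_alt.
- by rewrite /= szN ?size_alt.
- by rewrite c2.
- by rewrite c2.
Qed.

Lemma lower_s N k a : (forall p, (p < N)%N -> span_step p) ->
  lower N a -> lower N.+1 (s k * a).
Proof.
move=> IH [c ->]; rewrite mulr_sumr; apply: lower_sum => x lt.
rewrite s_scale; apply: lowerZ; have [wE ws] := w_red x.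
move: lt; rewrite leq_eqVlt => /orP [/eqP xN|lt]; last first.
  by have [_ IH2] := IH _ lt; apply: lower_le (IH2 k _ (lower_T (ltnSn _))); exact: ltnW.
(* If s_k is a descent of x, T_(w(x)) may be replaced by a word that begins with
   s_k; otherwise s_k T_(w(x)) is given by a reduced word of s_k x. *)
have [dk|dk] := boolP (desc k x).
  have [x' x'E] : exists x', x' = (sW k * x)%g by exists (sW k * x)%g.
  have [wE' ws'] := w_red x'.
  have xE : wordW (k :: w x') = x by rewrite wordW_cons wE' x'E sK.
  have szx : size (k :: w x') = len x by rewrite /= ws' x'E [RHS](len_desc dk).
  have lx : (len x < N)%N by rewrite -xN.
  have [IH1 IH2] := IH _ lx.
  have [||||f _ lf] := IH1 (w x) (k :: w x'); rewrite ?wE //.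
  have -> : T x = (T x - f *: T_ (k :: w x')) + f *: T_ (k :: w x') by rewrite subrK.
  rewrite mulrDr; apply: lowerD; first by apply: lower_le (IH2 _ _ lf); lia.
  rewrite s_scale T_cons mulrA sA_sq mul1r; apply/lowerZ/lower_T.
  by move: szx; rewrite /= ws'; lia.
have [wE' ws'] := w_red (sW k * x)%g.
have lenk := len_asc dk.
have cmpT : assoc_mod N (T_ (k :: w x)) (T (sW k * x)%g).
  apply: assoc_mod_reduced IH _ _ _ _.
  - by rewrite /= ws.
  - by rewrite ws' lenk xN.
  - by rewrite wordW_cons wE wE'.
  - by rewrite wordW_cons wE lenk xN.
by rewrite -T_cons; apply: assoc_mod_lower (leqnSn _) cmpT (lower_T _); rewrite lenk xN.
Qed.

Lemma span_step_all N : span_step N.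
Proof.
elim/ltn_ind: N => N IH; split; first by move=> u v; apply: assoc_mod_reduced.
by move=> k a; apply: lower_s.
Qed.

Lemma length_le_lower N a : length_le N a -> lower N.+1 a.
Proof.
move=> la; suff lmul n b : lower n b -> lower (N + n) (a * b).
  rewrite -addn1 -[a]mulr1; apply: lmul; have [wE ws] := w_red 1%g.
  have -> : 1 = T 1%g :> A.
    by move: ws; rewrite len1; case: (w _) => // _; rewrite T_0.
  by apply: lower_T; rewrite len1.
elim: la n b => {N a} [f|k|n p a le _ IHa|n a b _ IHa _ IHb|n p a b _ IHa _ IHb] N e le'.
- exact: lowerZ.
- by have [_] := span_step_all N; apply.
- by apply: lower_le (IHa _ _ le'); rewrite leq_add2r.
- by rewrite mulrDl; apply: lowerD; [apply: IHa | apply: IHb].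
- by rewrite -mulrA -addnA; apply/IHa/IHb.
Qed.

Lemma length_le_T u : length_le (size u) (T_ u).
Proof.
elim: u => [|k u IHu]; first by rewrite T_0 -(rmorph1 (@cstA K D)); constructor.
rewrite T_cons [size _]/= -add1n; apply: length_le_mul IHu; constructor.
Qed.

Lemma length_le_ex a : exists N, length_le N a.
Proof.
elim/rquo_ind: a; elim=> [f|k|a [n la]|a [n la] b [p lb]|a [n la] b [p lb]].
- by exists 0%N; apply: length_le_cst.
- by exists 1%N; apply: length_le_s.
- exists (0 + n)%N; rewrite rpiN -mulN1r.
  apply: length_le_mul la; rewrite -(rmorphN1 (@cstA K D)); exact: length_le_cst.
- exists (maxn n p); rewrite rpiD; apply: length_le_add.
    by apply: length_le_leq la; rewrite leq_maxl.
  by apply: length_le_leq lb; rewrite leq_maxr.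
- by exists (n + p)%N; rewrite rpiM; apply: length_le_mul.
Qed.

End Spanning.

(** * Injectivity of eta *)

Section Injectivity.
Variables (K : realType) (D : diagram).
Local Notation R := (RR K D).
Local Notation A := (A K D).
Local Notation H := (H K D).
Local Notation I := ('I_(m D)).
Local Notation br := (@braid_root K D).
Local Notation q := (rq K[i] D : R).
Local Notation qV := (rqV K[i] D : R).
Local Notation barR := (@bar K[i] D : {rmorphism R -> R}).
Local Notation cstH := (@cstH K D).
Local Notation TH := (@TH K D).
Implicit Types (k l : I) (f : R) (h : H).

Lemma TH_cst k f : TH k * cstH f = cstH f * TH k.
Proof.
have := pres_rel (@relH_central K D k f).
by rewrite !rmorphM /= !free_to_pres_cst free_to_pres_gen.
Qed.

Lemma TH_poly k : \prod_j (TH k - cstH (@u K D k j)) = 0.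
Proof.
have := pres_rel (relH_poly K k); rewrite rmorph0 rmorph_prod => <-.
apply: eq_bigr => j _.
by rewrite rmorphB /= free_to_pres_cst free_to_pres_gen.
Qed.

Lemma TH_prod : \prod_(k < m D) TH k = cstH q.
Proof.
have := pres_rel (relH_prod K D); rewrite rmorph_prod /= free_to_pres_cst => E.
by rewrite -[RHS]E; apply: eq_bigr => k _; rewrite /= free_to_pres_gen.
Qed.

(** T_k is invertible, because it is a root of a polynomial whose constant term
    is invertible. *)
Lemma TH_inv_ex k : exists t, TH k * t = 1 /\ t * TH k = 1.
Proof.
have := TH_poly k.
rewrite -(big_map (@u K D k) xpredT (fun f => TH k - cstH f)).
set r := map _ _; rewrite (prod_coef (@TH_cst k)) big_ord_recl /= mulr1.
have [g gE] : has_inv (root_coef r 0).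
  rewrite root_coef_0 big_map; elim/big_ind: _ => [|a b|j _].
  - exact: has_inv1.
  - exact: has_invM.
  - apply: has_invN; exists (barR (@u K D k (- j))).
    by rewrite mulrC -[X in _ * @u K D k X]opprK bar_u.
set S := \sum_(i < size r) cstH (root_coef r i.+1) * TH k ^+ i.
have -> : \sum_(i < size r) cstH (root_coef r (bump 0 i)) * TH k ^+ bump 0 i = S * TH k.
  by rewrite mulr_suml; apply: eq_bigr => i _; rewrite -mulrA -exprSr.
have ST : S * TH k = TH k * S.
  rewrite mulr_suml mulr_sumr; apply: eq_bigr => i _.
  by rewrite -mulrA -exprSr mulrA TH_cst -mulrA -exprS.
move=> /eqP; rewrite addrC addr_eq0 => /eqP SE.
have gC : cstH g * cstH (root_coef r 0) = 1 by rewrite -rmorphM mulrC gE rmorph1.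
exists (- (cstH g * S)); split; last by rewrite mulNr -mulrA SE mulrN opprK.
by rewrite mulrN mulrA TH_cst -mulrA -ST SE mulrN opprK.
Qed.

Definition THV k : H := projT1 (cid (TH_inv_ex k)).
Lemma THVK k : TH k * THV k = 1.
Proof. by rewrite /THV; case: cid => t []. Qed.
Lemma THKV k : THV k * TH k = 1.
Proof. by rewrite /THV; case: cid => t []. Qed.
Lemma THV_cst k f : THV k * cstH f = cstH f * THV k.
Proof.
rewrite -[LHS]mulr1 -(THVK k) -!mulrA (mulrA (cstH f)) -TH_cst.
by rewrite !mulrA THKV mul1r.
Qed.

(** The product of the T_i with i < k, and its inverse [partial_prodV]. *)
Definition partial_prod k : H := \prod_(i <- take k (enum I)) TH i.
Definition partial_prodV k : H := \prod_(i <- rev (take k (enum I))) THV i.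

Lemma partial_prod_cst k f : partial_prod k * cstH f = cstH f * partial_prod k.
Proof.
rewrite /partial_prod; elim: (take _ _) => [|i r IHr]; first by rewrite big_nil mul1r mulr1.
by rewrite big_cons -mulrA IHr !mulrA TH_cst.
Qed.
Lemma partial_prodV_cst k f : partial_prodV k * cstH f = cstH f * partial_prodV k.
Proof.
rewrite /partial_prodV; elim: (rev _) => [|i r IHr]; first by rewrite big_nil mul1r mulr1.
by rewrite big_cons -mulrA IHr !mulrA THV_cst.
Qed.
Lemma partial_prodK k : partial_prodV k * partial_prod k = 1 /\
  partial_prod k * partial_prodV k = 1.
Proof.
rewrite /partial_prod /partial_prodV; elim: (take _ _) => [|i r [E1 E2]].
  by rewrite !big_nil mul1r.
rewrite rev_cons -cats1 big_cat big_seq1 big_cons /=; split.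
  by rewrite -mulrA (mulrA (THV i)) THKV mul1r.
by rewrite -mulrA (mulrA (\prod_(_ <- r) _)) E2 mul1r THVK.
Qed.

(** For the last k, [ordS k] is 0 and the equality is the relation
    T_1 ... T_m = q. *)
Lemma partial_prod_next k :
  partial_prodV k * partial_prod (ordS k) = cstH (qV ^+ delta k) * TH k.
Proof.
have take_next : take k.+1 (enum I) = rcons (take k (enum I)) k.
  by rewrite (take_nth k) ?size_enum_ord // nth_ord_enum.
have pTS : \prod_(i <- take k.+1 (enum I)) TH i = partial_prod k * TH k.
  by rewrite take_next -cats1 big_cat big_seq1.
have [K1 K2] := partial_prodK k.
rewrite /delta; case: eqP => km.
  have E : partial_prod k * TH k = cstH q.
    by rewrite -pTS km take_oversize ?size_enum_ord // -TH_prod enumT [index_enum _]unlock.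
  have -> : partial_prod (ordS k) = 1 by rewrite /partial_prod /= km modnn take0 big_nil.
  rewrite mulr1 expr1 -[TH k]mul1r -K1 -(mulrA (partial_prodV k)) E.
  rewrite partial_prodV_cst mulrA -rmorphM.
  by rewrite [qV * q]mulrC rqVK rmorph1 mul1r.
rewrite expr0 rmorph1 mul1r /partial_prod /= modn_small ?pTS ?mulrA ?K1 ?mul1r //.
by have := ltn_ord k; rewrite leq_eqVlt => /orP [/eqP|].
Qed.

Let HH : zmodType := (H * H)%type.

Lemma swap_additive k :
  zmod_morphism (fun p : HH => (partial_prodV k * p.2, partial_prod k * p.1) : HH).
Proof. by move=> p p'; congr pair; rewrite /= mulrBr. Qed.
(** The action of s_k on H + H. *)
Definition swap_endo k : endo HH := mkendo (swap_additive k).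

Lemma diag_additive f :
  zmod_morphism (fun p : HH => (cstH f * p.1, cstH (bar f) * p.2) : HH).
Proof. by move=> p p'; congr pair; rewrite /= mulrBr. Qed.
(** The action of a scalar on H + H; the second summand is twisted by the bar
    involution. *)
Definition diag_endo f : endo HH := mkendo (diag_additive f).

Lemma diag_endo_zmod_morphism : zmod_morphism diag_endo.
Proof.
by move=> f g; apply: endo_eq => p; congr pair; rewrite /= ?rmorphB mulrBl.
Qed.
Lemma diag_endo_monoid_morphism : monoid_morphism diag_endo.
Proof.
split=> [|f g]; apply: endo_eq => p; last first.
  by congr pair; rewrite /= ?rmorphM mulrA.
by case: p => x y; congr pair; rewrite /= ?rmorph1 mul1r.
Qed.
HB.instance Definition _ :=
  GRing.isZmodMorphism.Build R (endo HH) diag_endo diag_endo_zmod_morphism.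
HB.instance Definition _ :=
  GRing.isMonoidMorphism.Build R (endo HH) diag_endo diag_endo_monoid_morphism.

Lemma swap_endo_sq k : swap_endo k * swap_endo k = 1.
Proof.
have [K1 K2] := partial_prodK k; apply: endo_eq => -[x y]; rewrite endo_mulE /=.
by rewrite !mulrA K1 K2 !mul1r.
Qed.

Lemma swap_endo_diag k f : swap_endo k * diag_endo f = diag_endo (barR f) * swap_endo k.
Proof.
apply: endo_eq => -[x y]; rewrite !endo_mulE /=.
by rewrite barK !mulrA partial_prod_cst partial_prodV_cst.
Qed.

(** The relation holds on the first summand because it holds in H; it follows
    on the second one, which is the image of the first one under s_k. *)
Lemma swap_poly k :
  \prod_j (swap_endo k * swap_endo (ordS k) - diag_endo (br (k := k) j)) = 0.
Proof.
set Q := \prod_j _.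
have Qx x : Q (x, 0) = 0.
  have -> : Q (x, 0) =
      (\prod_j (partial_prodV k * partial_prod (ordS k) - cstH (@br k j)) * x, 0).
    rewrite /Q; elim/big_rec2: _ => [|j Q1 Q2 _ IH]; first by rewrite endo_oneE mul1r.
    rewrite endo_mulE IH; congr pair.
      rewrite -[LHS]/(partial_prodV k * (partial_prod (ordS k) * (Q1 * x)) -
        cstH (@br k j) * (Q1 * x)).
      by rewrite mulrBl mulrBl !mulrA.
    rewrite -[LHS]/(partial_prod k * (partial_prodV (ordS k) * 0) -
      cstH (bar (@br k j)) * 0).
    by rewrite !mulr0 subr0.
  rewrite (_ : \prod_j _ = 0) ?mul0r // partial_prod_next.
  transitivity (\prod_(j : 'Z_(d k)) (cstH (qV ^+ delta k) * (TH k - cstH (@u K D k j)))).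
    by apply: eq_bigr => j _; rewrite mulrBr /braid_root rmorphM.
  have [j|n ->] := @prod_comm_mull H _ (cstH (qV ^+ delta k))
     (fun j => TH k - cstH (@u K D k j)); last by rewrite TH_poly mulr0.
  by rewrite mulrBr mulrBl TH_cst -!rmorphM [_ * u _ _]mulrC.
(* Q kills the first summand, hence also its image under s_k. *)
have [g E] : exists g, Q * swap_endo k = g * Q.
  apply: (braid_poly_semicomm (@bar_braid_root K D k) (swap_endo_sq _) (swap_endo_sq _)
    (swap_endo_diag _) (swap_endo_diag _) (@barK _ _)); last exact: swap_endo_diag.
  by rewrite -mulrA.
apply: endo_eq => -[x y]; rewrite endo_zeroE.
have [K1 K2] := partial_prodK k.
have -> : (x, y) = (x, 0) + swap_endo k (partial_prodV k * y, 0) :> HH.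
  by congr pair; rewrite /= ?mulr0 ?addr0 // add0r mulrA K2 mul1r.
rewrite endoD Qx add0r -[LHS]/((Q * swap_endo k) (partial_prodV k * y, 0)) E endo_mulE Qx.
exact: endo0.
Qed.

Lemma HH_respects : respects (@relA K D) diag_endo swap_endo.
Proof.
move=> x y [k|k f|k].
- by rewrite rmorphXn /= freeLift_gen rmorph1 expr2 swap_endo_sq.
- rewrite !rmorphM /= !freeLift_cst freeLift_gen; exact: swap_endo_diag.
- rewrite rmorph_prod rmorph0 -[RHS](swap_poly k).
  apply: eq_bigr => j _; rewrite rmorphB /= freeLift_cst; congr (_ - _).
  by rewrite rmorphM /= !freeLift_gen.
Qed.

Definition act_HH : A -> endo HH := presLift HH_respects.
HB.instance Definition _ := GRing.RMorphism.on act_HH.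

(** H acts on the first summand by left multiplication. *)
Lemma act_HH_eta h (p : HH) : (act_HH (etaHA h) p).1 = h * p.1.
Proof.
elim/rquo_ind: h p; elim=> [f|k|a IHa|a IHa b IHb|a IHa b IHb] p.
- by rewrite -[rpi _ _]/(cstH f) eta_cst /act_HH presLift_cst.
- rewrite -[rpi _ _]/(TH k) eta_T !rmorphM /= /act_HH presLift_cst !presLift_gen /=.
  rewrite !mulrA -(mulrA (cstH _)) partial_prod_next !mulrA -rmorphM -exprMn rqVK expr1n.
  by rewrite rmorph1 mul1r.
- by rewrite rpiN !rmorphN mulNr -IHa.
- by rewrite rpiD !rmorphD mulrDl -IHa -IHb.
- by rewrite rpiM !rmorphM endo_mulE IHa IHb mulrA.
Qed.

Lemma eta_inj : injective (@etaHA K D).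
Proof.
move=> h h' E; have := act_HH_eta h (1, 0); rewrite E act_HH_eta /=.
by rewrite !mulr1.
Qed.

End Injectivity.

(** * The parity automorphism *)

Section Parity.
Variables (K : realType) (D : diagram).
Local Notation R := (RR K D).
Local Notation A := (A K D).
Local Notation H := (H K D).
Local Notation I := ('I_(m D)).
Local Notation q := (rq K[i] D : R).
Local Notation qV := (rqV K[i] D : R).
Local Notation W := (W D).

Lemma parity_respects : respects (@relA K D) (@cstA K D) (fun k => - sA K k).
Proof.
move=> x y [k|k f|k].
- by rewrite rmorphXn /= freeLift_gen rmorph1 expr2 mulrNN sA_sq.
- by rewrite !rmorphM /= !freeLift_cst freeLift_gen mulNr sA_cst mulrN.
- rewrite rmorph_prod rmorph0 -[RHS](sA_poly K k).
  apply: eq_bigr => j _; rewrite rmorphB /= freeLift_cst; congr (_ - _).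
  by rewrite rmorphM /= !freeLift_gen mulrNN.
Qed.

(** The automorphism s_k |-> - s_k of A over R. *)
Definition parity : A -> A := presLift parity_respects.
HB.instance Definition _ := GRing.RMorphism.on parity.

Lemma parity_cst f : parity (cstA f) = cstA f.
Proof. exact: presLift_cst. Qed.
Lemma parity_s k : parity (sA K k) = - sA K k.
Proof. exact: presLift_gen. Qed.
Lemma parity_scale (f : R) a : parity (f *: a) = f *: parity a.
Proof. by rewrite !scaleA rmorphM /= parity_cst. Qed.

Lemma parity_T w : parity (T_ K w) = (-1) ^+ size w *: T_ K w.
Proof.
elim: w => [|k w IHw]; first by rewrite T_0 rmorph1 scale1r.
rewrite T_cons rmorphM /= parity_s IHw mulNr s_scale exprS -scalerA scaleN1r.
by rewrite rmorphXn rmorphN1.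
Qed.

Lemma parity_eta h : parity (etaHA h) = etaHA h.
Proof.
elim/rquo_ind: h; elim=> [f|k|a IHa|a IHa b IHb|a IHa b IHb].
- by rewrite -[rpi _ _]/(cstH f) eta_cst parity_cst.
- by rewrite -[rpi _ _]/(TH K k) eta_T !rmorphM /= parity_cst !parity_s mulrN mulrN mulNr opprK.
- by rewrite rpiN !rmorphN /= IHa.
- by rewrite rpiD !rmorphD /= IHa IHb.
- by rewrite rpiM !rmorphM /= IHa IHb.
Qed.

Lemma has_inv2 : exists f : R, f * 2%:R = 1.
Proof.
exists (rc D 2^-1); apply: coordRing_eq => p.
rewrite -[LHS]/(2^-1 * (1 + 1) : K[i]) -[RHS]/(1 : K[i]).
by rewrite mulVf // pnatr_eq0.
Qed.

(** s_k s_l is a product of factors s_i s_(i+1), going round the cycle from k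
    to l. *)
Lemma eta_ss (k l : I) : exists h : H, etaHA h = sA K k * sA K l.
Proof.
have fwd n : exists h : H, etaHA h = sA K k * sA K (iter n (@ordS (m D)) k).
  elim: n => [|n [h hE]]; first by exists 1; rewrite rmorph1 sA_sq.
  set j := iter n _ k in hE.
  exists (h * (cstH (qV ^+ delta j) * TH K j)).
  rewrite !rmorphM /= hE eta_cst eta_T -!mulrA (mulrA (cstA _) (cstA _)) -rmorphM.
  rewrite -exprMn [qV * q]mulrC rqVK expr1n rmorph1 mul1r (mulrA (sA K j)) sA_sq mul1r.
  by rewrite /= -/j.
have [h hE] := fwd (l + m D - k)%N; exists h; rewrite hE; congr (_ * sA K _).
have iterE n : iter n (@ordS (m D)) k = ((k + n) %% m D)%N :> nat.
  elim: n => [|n IHn]; first by rewrite addn0 modn_small.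
  by rewrite /= IHn -addn1 modnDml addn1 addnS.
apply: val_inj; rewrite /= iterE subnKC; last by have := ltn_ord k; lia.
by rewrite modnDr modn_small.
Qed.

Lemma eta_T_even w : ~~ odd (size w) -> exists h : H, etaHA h = T_ K w.
Proof.
move: {2}(size w) (leqnn (size w)) => n; elim: n w => [|n IHn] [|k [|l w]] //= le ev;
  try by exists 1; rewrite rmorph1 T_0.
rewrite negbK in ev; have [||h hE] := IHn w; rewrite ?ev //; first exact: ltnW.
have [g gE] := eta_ss k l; exists (g * h).
by rewrite rmorphM /= gE hE !T_cons mulrA.
Qed.

End Parity.

(** * Bases adapted to a filtration *)

Section QuotientLinear.
Variables (R : pzRingType) (M : lmodType R) (G : submodClosed M).
Local Notation quopi := (@quopi R M G).

Lemma quopi0 : quopi 0 = 0.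
Proof.
by apply: (@addrI _ (quopi 0)); rewrite -quopiD !addr0.
Qed.

Lemma quopi_eq0 v : quopi v = 0 <-> v \in G.
Proof. by rewrite -quopi0 quopiP subr0. Qed.

Lemma quopiZ a v : quopi (a *: v) = a *: quopi v.
Proof. exact/esym/quo_scaleE. Qed.

Lemma quopi_lin J (r : seq J) (P : pred J) (c : J -> R) (b : J -> M) :
  quopi (\sum_(j <- r | P j) c j *: b j) = \sum_(j <- r | P j) c j *: quopi (b j).
Proof.
rewrite (big_morph quopi (id1 := 0) (op1 := +%R)); first last.
- exact: quopi0.
- exact: quopiD.
by apply: eq_bigr => j _; rewrite quopiZ.
Qed.

End QuotientLinear.

Section FilteredBasis.
Variables (D : diagram) (R : comPzRingType) (M : lmodType R).
Variables (F : nat -> submodClosed M) (p : pred (W D)) (b : W D -> M).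
Local Notation len := (@lengthW D).

(** The elements of length at most N that satisfy p. *)
Definition pball N := [seq x <- ball D N | p x].
(** The elements of length N that satisfy p. *)
Definition psphere N := [seq x <- pball N | len x == N].

Hypothesis b_in : forall N x, p x -> (len x <= N)%N -> b x \in F N.
Hypothesis b_span : forall N v, v \in F N ->
  exists c : W D -> R, v = \sum_(x <- pball N) c x *: b x.
Hypothesis b_free : forall (s : seq (W D)) (c : W D -> R), uniq s ->
  {in s, forall x, p x} -> \sum_(x <- s) c x *: b x = 0 ->
  {in s, forall x, c x = 0}.
Hypothesis F_ex : forall v, exists N, v \in F N.

Lemma mem_pball N x : (x \in pball N) = p x && (len x <= N)%N.
Proof. by rewrite mem_filter mem_ball. Qed.

Lemma mem_psphere N x : (x \in psphere N) = p x && (len x == N).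
Proof. by rewrite mem_filter mem_pball; case: eqP => [->|_]; rewrite ?leqnn ?andbT ?andbF. Qed.

Lemma pball_uniq N : uniq (pball N).
Proof. by rewrite filter_uniq ?ball_uniq. Qed.
Lemma psphere_uniq N : uniq (psphere N).
Proof. by rewrite filter_uniq ?pball_uniq. Qed.

Lemma basis_F N : is_basis [set` F N] [set x | p x /\ (len x <= N)%N] b.
Proof.
split=> [x /= [px xN]|v /= /b_span [c ->]|s c us sP].
- exact: b_in.
- by exists (pball N), c; split=> // x; rewrite mem_pball => /andP.
- by apply: b_free => // x /sP [].
Qed.

Lemma basis_setT : is_basis [set: M] [set x | p x] b.
Proof.
split=> [//|v _|s c us sP]; last by apply: b_free => // x /sP.
have [N /b_span [c ->]] := F_ex v.
by exists (pball N), c; split=> // x; rewrite mem_pball => /andP [].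
Qed.

Lemma gr_rank N : is_free_of_rank (gr F N) (size (psphere N)).
Proof.
set G := filprev F N; set s := psphere N.
pose xi (i : 'I_(size s)) := nth 1%g s i.
have xi_s i : xi i \in s by apply: mem_nth.
have low x : p x -> (len x < N)%N -> quopi G (b x) = 0.
  move=> px lt; apply/quopi_eq0; rewrite /G.
  by case: (N) lt => // n lt; apply: b_in.
exists (fun i => quopi G (b (xi i))); split=> [i _|v|s' e us' _ sum0].
- exists (b (xi i)) => //=; have := xi_s i; rewrite mem_psphere => /andP [px /eqP xN].
  by apply: b_in => //; rewrite xN.
- case=> u /= /b_span [c ->] <-; exists (index_enum 'I_(size s)), (c \o xi).
  split=> //; rewrite quopi_lin (bigID (fun x => len x == N)) /= [X in _ + X]big1_seq.
    by rewrite addr0 -big_filter -/s (big_nth 1%g) big_mkord.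
  move=> x /andP [xN]; rewrite mem_pball => /andP [px le].
  by rewrite low ?scaler0 // ltn_neqAle xN.
(* A combination of elements of length N that lies in the previous step of the
   filtration is also a combination of shorter elements. *)
have [g [B [uB Bp E]]] : exists g B, [/\ uniq B,
    forall x, x \in B -> p x /\ (len x < N)%N &
    \sum_(i <- s') e i *: b (xi i) = \sum_(x <- B) g x *: b x].
  have : \sum_(i <- s') e i *: b (xi i) \in G by apply/quopi_eq0; rewrite quopi_lin.
  rewrite /G; case: (N) => [|n] /=.
    move=> /eqP ->; exists (fun _ => 0), [::]; split=> //.
    by rewrite big_nil.
  case/b_span => g gE; exists g, (pball n); split=> //; first exact: pball_uniq.
  by move=> x; rewrite mem_pball => /andP.
pose e' x := oapp e 0 (insub (index x s)).
have e'E i : e' (xi i) = e i by rewrite /e' /xi index_uniq ?psphere_uniq // valK.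
pose h x := if len x == N then e' x else - g x.
have xi_len i : len (xi i) = N by have := xi_s i; rewrite mem_psphere => /andP [_ /eqP].
have xi_inj : injective xi.
  move=> i j /eqP; rewrite nth_uniq ?psphere_uniq // => /eqP ij; exact: val_inj.
have ut : uniq (map xi s' ++ B).
  rewrite cat_uniq map_inj_uniq // us' uB andbT /=; apply/hasPn => x /Bp [_ lt].
  by apply/mapP => -[i _ xE]; move: lt; rewrite xE xi_len ltnn.
have tp : {in map xi s' ++ B, forall x, p x}.
  move=> x; rewrite mem_cat => /orP [/mapP [i _ ->]|/Bp [] //].
  by have := xi_s i; rewrite mem_psphere => /andP [].
have sumt : \sum_(x <- map xi s' ++ B) h x *: b x = 0.
  rewrite big_cat big_map /=.
  rewrite (eq_bigr (fun i => e i *: b (xi i))) => [|i _]; last first.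
    by rewrite /h xi_len eqxx e'E.
  rewrite E [X in _ + X]big_seq [X in _ + X](eq_bigr (fun x => - (g x *: b x))).
    by rewrite sumrN -big_seq subrr.
  by move=> x /Bp [_ lt]; rewrite /h ltn_eqF // scaleNr.
move=> i is'; rewrite -e'E; have := b_free ut tp sumt (x := xi i).
rewrite /h xi_len eqxx; apply; rewrite mem_cat map_f //.
Qed.

Lemma psphere_card N : ([set x | p x /\ len x = N] #= `I_(size (psphere N)))%card.
Proof.
apply/card_set_bijP; exists (fun x => index x (psphere N)); split.
- move=> x [px xN] /=; rewrite index_mem mem_psphere px.
  exact/eqP.
- move=> x y; rewrite !inE => -[px /eqP xN] [py /eqP yN] E.
  have xs : x \in psphere N by rewrite mem_psphere px.
  have ys : y \in psphere N by rewrite mem_psphere py.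
  by rewrite -(nth_index 1%g xs) E nth_index.
- move=> i /= lt; exists (nth 1%g (psphere N) i); last by rewrite index_uniq ?psphere_uniq.
  by have := mem_nth 1%g lt; rewrite mem_psphere => /andP [px /eqP].
Qed.

End FilteredBasis.

(** * The length filtrations of A and H *)

Section Final.
Variables (K : realType) (D : diagram) (w : W D -> seq 'I_(m D)).
Hypothesis w_red : forall x : W D, reduced_decomposition x (w x).
Local Notation R := (RR K D).
Local Notation T := (fun x : W D => T_ K (w x)).
Local Notation len := (@lengthW D).

Lemma FLA_in N x : (len x <= N)%N -> T x \in FLA K D N.
Proof.
move=> le; apply/asboolP; move: le; have [_ <-] := w_red x => le.
exact: length_le_leq le (length_le_T _ _).
Qed.

Lemma FLA_span N (v : A K D) : v \in FLA K D N ->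
  exists c : W D -> R, v = \sum_(x <- pball xpredT N) c x *: T x.
Proof.
move=> /asboolP /(length_le_lower w_red) [c ->]; exists c.
rewrite -big_filter; apply: perm_big.
apply: uniq_perm; rewrite ?filter_uniq ?ball_uniq // => x.
by rewrite !mem_filter !mem_ball ltnS /=; case: leqP => // /leqW.
Qed.

Lemma FLA_ex (v : A K D) : exists N, v \in FLA K D N.
Proof. by have [N vN] := length_le_ex v; exists N; apply/asboolP. Qed.

Definition even_word : pred (W D) := fun x => ~~ odd (len x).

(** The preimage of T_(w(x)) in H for x even; the value 0 at odd x is not used. *)
Definition even_lift (x : W D) : H K D := xget 0 [set h | etaHA h = T x].

Lemma eta_even_lift x : even_word x -> etaHA (even_lift x) = T x.
Proof.
move=> ex; apply: (@xgetPex _ 0 [set h | etaHA h = T x]).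
by apply: eta_T_even; have [_ ->] := w_red x.
Qed.

Lemma FLH_in N x : even_word x -> (len x <= N)%N -> even_lift x \in FLH K D N.
Proof.
by move=> ex le; rewrite -[_ \in _]/(etaHA (even_lift x) \in FLA K D N) eta_even_lift ?FLA_in.
Qed.

(** As the image of eta is fixed by the parity automorphism, the coefficients at
    odd x vanish, by linear independence and because 2 is invertible. *)
Lemma FLH_span N (v : H K D) : v \in FLH K D N ->
  exists c : W D -> R, v = \sum_(x <- pball even_word N) c x *: even_lift x.
Proof.
rewrite -[_ \in _]/(etaHA v \in FLA K D N) => /FLA_span [c vE]; exists c.
apply: eta_inj; rewrite rmorph_sum.
transitivity (\sum_(x <- pball even_word N) c x *: T x); last first.
  rewrite !big_filter; apply: eq_bigr => x ex.
  by rewrite /= eta_scale eta_even_lift.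
pose e x : R := c x - (-1) ^+ len x * c x.
have e0 : {in pball xpredT N, forall x, e x = 0}.
  apply: (T_free w_red); first exact: pball_uniq.
  under eq_bigr do rewrite scalerBl.
  rewrite sumrB -vE -[X in X - _]parity_eta vE rmorph_sum /= -sumrB big1 // => x _.
  have [_ wl] := w_red x.
  by rewrite parity_scale parity_T wl scalerA mulrC subrr.
rewrite vE /pball filter_predT [RHS]big_filter (bigID even_word) /=.
rewrite [X in _ + X]big1_seq ?addr0 //.
move=> x /andP [ox xN].
have := e0 x; rewrite /pball filter_predT => /(_ xN); rewrite /e.
move: ox; rewrite /even_word negbK -signr_odd => ->.
rewrite mulN1r opprK => c2; have [f f2] := has_inv2 K D.
have -> : c x = f * (c x + c x) by rewrite -mulr2n -mulr_natl mulrA f2 mul1r.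
by rewrite c2 mulr0 scale0r.
Qed.

Lemma even_lift_free (s : seq (W D)) (c : W D -> R) : uniq s ->
  {in s, forall x, even_word x} -> \sum_(x <- s) c x *: even_lift x = 0 ->
  {in s, forall x, c x = 0}.
Proof.
move=> us se s0; apply: (T_free w_red us).
transitivity (etaHA (\sum_(x <- s) c x *: even_lift x)); last by rewrite s0 rmorph0.
rewrite rmorph_sum.
by apply: eq_big_seq => x xs; rewrite /= eta_scale eta_even_lift // se.
Qed.

Lemma FLH_ex (v : H K D) : exists N, v \in FLH K D N.
Proof. by have [N vN] := FLA_ex (etaHA v); exists N. Qed.

End Final.

Theorem theorem5p1 (K : realType) (D : diagram) (w : W D -> seq 'I_(m D))
    (w_reduced : forall x : W D, reduced_decomposition x (w x)) :
  let T (x : W D) : A K D := T_ K (w x) in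
  [/\ is_basis [set: A K D] [set: W D] T /\
      is_basis_along (@etaHA K D) [set: H K D] (@evenW D) T,
      forall N : nat,
        is_basis [set` FLA K D N] [set x : W D | (lengthW x <= N)%N] T /\
        is_basis_along (@etaHA K D) [set` FLH K D N]
          [set x : W D | evenW x /\ (lengthW x <= N)%N] T
    & (forall N : nat, is_free (gr (FLH K D) N) /\ is_free (gr (FLA K D) N)) /\
      (exists h : nat -> nat,
         hilbert_series (FLA K D) h /\ length_series [set: W D] h) /\
      (exists h : nat -> nat,
         hilbert_series (FLH K D) h /\ length_series (@evenW D) h)].
Proof.
move=> T.
have A_in N x : xpredT x -> (lengthW x <= N)%N -> T x \in FLA K D N.
  by move=> _; apply: FLA_in.
have A_free (s : seq (W D)) (c : W D -> RR K D) : uniq s -> {in s, forall x, xpredT x} ->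
    \sum_(x <- s) c x *: T x = 0 -> {in s, forall x, c x = 0}.
  by move=> us _; apply: T_free.
have A_gr := gr_rank A_in (@FLA_span K D w w_reduced) A_free.
have H_gr := gr_rank (@FLH_in K D w w_reduced) (@FLH_span K D w w_reduced)
  (@even_lift_free K D w w_reduced).
have rank_free (R : pzRingType) (M : lmodType R) (S : set M) n :
    is_free_of_rank S n -> is_free S by case=> b bS; exists 'I_n, b.
split.
- split.
    have := basis_setT (@FLA_span K D w w_reduced) A_free (@FLA_ex K D).
    by rewrite (_ : [set x | xpredT x] = setT) //; apply/seteqP; split.
  exists (@even_lift K D w); split; first by move=> x ex; apply: eta_even_lift.
  exact: basis_setT (@FLH_span K D w w_reduced)
    (@even_lift_free K D w w_reduced) (@FLH_ex K D).
- move=> N; split.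
    have := basis_F A_in (@FLA_span K D w w_reduced) A_free N.
    rewrite (_ : [set x | xpredT x /\ (lengthW x <= N)%N] = [set x | (lengthW x <= N)%N]) //.
    by apply/seteqP; split=> x // [].
  exists (@even_lift K D w); split; first by move=> x [ex _]; apply: eta_even_lift.
  exact: basis_F (@FLH_in K D w w_reduced) (@FLH_span K D w w_reduced)
    (@even_lift_free K D w w_reduced) N.
- split; first by move=> N; split; apply: rank_free; [exact: H_gr | exact: A_gr].
  split; [exists (fun N => size (psphere (D := D) xpredT N)) |
          exists (fun N => size (psphere (@even_word D) N))]; split=> //.
  + move=> N; have := psphere_card (D := D) xpredT N.
    by rewrite (_ : [set x | xpredT x /\ lengthW x = N] = [set x | setT x /\ lengthW x = N]) //;
      apply/seteqP; split=> x [].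
  + move=> N; exact: psphere_card.
Qed.
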